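(* $\mathfrak{H}[0,1]\subset\mathrm{Dom}(\delta)$, and $\delta$ restricted to $\mathfrak{H}[0,1]$ coincides with the Itô–Clifford integral: for every $u\in\mathfrak{H}[0,1]$, $$\delta(u)=\int_0^1 d\Psi_t\,u_t .$$
   Context: $L^2(\mathbb{R}_+)$ is the complex $L^2$ space for Lebesgue measure (inner products linear in the second variable), with complex conjugation $J$. For $h\in L^2(\mathbb{R}_+^n)$ its anti-symmetrization is $\hat h(t_1,\dots,t_n)=\frac1{n!}\sum_{\sigma\in S_n}\mathrm{sgn}(\sigma)h(t_{\sigma(1)},\dots,t_{\sigma(n)})$. $\Lambda_n$ is the space of anti-symmetric functions in $L^2(\mathbb{R}_+^n)$ with inner product $\langle f,g\rangle_{\Lambda_n}=n!\int\overline{f}g\,d\mathbf{x}$, and $\Lambda_0=\mathbb{C}$. $\Gamma_a=\bigoplus_{n\ge0}\Lambda_n$ is the anti-symmetric Fock space (Hilbert direct sum) with vacuum vector $\Omega=1\in\Lambda_0$. For $z\in L^2(\mathbb{R}_+)$, $b^*(z)$ is the bounded operator with $b^*(z)w=\widehat{z\otimes w}$ for $w\in\Lambda_n$, $b(z)$ is its adjoint, and $\Psi(z)=b^*(z)+b(Jz)$. $\mathcal{C}$ is the von Neumann algebra generated by $\{\Psi(z)\}$, and $m(u)=\langle\Omega,u\Omega\rangle$ is a faithful normal tracial state on it; $L^2(\mathcal{C})$ is the completion of $\mathcal{C}$ for the inner product $m(u^*v)$ (a $\mathcal{C}$-bimodule). The map $u\mapsto u\Omega$ extends to a unitary $L^2(\mathcal{C})\to\Gamma_a$,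 and for $f\in\Lambda_n$, $J_n(f)\in L^2(\mathcal{C})$ denotes the element mapped to $f$ by this unitary; $J_{-1}(\cdot)=0$. On finite sums of $J_n(v_n)$, $v_n\in\Lambda_n$, $\mathcal{D}$ is defined by linearity and $\mathcal{D}_t(J_n(v_n))=nJ_{n-1}(v_n(t,\cdot))$, as an operator into $L^2(\mathbb{R}_+)\otimes L^2(\mathcal{C})\cong L^2(\mathbb{R}_+;L^2(\mathcal{C}))$ (inner product $\int m(u_t^*v_t)\,dt$); it is closable, and $\mathcal{D}$ also denotes its closure, with domain $\mathrm{Dom}(\mathcal{D})$. The divergence $\delta$ is the adjoint of $\mathcal{D}$: $\mathrm{Dom}(\delta)$ is the set of $u\in L^2(\mathbb{R}_+)\otimes L^2(\mathcal{C})$ for which there is a constant $c$ with $|\langle\mathcal{D}_\cdot F,u\rangle|\le c\|F\|_{L^2(\mathcal{C})}$ for all $F\in\mathrm{Dom}(\mathcal{D})$, and $\langle F,\delta(u)\rangle=\langle\mathcal{D}_\cdot F,u\rangle$. It extends the operator given on finite sums by $\delta(J_n(w_n(t,\cdot)))=J_{n+1}(\hat w_n)$ for $w_n\in L^2(\mathbb{R}_+^{n+1})$ with $w_n(t,\cdot)\in\Lambda_n$ (anti-symmetrization in all $n+1$ variables). $\mathcal{C}_t$ is the von Neumann subalgebra generated by $\{\Psi(u):u\in L^2(\mathbb{R}_+),\ \mathrm{supp}(u)\subset[0,t]\}$, $L^2(\mathcal{C}_t)$ is the closure of $\mathcal{C}_t$ in $L^2(\mathcal{C})$, and $\Psi_t=\Psi(\mathbf{1}_{[0,t]})$.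 $\mathfrak{H}[0,1]$ is the set of $u\in L^2([0,1];L^2(\mathcal{C}))$ that are adapted, i.e. $u_s\in L^2(\mathcal{C}_s)$ for a.e. $s\in[0,1]$; such $u$ is viewed in $L^2(\mathbb{R}_+)\otimes L^2(\mathcal{C})$ by extending it by $0$. For a simple adapted process $h=\sum_{k=1}^n h_{k-1}\mathbf{1}_{[t_{k-1},t_k)}$ with $0\le t_0\le\dots\le t_n\le 1$ and $h_k\in L^2(\mathcal{C}_{t_k})$, the (left) Itô–Clifford integral is $\int_0^1 d\Psi_s\,h(s)=\sum_{k=1}^n(\Psi_{t_k}-\Psi_{t_{k-1}})h_{k-1}$. Simple adapted processes are dense in $\mathfrak{H}[0,1]$, the integral is an isometry into $L^2(\mathcal{C})$ on them, and the Itô–Clifford integral on $\mathfrak{H}[0,1]$ is its continuous extension. *)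

(* Defs.v *)
From HB Require Import structures.
From mathcomp Require Import all_boot all_order all_algebra.
From mathcomp Require Import perm complex.
From mathcomp Require Import all_classical all_reals all_analysis.
From mathcomp Require Import measurable_realfun.
From mathcomp Require Import ring lra.
Set Implicit Arguments. Unset Strict Implicit. Unset Printing Implicit Defensive.
Import Order.TTheory GRing.Theory Num.Theory.
Import numFieldNormedType.Exports.
Import ComplexField.Normc.
Local Open Scope classical_set_scope.
Local Open Scope ring_scope.
Local Open Scope complex_scope.

(* Complex pre-Hilbert spaces: the form is linear in its second argument and
   only positive semidefinite; definiteness is required of Hilbert spaces. *)
HB.mixin Record Lmodule_isPreHilbert (R : realType) V of GRing.Lmodule R[i] V := {
  dot : V -> V -> R[i];
  dotDr : forall u v w, dot u (v + w) = dot u v + dot u w;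
  dotZr : forall (a : R[i]) u v, dot u (a *: v) = a * dot u v;
  dotC : forall u v, dot u v = (dot v u)^*%C;
  dot_ge0 : forall u, 0 <= dot u u }.
#[short(type="preHilbertType")]
HB.structure Definition PreHilbert (R : realType) :=
  { V of Lmodule_isPreHilbert R V & GRing.Lmodule R[i] V }.

Definition hnorm (R : realType) (V : preHilbertType R) (u : V) : R :=
  Num.sqrt (complex.Re (dot u u)).

Definition hcvg (R : realType) (V : preHilbertType R) (x : nat -> V) (l : V) :=
  hnorm (x k - l) @[k --> \oo] --> (0 : R).

Definition hcauchy (R : realType) (V : preHilbertType R) (x : nat -> V) :=
  forall e : R, 0 < e -> exists N, forall m n, (N <= m)%N -> (N <= n)%N ->
    hnorm (x m - x n) < e.

HB.mixin Record PreHilbert_isHilbert (R : realType) V of PreHilbert R V := {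
  dot_eq0 : forall u : V, dot u u = 0 -> u = 0;
  hcomplete : forall x : nat -> V, hcauchy x -> exists l, hcvg x l }.
#[short(type="hilbertType")]
HB.structure Definition Hilbert (R : realType) :=
  { V of PreHilbert_isHilbert R V & PreHilbert R V }.



Arguments hnorm {R V}.
Section prehilbert_theory.
Variables (R : realType) (V : preHilbertType R).
Implicit Types u v w : V.

Lemma dotDl u v w : dot (u + v) w = dot u w + dot v w.
Proof. by rewrite dotC dotDr rmorphD/= -!dotC. Qed.

Lemma dotZl (a : R[i]) u v : dot (a *: u) v = a^*%C * dot u v.
Proof. by rewrite dotC dotZr rmorphM/= -dotC. Qed.

Lemma dot0r u : dot u 0 = 0.
Proof. by rewrite -(scale0r (0 : V)) dotZr mul0r. Qed.

Lemma dotNr u v : dot u (- v) = - dot u v.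
Proof. by rewrite -scaleN1r dotZr mulN1r. Qed.

Lemma dotNl u v : dot (- u) v = - dot u v.
Proof. by rewrite dotC dotNr rmorphN/= -dotC. Qed.

Lemma Re_dot_ge0 u : 0 <= complex.Re (dot u u).
Proof. by have := dot_ge0 u; rewrite lecE => /andP[]. Qed.

Lemma dotuu u : dot u u = (hnorm u ^+ 2)%:C.
Proof.
rewrite /hnorm sqr_sqrtr ?Re_dot_ge0//.
by have := ger0_Im (dot_ge0 u); case: (dot u u) => a b /= ->.
Qed.

Lemma hnorm_ge0 u : 0 <= hnorm u. Proof. exact: sqrtr_ge0. Qed.

Lemma Re_dotC u v : complex.Re (dot u v) = complex.Re (dot v u).
Proof. by rewrite dotC; case: (dot v u). Qed.

Lemma hnormD2 u v :
  hnorm (u + v) ^+ 2 = hnorm u ^+ 2 + hnorm v ^+ 2 + 2 * complex.Re (dot u v).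
Proof.
rewrite /hnorm !sqr_sqrtr ?Re_dot_ge0// dotDl !dotDr.
have := Re_dotC u v.
case: (dot u u) => ? ?; case: (dot u v) => ? ?; case: (dot v u) => ? ?.
by case: (dot v v) => ? ? /= ->; ring.
Qed.

Lemma hnormZ (a : R[i]) u : hnorm (a *: u) = normc a * hnorm u.
Proof.
rewrite /hnorm dotZl dotZr mulrA [_ * a]mulrC -sqr_normc normc_def dotuu.
case: a => a b; rewrite /normc -[RHS]sqrtrM ?addr_ge0 ?sqr_ge0//.
congr Num.sqrt; rewrite -rmorphXn -rmorphM/= sqr_sqrtr ?addr_ge0 ?sqr_ge0//.
Qed.

Lemma hnormN u : hnorm (- u) = hnorm u.
Proof. by rewrite /hnorm dotNl dotNr opprK. Qed.

Lemma hnorm0 : hnorm (0 : V) = 0.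
Proof. by rewrite /hnorm dot0r sqrtr0. Qed.

Lemma Re_dot_le u v : complex.Re (dot u v) <= hnorm u * hnorm v.
Proof.
have H (s : R) : 0 <= hnorm u ^+ 2 - 2 * s * complex.Re (dot u v)
    + s ^+ 2 * hnorm v ^+ 2.
  have := sqr_ge0 (hnorm (u + (- s)%:C *: v)).
  rewrite hnormD2 hnormZ dotZr /normc /= expr0n/= addr0 sqrtr_sqr exprMn.
  rewrite real_normK ?num_real// sqrrN; case: (dot u v) => a b /=.
  by congr (is_true (_ <= _)); ring.
have [A0 B0] := (hnorm_ge0 u, hnorm_ge0 v).
move: H A0 B0; move: (hnorm u) (hnorm v) (complex.Re _) => A B c H A0 B0.
have [B00|B00] := eqVneq B 0.
  rewrite B00 mulr0 leNgt; apply/negP => c0.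
  have := H ((A ^+ 2 + 1) / (2 * c)); rewrite B00 expr0n mulr0 addr0.
  rewrite (_ : 2 * _ * c = A ^+ 2 + 1); last by field; rewrite gt_eqF.
  by rewrite opprD addrA subrr sub0r ler0N1.
have Bp : 0 < B by rewrite lt_neqAle eq_sym B00.
have [A00|A00] := eqVneq A 0.
  rewrite A00 mul0r leNgt; apply/negP => c0.
  have := H (c / B ^+ 2); rewrite A00.
  rewrite (_ : _ + _ = - (c ^+ 2 / B ^+ 2)); last by field; rewrite gt_eqF.
  by rewrite oppr_ge0 leNgt divr_gt0// exprn_gt0.
have Ap : 0 < A by rewrite lt_neqAle eq_sym A00.
have := H (A / B).
rewrite (_ : _ + _ = 2 * (A / B) * (A * B - c)); last by field; rewrite gt_eqF.
by rewrite pmulr_rge0 ?subr_ge0// mulr_gt0 ?divr_gt0.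
Qed.

Lemma hnorm_triangle u v : hnorm (u + v) <= hnorm u + hnorm v.
Proof.
rewrite -(@ler_pXn2r _ 2%N)// ?nnegrE ?addr_ge0 ?hnorm_ge0//.
by rewrite hnormD2; have := Re_dot_le u v; nra.
Qed.

Lemma hnormBC u v : hnorm (u - v) = hnorm (v - u).
Proof. by rewrite -hnormN opprB. Qed.

Lemma hnorm_dist u v w : hnorm (u - w) <= hnorm (u - v) + hnorm (v - w).
Proof. by have := hnorm_triangle (u - v) (v - w); rewrite addrA subrK. Qed.

Lemma hnorm_dist_dist u v : `|hnorm u - hnorm v| <= hnorm (u - v).
Proof.
rewrite ler_norml; apply/andP; split.
  have := hnorm_triangle (v - u) u; rewrite subrK hnormBC; lra.
have := hnorm_triangle (u - v) v; rewrite subrK; lra.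
Qed.

Lemma Re_dotE u v :
  complex.Re (dot u v) = (hnorm (u + v) ^+ 2 - hnorm (u - v) ^+ 2) / 4.
Proof.
rewrite !hnormD2 dotNr hnormN; by case: (dot u v) => a b /=; field.
Qed.

Lemma Im_dotE u v : complex.Im (dot u v) = complex.Re (dot (('i)%C *: u) v).
Proof. by rewrite dotZl; case: (dot u v) => a b /=; ring. Qed.

Lemma hcauchyP (x : nat -> V) : hcauchy x ->
  cvgn (hnorm \o x).
Proof.
move=> cx; apply/cauchy_cvgP/cauchy_exP => e e0.
have [N HN] := cx _ e0; exists (hnorm (x N)).
exists N => // n /= Nn.
by rewrite /ball/= (le_lt_trans (hnorm_dist_dist _ _))// HN.
Qed.

Lemma hcauchyD (x y : nat -> V) : hcauchy x -> hcauchy y -> hcauchy (x + y).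
Proof.
move=> cx cy e e0; have e2 : 0 < e / 2 by rewrite divr_gt0.
have [N HN] := cx _ e2; have [M HM] := cy _ e2.
exists (maxn N M) => m n; rewrite !geq_max => /andP[Nm Mm] /andP[Nn Mn].
rewrite (_ : _ - _ = (x m - x n) + (y m - y n)); last first.
  by rewrite /= opprD addrACA.
rewrite (le_lt_trans (hnorm_triangle _ _))//.
by rewrite [ltRHS]splitr ltrD ?HN ?HM.
Qed.

Lemma hcauchyZ a (x : nat -> V) : hcauchy x -> hcauchy (a *: x).
Proof.
move=> cx e e0; have a0 : 0 <= normc a by case: a => ? ?; exact: sqrtr_ge0.
have e2 : 0 < e / (normc a + 1) by rewrite divr_gt0// ltr_wpDl.
have [N HN] := cx _ e2; exists N => m n Nm Nn.
rewrite /= -scalerBr hnormZ.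
have := HN _ _ Nm Nn; rewrite ltr_pdivlMr ?ltr_wpDl// => h.
by rewrite (le_lt_trans _ h)// mulrC ler_wpM2l ?hnorm_ge0// lerDl.
Qed.

Lemma hcauchy_cst (v : V) : hcauchy (fun=> v).
Proof. by move=> e e0; exists 0%N => *; rewrite subrr hnorm0. Qed.

Lemma is_cvg_Re_dot (x y : nat -> V) : hcauchy x -> hcauchy y ->
  cvgn (fun k => complex.Re (dot (x k) (y k))).
Proof.
move=> cx cy; under eq_fun do rewrite Re_dotE.
have cy' := hcauchyZ (-1) cy.
have sq (z : nat -> R) : cvgn z -> cvgn (fun k => z k ^+ 2).
  by move=> cz; under eq_fun do rewrite expr2; exact: is_cvgM.
apply: is_cvgMl; apply: is_cvgB; apply: sq.
  exact: (hcauchyP (hcauchyD cx cy)).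
have := hcauchyP (hcauchyD cx cy').
by congr (cvgn _); apply/funext => k /=; rewrite scaleN1r.
Qed.

Lemma is_cvg_Im_dot (x y : nat -> V) : hcauchy x -> hcauchy y ->
  cvgn (fun k => complex.Im (dot (x k) (y k))).
Proof.
move=> cx cy; under eq_fun do rewrite Im_dotE.
exact: (is_cvg_Re_dot (hcauchyZ _ cx) cy).
Qed.

End prehilbert_theory.

Section cauchy_sequences.
Variables (R : realType) (V : preHilbertType R).

Definition cauchy_pred : {pred nat -> V} := [pred x | `[< hcauchy x >]].

Lemma cauchy_pred_submod : submod_closed cauchy_pred.
Proof.
split=> [|a x y].
  by apply/asboolP; exact: (hcauchy_cst (0 : V)).
move=> /asboolP cx /asboolP cy; apply/asboolP.
exact: hcauchyD (hcauchyZ a cx) cy.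
Qed.
HB.instance Definition _ :=
  GRing.isSubmodClosed.Build R[i] (nat -> V) cauchy_pred cauchy_pred_submod.

(* The Hilbert space completion of a pre-Hilbert space: Cauchy sequences modulo
   sequences at vanishing distance. Vectors of zero norm are identified with 0. *)
Record cauchy_seq := CauchySeq {
  cauchy_seq_val :> nat -> V; _ : cauchy_seq_val \in cauchy_pred }.
HB.instance Definition _ := [isSub for cauchy_seq_val].
HB.instance Definition _ := [Choice of cauchy_seq by <:].
HB.instance Definition _ := [SubChoice_isSubLmodule of cauchy_seq by <:].

Lemma cauchy_seqP (x : cauchy_seq) : hcauchy x.
Proof. by case: x => x /= /asboolP. Qed.

Definition null_dist (x y : cauchy_seq) : bool :=
  `[< hnorm (x k - y k) @[k --> \oo] --> (0 : R) >].

Lemma null_dist_equiv : equiv_class_of null_dist.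
Proof.
split=> [x|x y|y x z].
- apply/asboolP; rewrite (_ : (fun _ => _) = fun=> 0); first exact: cvg_cst.
  by apply/funext => k; rewrite subrr hnorm0.
- apply/asboolP/asboolP => h.
    by under eq_fun do rewrite hnormBC.
  by under eq_fun do rewrite hnormBC.
- move=> /asboolP xy /asboolP yz; apply/asboolP.
  apply: (@squeeze_cvgr _ _ _ _ (fun=> 0)
    (fun k => hnorm (x k - y k) + hnorm (y k - z k))).
  + by apply: nearW => k; rewrite hnorm_ge0 hnorm_dist.
  + exact: cvg_cst.
  + by rewrite -[0](addr0 (0 : R)); exact: cvgD.
Qed.
Canonical null_dist_equivRel := EquivRelPack null_dist_equiv.

End cauchy_sequences.

Definition completion (R : realType) (V : preHilbertType R) : Type :=
  {eq_quot @null_dist R V}%qT.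
Arguments completion {R} V.

Section completion_lmodule.
Variables (R : realType) (V : preHilbertType R).
Local Notation C := (completion V).

HB.instance Definition _ := Choice.on C.
HB.instance Definition _ := EqQuotient.on C.

Definition compl_class (x : cauchy_seq V) : C := \pi_C%qT x.

Lemma classP (x y : cauchy_seq V) :
  compl_class x = compl_class y <-> (hnorm (x k - y k) @[k --> \oo] --> (0 : R)).
Proof.
split=> [/eqquotP/asboolP//|h].
by apply/eqquotP/asboolP.
Qed.

Lemma class_ind (P : C -> Prop) : (forall x, P (compl_class x)) -> forall u, P u.
Proof. by move=> h u; rewrite -[u]reprK; exact: h. Qed.

Lemma repr_class (x : cauchy_seq V) :
  hnorm (repr (compl_class x) k - x k) @[k --> \oo] --> (0 : R).
Proof. by apply/classP; rewrite /compl_class reprK. Qed.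

Definition compl_add (u v : C) : C := compl_class (repr u + repr v).
Definition compl_opp (u : C) : C := compl_class (- repr u).
Definition compl_scale (a : R[i]) (u : C) : C := compl_class (a *: repr u).

Lemma classD x y : compl_add (compl_class x) (compl_class y) = compl_class (x + y).
Proof.
apply/classP; apply: (@squeeze_cvgr _ _ _ _ (fun=> 0) (fun k =>
  hnorm (repr (compl_class x) k - x k) + hnorm (repr (compl_class y) k - y k))).
- apply: nearW => k; rewrite hnorm_ge0/=.
  by rewrite opprD addrACA hnorm_triangle.
- exact: cvg_cst.
- by rewrite -[0](addr0 (0 : R)); apply: cvgD; exact: repr_class.
Qed.

Lemma classZ a x : compl_scale a (compl_class x) = compl_class (a *: x).
Proof.
apply/classP.
under eq_fun => k do rewrite /= -scalerBr hnormZ.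
rewrite -[0](mulr0 (normc a)); apply: cvgMr; exact: repr_class.
Qed.

Lemma classN x : compl_opp (compl_class x) = compl_class (- x).
Proof.
apply/classP.
under eq_fun => k do rewrite /= -opprD hnormN.
exact: repr_class.
Qed.

Lemma compl_addA : associative compl_add.
Proof.
elim/class_ind=> x; elim/class_ind=> y; elim/class_ind=> z.
by rewrite !classD addrA.
Qed.
Lemma compl_addC : commutative compl_add.
Proof. by elim/class_ind=> x; elim/class_ind=> y; rewrite !classD addrC. Qed.
Lemma compl_add0 : left_id (compl_class 0) compl_add.
Proof. by elim/class_ind=> x; rewrite classD add0r. Qed.
Lemma compl_addN : left_inverse (compl_class 0) compl_opp compl_add.
Proof. by elim/class_ind=> x; rewrite classN classD addNr. Qed.
HB.instance Definition _ :=
  GRing.isZmodule.Build C compl_addA compl_addC compl_add0 compl_addN.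

Lemma compl_scaleA a b u :
  compl_scale a (compl_scale b u) = compl_scale (a * b) u.
Proof. by elim/class_ind: u => x; rewrite !classZ scalerA. Qed.
Lemma compl_scale1 : left_id 1 compl_scale.
Proof. by elim/class_ind=> x; rewrite classZ scale1r. Qed.
Lemma compl_scaleDr : right_distributive compl_scale +%R.
Proof.
move=> a; elim/class_ind=> x; elim/class_ind=> y.
by rewrite /GRing.add/= classD !classZ classD scalerDr.
Qed.
Lemma compl_scaleDl u : {morph compl_scale^~ u : a b / a + b}.
Proof.
move=> a b; elim/class_ind: u => x.
by rewrite [in RHS]/GRing.add/= !classZ classD scalerDl.
Qed.
HB.instance Definition _ := GRing.Zmodule_isLmodule.Build R[i] C
  compl_scaleA compl_scale1 compl_scaleDr compl_scaleDl.

Lemma class_addE x y : compl_class x + compl_class y = compl_class (x + y).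
Proof. exact: classD. Qed.
Lemma class_scaleE a x : a *: compl_class x = compl_class (a *: x).
Proof. exact: classZ. Qed.
Lemma class_oppE x : - compl_class x = compl_class (- x).
Proof. exact: classN. Qed.

Definition compl_dot (u v : C) : R[i] :=
  limn (fun k => complex.Re (dot (repr u k) (repr v k)))
  +i* limn (fun k => complex.Im (dot (repr u k) (repr v k))).

Lemma limn_Re_dot (x x' y y' : cauchy_seq V) :
  (hnorm (x' k - x k) @[k --> \oo] --> (0 : R)) ->
  (hnorm (y' k - y k) @[k --> \oo] --> (0 : R)) ->
  limn (fun k => complex.Re (dot (x' k) (y' k))) =
  limn (fun k => complex.Re (dot (x k) (y k))).
Proof.
move=> xx yy; apply/cvg_lim => //.
have cv := is_cvg_Re_dot (cauchy_seqP x) (cauchy_seqP y).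
suff h : complex.Re (dot (x' k) (y' k)) - complex.Re (dot (x k) (y k))
   @[k --> \oo] --> (0 : R).
  rewrite -[limn _]add0r.
  rewrite (_ : (fun _ => _) = (fun k => complex.Re (dot (x' k) (y' k)) -
    complex.Re (dot (x k) (y k))) \+ (fun k => complex.Re (dot (x k) (y k)))).
    by apply: cvgD.
  by apply/funext => k /=; rewrite subrK.
have [cx cy'] := (hcauchyP (cauchy_seqP x), hcauchyP (cauchy_seqP y')).
apply/norm_cvg0P.
apply: (@squeeze_cvgr _ _ _ _ (fun=> 0) (fun k =>
  hnorm (x' k - x k) * hnorm (y' k) + hnorm (x k) * hnorm (y' k - y k))).
- apply: nearW => k; rewrite normr_ge0/=.
  rewrite (_ : _ - _ = complex.Re (dot (x' k - x k) (y' k)) +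
    complex.Re (dot (x k) (y' k - y k))).
    rewrite (le_trans (ler_normD _ _))// lerD// ler_norml Re_dot_le andbT lerNl.
      rewrite -(hnormN (x' k - x k)).
      rewrite (le_trans _ (Re_dot_le _ _))// dotNl.
      by case: (dot _ _).
    rewrite -(hnormN (x k)).
    rewrite (le_trans _ (Re_dot_le _ _))// dotNl.
    by case: (dot _ _).
  rewrite dotDl dotDr dotNl dotNr.
  case: (dot (x' k) (y' k)) => ? ?; case: (dot (x k) (y' k)) => ? ?.
  by case: (dot (x k) (y k)) => ? ? /=; ring.
- exact: cvg_cst.
- rewrite (_ : (0 : R) = 0 * limn (fun k => hnorm (y' k)) +
    limn (fun k => hnorm (x k)) * 0).
    by apply: cvgD; apply: cvgM.
  by rewrite mul0r mulr0 addr0.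
Qed.

Lemma class_dotE (x y : cauchy_seq V) : compl_dot (compl_class x) (compl_class y) =
  limn (fun k => complex.Re (dot (x k) (y k)))
  +i* limn (fun k => complex.Im (dot (x k) (y k))).
Proof.
have [rx ry] := (@repr_class x, @repr_class y).
congr (_ +i* _); first exact: limn_Re_dot.
have E (z : cauchy_seq V) (w : cauchy_seq V) :
  (fun k => complex.Im (dot (z k) (w k))) =
  (fun k => complex.Re (dot ((('i)%C *: z : cauchy_seq V) k) (w k))).
  by apply/funext => k; rewrite Im_dotE.
rewrite !E; apply: limn_Re_dot => //.
under eq_fun => k do rewrite /= -scalerBr hnormZ.
have h : normc ('i)%C * hnorm (repr (compl_class x) k - x k) @[k --> \oo] -->
    normc ('i)%C * (0 : R) by apply: cvgMr; exact: rx.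
by rewrite mulr0 in h.
Qed.

Lemma compl_dotDr u v w : compl_dot u (v + w) = compl_dot u v + compl_dot u w.
Proof.
elim/class_ind: u => x; elim/class_ind: v => y; elim/class_ind: w => z.
have [[cx cy] cz] := (cauchy_seqP x, cauchy_seqP y, cauchy_seqP z).
rewrite class_addE !class_dotE.
rewrite [RHS]/(_ + _) /=.
rewrite -!limD; [|exact: is_cvg_Im_dot..|exact: is_cvg_Re_dot|exact: is_cvg_Re_dot].
have ReD (a b : R[i]) : complex.Re (a + b) = complex.Re a + complex.Re b.
  by case: a b => [? ?] [? ?].
have ImD (a b : R[i]) : complex.Im (a + b) = complex.Im a + complex.Im b.
  by case: a b => [? ?] [? ?].
congr (limn _ +i* limn _); apply/funext => k; rewrite /= dotDr.
  exact: ReD.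
exact: ImD.
Qed.

Lemma compl_dotZr a u v : compl_dot u (a *: v) = a * compl_dot u v.
Proof.
elim/class_ind: u => x; elim/class_ind: v => y.
have [cx cy] := (cauchy_seqP x, cauchy_seqP y).
have cr := is_cvg_Re_dot cx cy; have ci := is_cvg_Im_dot cx cy.
rewrite class_scaleE !class_dotE; case: a => a b /=.
apply/eqP; rewrite eq_complex/=; apply/andP; split; apply/eqP; apply/cvg_lim => //.
  rewrite (_ : (fun _ => _) = fun k => a * complex.Re (dot (x k) (y k)) -
      b * complex.Im (dot (x k) (y k))).
    by apply: cvgB; apply: cvgMr.
  by apply/funext => k; rewrite /= dotZr; case: (dot _ _).
rewrite (_ : (fun _ => _) = fun k => a * complex.Im (dot (x k) (y k)) +
    b * complex.Re (dot (x k) (y k))).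
  by apply: cvgD; apply: cvgMr.
by apply/funext => k; rewrite /= dotZr; case: (dot _ _).
Qed.

Lemma compl_dotC u v : compl_dot u v = (compl_dot v u)^*%C.
Proof.
elim/class_ind: u => x; elim/class_ind: v => y.
have [cx cy] := (cauchy_seqP x, cauchy_seqP y).
rewrite !class_dotE/= -limN; last exact: is_cvg_Im_dot.
have ImC (a : R[i]) : complex.Im (a^*%C) = - complex.Im a by case: a.
congr (limn _ +i* limn _); apply/funext => k; rewrite /= dotC.
  by case: (dot _ _).
exact: ImC.
Qed.

Lemma class_dotxx x : compl_dot (compl_class x) (compl_class x) =
  (limn (fun k => hnorm (x k)) ^+ 2)%:C.
Proof.
rewrite class_dotE; congr (_ +i* _).
  apply/cvg_lim => //; under eq_fun => k do rewrite dotuu /= expr2.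
  by rewrite expr2; apply: cvgM; exact: (hcauchyP (cauchy_seqP x)).
apply/cvg_lim => //; under eq_fun => k do rewrite dotuu /=.
exact: cvg_cst.
Qed.

Lemma compl_dot_ge0 u : 0 <= compl_dot u u.
Proof. by elim/class_ind: u => x; rewrite class_dotxx ler0c sqr_ge0. Qed.

HB.instance Definition _ := Lmodule_isPreHilbert.Build R C
  compl_dotDr compl_dotZr compl_dotC compl_dot_ge0.

Lemma hnorm_class x : hnorm (compl_class x) = limn (fun k => hnorm (x k)).
Proof.
rewrite {1}/hnorm [dot _ _]class_dotxx /= sqrtr_sqr ger0_norm//.
apply: limr_ge; first exact: (hcauchyP (cauchy_seqP x)).
by apply: nearW => k; exact: hnorm_ge0.
Qed.

Lemma compl_dot_eq0 (u : C) : dot u u = 0 -> u = 0.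
Proof.
elim/class_ind: u => x; rewrite [dot _ _]class_dotxx => /(congr1 (@complex.Re R)).
move=> /eqP; rewrite /= sqrf_eq0 => /eqP x0.
apply/classP; under eq_fun => k do rewrite subr0.
by rewrite -x0; exact: (hcauchyP (cauchy_seqP x)).
Qed.

(* The canonical map of a pre-Hilbert space into its completion. *)
Definition emb (v : V) : C :=
  compl_class (CauchySeq (introT (asboolP _) (hcauchy_cst v))).

Lemma hnorm_emb v : hnorm (emb v) = hnorm v.
Proof. by rewrite hnorm_class/=; apply/cvg_lim => //; exact: cvg_cst. Qed.

Lemma emb_linear : linear emb.
Proof.
move=> a u v; rewrite class_scaleE class_addE; congr compl_class.
by apply/val_inj.
Qed.
HB.instance Definition _ := GRing.isLinear.Build R[i] V C *:%R emb emb_linear.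

Lemma emb_dense (x : cauchy_seq V) (e : R) : 0 < e ->
  exists N, forall n, (N <= n)%N -> hnorm (compl_class x - emb (x n)) <= e.
Proof.
move=> e0; have [N HN] := cauchy_seqP x e0; exists N => n Nn.
rewrite class_oppE class_addE hnorm_class.
apply: limr_le; first exact: (hcauchyP (cauchy_seqP _)).
by exists N => // k Nk; apply/ltW/HN.
Qed.

Lemma compl_complete (X : nat -> C) : hcauchy X -> exists l, hcvg X l.
Proof.
move=> cX.
have /choice[y Hy] : forall n, exists v : V, hnorm (X n - emb v) <= n.+1%:R^-1.
  move=> n; elim/class_ind: (X n) => x.
  have [|N HN] := @emb_dense x (n.+1%:R^-1); first by rewrite invr_gt0.
  by exists (x N); exact: HN.
have small (e : R) : 0 < e -> exists N, forall n, (N <= n)%N -> n.+1%:R^-1 < e.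
  move=> e0; have [N _ HN] := near_infty_natSinv_lt (PosNum e0).
  by exists N => n; exact: HN.
have cy : hcauchy y.
  move=> e e0; have e3 : 0 < e / 3 by rewrite divr_gt0.
  have [N HN] := cX _ e3; have [M HM] := small _ e3.
  exists (maxn N M) => m n; rewrite !geq_max => /andP[Nm Mm] /andP[Nn Mn].
  rewrite -hnorm_emb raddfB/=.
  have h1 := hnorm_dist (emb (y m)) (X m) (emb (y n)).
  have h2 := hnorm_dist (X m) (X n) (emb (y n)).
  have h3 := Hy m; rewrite hnormBC in h3.
  have {h3} h3 := le_lt_trans h3 (HM _ Mm).
  have h4 := le_lt_trans (Hy n) (HM _ Mn); have h5 := HN _ _ Nm Nn.
  by move: (hnorm _) (hnorm _) (hnorm _) (hnorm _) (hnorm _) h1 h2 h3 h4 h5 => *; lra.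
exists (compl_class (CauchySeq (introT (asboolP _) cy))); set l := compl_class _.
apply/cvgrPdist_lt => e e0; have e2 : 0 < e / 2 by rewrite divr_gt0.
have [N HN] := @emb_dense (CauchySeq (introT (asboolP _) cy)) (e / 2) e2.
have [M HM] := small _ e2.
exists (maxn N M) => // n /=; rewrite geq_max => /andP[Nn Mn].
rewrite sub0r normrN ger0_norm ?hnorm_ge0//.
have h1 := hnorm_dist (X n) (emb (y n)) l.
have h2 := HN _ Nn; rewrite hnormBC -/l in h2.
have h3 := le_lt_trans (Hy n) (HM _ Mn); rewrite /= in h2.
by move: (hnorm _) (hnorm _) (hnorm _) h1 h2 h3 => *; lra.
Qed.

HB.instance Definition _ := PreHilbert_isHilbert.Build R C
  compl_dot_eq0 compl_complete.

End completion_lmodule.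

Section tuple_lebesgue.
Variable R : realType.
Local Notation mR := (measurableTypeR R).

(* measurableTypeR R is the real line with its Borel sigma-algebra. *)
Definition tuple_cons n (p : mR * n.-tuple mR) : n.+1.-tuple mR :=
  [tuple of p.1 :: p.2].

Lemma measurable_tuple_cons n : measurable_fun setT (@tuple_cons n).
Proof. exact: measurable_cons. Qed.

Definition tuple_uncons n (t : n.+1.-tuple mR) : mR * n.-tuple mR :=
  (thead t, [tuple of behead t]).

Lemma measurable_tuple_uncons n : measurable_fun setT (@tuple_uncons n).
Proof.
apply: measurable_fun_pair; first exact: measurable_tnth.
exact: measurable_behead.
Qed.

Lemma tuple_consK n : cancel (@tuple_cons n) (@tuple_uncons n).
Proof. by case=> x t; congr pair; apply/val_inj. Qed.

Section step.
Variables (n : nat) (mu : {sigma_finite_measure set (n.-tuple mR) -> \bar R}).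

Definition lebesgue_cons : set (n.+1.-tuple mR) -> \bar R :=
  pushforward (@lebesgue_measure R \x mu)%E (@tuple_cons n).

Let preim A : measurable A -> measurable (@tuple_cons n @^-1` A).
Proof. by move=> mA; rewrite -[X in measurable X]setTI; exact: measurable_tuple_cons. Qed.

Let lebesgue_cons0 : lebesgue_cons set0 = 0%E.
Proof. by rewrite /lebesgue_cons /pushforward preimage_set0 measure0. Qed.

Let lebesgue_cons_ge0 A : (0 <= lebesgue_cons A)%E.
Proof.
rewrite /lebesgue_cons /pushforward.
exact: (measure_ge0 (@lebesgue_measure R \x mu)%E).
Qed.

Let lebesgue_cons_sigma_additive : semi_sigma_additive lebesgue_cons.
Proof.
move=> F mF tF mUF; rewrite /lebesgue_cons /pushforward preimage_bigcup.
apply: measure_semi_sigma_additive.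
- by move=> k; exact: preim.
- apply/trivIsetP => /= i j _ _ ij; rewrite -preimage_setI.
  by move/trivIsetP : tF => /(_ _ _ _ _ ij) ->//; rewrite preimage_set0.
- by rewrite -preimage_bigcup; exact: preim.
Qed.

HB.instance Definition _ := isMeasure.Build _ _ _ lebesgue_cons
  lebesgue_cons0 lebesgue_cons_ge0 lebesgue_cons_sigma_additive.

Let lebesgue_cons_sigma_finite : sigma_finite setT lebesgue_cons.
Proof.
have /sigma_finiteP[F [TF ndF Foo]] := sigma_finiteT (@lebesgue_measure R).
have /sigma_finiteP[G [TG ndG Goo]] := sigma_finiteT mu.
exists (fun k => @tuple_uncons n @^-1` (F k `*` G k)).
  rewrite -preimage_bigcup -[LHS](preimage_setT (@tuple_uncons n)).
  congr (_ @^-1` _); rewrite -setXTT TF TG predeqE => -[x y]; split.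
    move=> [/= [k _ Fkx] [l _ Gly]]; exists (maxn k l) => //; split.
      by move: x Fkx; exact/subsetPset/ndF/leq_maxl.
    by move: y Gly; exact/subsetPset/ndG/leq_maxr.
  by move=> [k _ []/= ? ?]; split; exists k.
move=> k; have [mF Fk] := Foo k; have [mG Gk] := Goo k.
have mFG : measurable (F k `*` G k) by exact: measurableX.
split.
  by rewrite -[X in measurable X]setTI; exact: measurable_tuple_uncons.
rewrite /lebesgue_cons /pushforward -comp_preimage.
rewrite (_ : _ \o _ = id); last by apply/funext; exact: tuple_consK.
by rewrite preimage_id product_measure1E// lte_mul_pinfty// ge0_fin_numE.
Qed.

HB.instance Definition _ := Measure_isSigmaFinite.Build _ _ _ lebesgue_cons
  lebesgue_cons_sigma_finite.

End step.

(* Lebesgue measure on R^n, as an iterated product measure. *)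
Fixpoint nlebesgue n : {sigma_finite_measure set (n.-tuple mR) -> \bar R} :=
  match n with
  | 0 => @dirac _ (0.-tuple mR) [tuple] R
  | m.+1 => lebesgue_cons (nlebesgue m)
  end.

End tuple_lebesgue.

Section complex_L2.
Context d (T : measurableType d) (R : realType) (mu : {measure set T -> \bar R}).
Variables (D : set T) (mD : measurable D).
Implicit Types f g : T -> R[i].

Definition square_integrable f :=
  [/\ measurable_fun D (fun x => complex.Re (f x)),
      measurable_fun D (fun x => complex.Im (f x)) &
      (\int[mu]_(x in D) (normc (f x) ^+ 2)%:E < +oo)%E].

Definition cintegral f : R[i] :=
  (\int[mu]_(x in D) complex.Re (f x))%R +i* (\int[mu]_(x in D) complex.Im (f x))%R.

Let normc2 (a : R[i]) : normc a ^+ 2 = complex.Re a ^+ 2 + complex.Im a ^+ 2.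
Proof. by case: a => a b; rewrite /normc sqr_sqrtr// addr_ge0 ?sqr_ge0. Qed.

Let measurable_normc2 f : measurable_fun D (fun x => complex.Re (f x)) ->
  measurable_fun D (fun x => complex.Im (f x)) ->
  measurable_fun D (fun x => normc (f x) ^+ 2).
Proof.
move=> mr mi; under eq_fun do rewrite normc2.
by apply: measurable_funD; apply: measurable_funX.
Qed.

Lemma integrable_normc2 f : square_integrable f ->
  mu.-integrable D (fun x => (normc (f x) ^+ 2)%:E).
Proof.
move=> [mr mi foo]; apply/integrableP; split.
  exact/measurable_EFinP/measurable_normc2.
apply: le_lt_trans foo; apply: ge0_le_integral => //=.
- by apply/measurable_EFinP; apply: measurableT_comp => //; exact: measurable_normc2.
- by apply/measurable_EFinP; exact: measurable_normc2.
- by move=> x _; rewrite lee_fin ger0_norm ?sqr_ge0.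
Qed.

Let integrable_dom f g (h : T -> R) : measurable_fun D h ->
  (forall x, `|h x| <= 2 * (normc (f x) ^+ 2 + normc (g x) ^+ 2)) ->
  square_integrable f -> square_integrable g -> mu.-integrable D (EFin \o h).
Proof.
move=> mh hfg sf sg.
apply: (@le_integrable _ _ _ mu D mD _
  (fun x => (2 : R)%:E * ((normc (f x) ^+ 2)%:E + (normc (g x) ^+ 2)%:E))%E).
- exact/measurable_EFinP.
- move=> x _ /=; rewrite -?EFinD -?EFinM/= lee_fin.
  by rewrite (le_trans (hfg x))// ler_norm.
- by apply: integrableZl => //; apply: integrableD => //; exact: integrable_normc2.
Qed.

Lemma square_integrableD f g : square_integrable f -> square_integrable g ->
  square_integrable (fun x => f x + g x).
Proof.
move=> sf sg; have [[fr fi _] [gr gi _]] := (sf, sg).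
have mr : measurable_fun D (fun x => complex.Re (f x + g x)).
  rewrite (_ : (fun _ => _) = (fun x => complex.Re (f x) + complex.Re (g x))).
    exact: measurable_funD.
  by apply/funext => x; case: (f x) (g x) => [? ?] [].
have mi : measurable_fun D (fun x => complex.Im (f x + g x)).
  rewrite (_ : (fun _ => _) = (fun x => complex.Im (f x) + complex.Im (g x))).
    exact: measurable_funD.
  by apply/funext => x; case: (f x) (g x) => [? ?] [].
split=> //.
have := @integrable_dom f g _ (measurable_normc2 mr mi) _ sf sg.
case/(_ _)/integrableP => [x|_].
  rewrite !normc2; case: (f x) (g x) => [a b] [c e] /=.
  rewrite ger0_norm ?addr_ge0 ?sqr_ge0//.
  have := sqr_ge0 (a - c); have := sqr_ge0 (b - e); nra.
apply: le_lt_trans; apply: ge0_le_integral => //=.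
- by move=> x _; rewrite lee_fin sqr_ge0.
- by apply/measurable_EFinP; exact: measurable_normc2.
- apply/measurable_EFinP; apply: measurableT_comp => //; exact: measurable_normc2.
- by move=> x _; rewrite lee_fin ler_norm.
Qed.

Lemma square_integrableZ (a : R[i]) f : square_integrable f ->
  square_integrable (fun x => a * f x).
Proof.
move=> sf; have [fr fi _] := sf.
have mr : measurable_fun D (fun x => complex.Re (a * f x)).
  rewrite (_ : (fun _ => _) = (fun x => complex.Re a * complex.Re (f x) -
      complex.Im a * complex.Im (f x))).
    by apply: measurable_funB; apply: measurable_funM.
  by apply/funext => x; move: (f x) (a) => [? ?] [].
have mi : measurable_fun D (fun x => complex.Im (a * f x)).
  rewrite (_ : (fun _ => _) = (fun x => complex.Re a * complex.Im (f x) +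
      complex.Im a * complex.Re (f x))).
    by apply: measurable_funD; apply: measurable_funM.
  by apply/funext => x; move: (f x) (a) => [? ?] [].
split=> //.
under eq_integral => x _ do rewrite normcM exprMn EFinM.
have [_ _ foo] := sf.
rewrite ge0_integralZl//=; first by rewrite lte_mul_pinfty ?lee_fin ?sqr_ge0.
- by apply/measurable_EFinP; exact: measurable_normc2.
- by move=> x _; rewrite lee_fin sqr_ge0.
- by rewrite lee_fin sqr_ge0.
Qed.

Lemma square_integrable0 : square_integrable (fun=> 0).
Proof.
split; [exact: measurable_cst|exact: measurable_cst|].
by under eq_integral do rewrite normc0 expr0n/=; rewrite integral0 ltry.
Qed.

Lemma integrable_Re_conj f g : square_integrable f -> square_integrable g ->
  mu.-integrable D (EFin \o (fun x => complex.Re ((f x)^*%C * g x))).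
Proof.
move=> sf sg; have [[fr fi _] [gr gi _]] := (sf, sg).
apply: (@integrable_dom f g) => //.
  rewrite (_ : (fun _ => _) = (fun x => complex.Re (f x) * complex.Re (g x) +
      complex.Im (f x) * complex.Im (g x))).
    by apply: measurable_funD; apply: measurable_funM.
  by apply/funext => x; case: (f x) (g x) => [? ?] [? ?] /=; ring.
move=> x; rewrite !normc2; case: (f x) (g x) => [a b] [c e] /=.
rewrite ler_norml; apply/andP.
have := sqr_ge0 (a - c); have := sqr_ge0 (b - e).
have := sqr_ge0 (a + c); have := sqr_ge0 (b + e).
have := sqr_ge0 (a); have := sqr_ge0 (b);have := sqr_ge0 (c); have := sqr_ge0 (e).
by split; nra.
Qed.

Lemma integrable_Im_conj f g : square_integrable f -> square_integrable g ->
  mu.-integrable D (EFin \o (fun x => complex.Im ((f x)^*%C * g x))).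
Proof.
move=> sf sg; have [[fr fi _] [gr gi _]] := (sf, sg).
apply: (@integrable_dom f g) => //.
  rewrite (_ : (fun _ => _) = (fun x => complex.Re (f x) * complex.Im (g x) -
      complex.Im (f x) * complex.Re (g x))).
    by apply: measurable_funB; apply: measurable_funM.
  by apply/funext => x; case: (f x) (g x) => [? ?] [? ?] /=; ring.
move=> x; rewrite !normc2; case: (f x) (g x) => [a b] [c e] /=.
rewrite ler_norml; apply/andP.
have := sqr_ge0 (a - e); have := sqr_ge0 (b - c).
have := sqr_ge0 (a + e); have := sqr_ge0 (b + c).
have := sqr_ge0 (a); have := sqr_ge0 (b);have := sqr_ge0 (c); have := sqr_ge0 (e).
by split; nra.
Qed.

Lemma cintegral_dotD f g h :
  square_integrable f -> square_integrable g -> square_integrable h ->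
  cintegral (fun x => (f x)^*%C * (g x + h x)) =
  cintegral (fun x => (f x)^*%C * g x) + cintegral (fun x => (f x)^*%C * h x).
Proof.
move=> sf sg sh; rewrite [RHS]/(_ + _)/=; congr (_ +i* _).
  rewrite -RintegralD//; [|exact: integrable_Re_conj..].
  apply: eq_Rintegral => x _; case: (f x) (g x) (h x) => [? ?] [? ?] [? ?] /=; ring.
rewrite -RintegralD//; [|exact: integrable_Im_conj..].
apply: eq_Rintegral => x _; case: (f x) (g x) (h x) => [? ?] [? ?] [? ?] /=; ring.
Qed.

Lemma cintegral_dotZ (a : R[i]) f g : square_integrable f -> square_integrable g ->
  cintegral (fun x => (f x)^*%C * (a * g x)) =
  a * cintegral (fun x => (f x)^*%C * g x).
Proof.
move=> sf sg; have [ir ii] := (integrable_Re_conj sf sg, integrable_Im_conj sf sg).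
have Z (r : R) (h : T -> R) : mu.-integrable D (EFin \o h) ->
  mu.-integrable D (EFin \o (fun x => r * h x)).
  by move=> ih; rewrite (_ : _ \o _ = fun x => r%:E * (h x)%:E)%E//; exact: integrableZl.
case: a => a b; rewrite [RHS]/(_ * _)/=; congr (_ +i* _).
  rewrite -RintegralZl// -[X in _ - X]RintegralZl// -RintegralB//; [|exact: Z..].
  apply: eq_Rintegral => x _; case: (f x) (g x) => [? ?] [? ?] /=; ring.
rewrite -RintegralZl// -[X in _ + X]RintegralZl// -RintegralD//; [|exact: Z..].
apply: eq_Rintegral => x _; case: (f x) (g x) => [? ?] [? ?] /=; ring.
Qed.

Lemma cintegral_dotC f g : square_integrable f -> square_integrable g ->
  cintegral (fun x => (f x)^*%C * g x) =
  (cintegral (fun x => (g x)^*%C * f x))^*%C.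
Proof.
move=> sf sg; congr (_ +i* _).
  by apply: eq_Rintegral => x _; case: (f x) (g x) => [? ?] [? ?] /=; ring.
rewrite -mulN1r -RintegralZl//; last exact: integrable_Im_conj.
by apply: eq_Rintegral => x _; case: (f x) (g x) => [? ?] [? ?] /=; ring.
Qed.

Lemma cintegral_dot_ge0 f : 0 <= cintegral (fun x => (f x)^*%C * f x).
Proof.
rewrite lecE/=; apply/andP; split.
  rewrite /Rintegral integral0_eq// => x _; case: (f x) => a b /=; congr EFin; ring.
apply: Rintegral_ge0 => x _; case: (f x) => a b /=.
by rewrite mulNr opprK addr_ge0// -expr2 sqr_ge0.
Qed.

End complex_L2.

Section antisymmetric.
Variable R : realType.
Local Notation mR := (measurableTypeR R).

Definition half_line : set mR := [set t | 0 <= t].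
Definition orthant n : set (n.-tuple mR) := [set t | forall i, 0 <= tnth t i].

Lemma measurable_half_line : measurable half_line.
Proof.
rewrite (_ : half_line = `[0, +oo[%classic)//.
by apply/seteqP; split=> x /=; rewrite in_itv/= andbT.
Qed.

Lemma measurable_orthant n : measurable (@orthant n).
Proof.
rewrite (_ : @orthant n = \big[setI/setT]_(i < n) ((@tnth n mR)^~ i @^-1` half_line)).
  apply: bigsetI_measurable => i _.
  rewrite -[X in measurable X]setTI; apply: measurable_tnth => //.
  exact: measurable_half_line.
apply/seteqP; split=> t.
  by move=> h; rewrite -bigcap_seq => i /= _; exact: h.
by rewrite -bigcap_seq => h i; apply: (h i); rewrite /= mem_index_enum.
Qed.

Definition L2n n (f : n.-tuple mR -> R[i]) :=
  square_integrable (nlebesgue R n) (@orthant n) f.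

Definition L2half (z : mR -> R[i]) :=
  square_integrable (@lebesgue_measure R) half_line z.

Definition perm_tuple n (s : 'S_n) (t : n.-tuple mR) : n.-tuple mR :=
  [tuple tnth t (s i) | i < n].

Definition antisymmetrization n (h : n.-tuple mR -> R[i]) : n.-tuple mR -> R[i] :=
  fun t => n`!%:R^-1 * \sum_(s : 'S_n) (-1) ^+ s * h (perm_tuple s t).

(* Elements of L^2 spaces of functions are given by representatives. *)
Definition Lambda n (f : n.-tuple mR -> R[i]) := L2n f /\
  forall s : 'S_n, {ae nlebesgue R n, forall t, orthant t ->
    f (perm_tuple s t) = (-1) ^+ s * f t}.

Definition Lambda_dot n (f g : n.-tuple mR -> R[i]) : R[i] :=
  n`!%:R * cintegral (nlebesgue R n) (@orthant n) (fun t => (f t)^*%C * g t).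

Lemma Lambda_linear n (a : R[i]) (f g : n.-tuple mR -> R[i]) :
  Lambda f -> Lambda g -> Lambda (fun t => a * f t + g t).
Proof.
move=> [sf af] [sg ag]; split.
  apply: square_integrableD => //; first exact: measurable_orthant.
  by apply: square_integrableZ => //; exact: measurable_orthant.
move=> s; have := ag s; have := af s; apply: filterS2 => t /= hf hg ot.
by rewrite hf// hg// mulrDr mulrCA.
Qed.

Lemma Lambda0 n : Lambda (fun _ : n.-tuple mR => 0).
Proof.
split; first by apply: square_integrable0; exact: measurable_orthant.
by move=> s; apply: aeW => t _; rewrite mulr0.
Qed.

End antisymmetric.

Section algebraic_fock.
Variable R : realType.
Local Notation mR := (measurableTypeR R).

(* A family (F_n) of functions of n variables is encoded as one function on
   finite sequences: F_n is its restriction to the sequences of length n. *)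
Definition component n (F : seq mR -> R[i]) : n.-tuple mR -> R[i] := fun t => F t.
Arguments component n F : clear implicits.

Definition afock_pred : {pred seq mR -> R[i]} := [pred F : seq mR -> R[i] |
  `[< (forall n, Lambda (component n F)) /\
      exists N, forall s, (N <= size s)%N -> F s = 0 >]].

Lemma afock_pred_submod : submod_closed afock_pred.
Proof.
split=> [|a F G].
  by apply/asboolP; split; [move=> n; exact: Lambda0|exists 0%N].
move=> /asboolP[lF [N HN]] /asboolP[lG [M HM]]; apply/asboolP; split.
  by move=> n; exact: (Lambda_linear a (lF n) (lG n)).
exists (maxn N M) => s; rewrite geq_max => /andP[Ns Ms].
by rewrite -[LHS]/(a * F s + G s) HN// HM// mulr0 addr0.
Qed.
HB.instance Definition _ :=
  GRing.isSubmodClosed.Build R[i] (seq mR -> R[i]) afock_pred afock_pred_submod.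

(* The algebraic direct sum of the spaces Lambda_n. *)
Record afock := AFock { afock_val :> seq mR -> R[i]; _ : afock_val \in afock_pred }.
HB.instance Definition _ := [isSub for afock_val].
HB.instance Definition _ := [Choice of afock by <:].
HB.instance Definition _ := [SubChoice_isSubLmodule of afock by <:].

Definition afock_dot (F G : afock) : R[i] :=
  \sum_(n \in [set: nat]) Lambda_dot (component n F) (component n G).

Lemma afock_Lambda n (F : afock) : Lambda (component n F).
Proof. by case: F => F /= /asboolP[]. Qed.

Let afock_L2 n (F : afock) : L2n (component n F).
Proof. by case: (afock_Lambda n F). Qed.

Lemma afock_dotE (F G : afock) N :
  (forall s, (N <= size s)%N -> G s = 0) ->
  afock_dot F G = \sum_(n < N) Lambda_dot (component n F) (component n G).
Proof.
move=> HN; rewrite (@fsbig_ord _ _ _ N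
  (fun n => Lambda_dot (component n F) (component n G))).
apply/esym/fsbig_widen => // n [_ /= /negP]; rewrite -leqNgt => Nn.
rewrite /Lambda_dot /cintegral /Rintegral !integral0_eq ?mulr0//= => t _.
  by rewrite /component HN ?size_tuple// mulr0.
by rewrite /component HN ?size_tuple// mulr0.
Qed.

Let afock_bound (F : afock) : exists N, forall s, (N <= size s)%N -> F s = 0.
Proof. by case: F => F /= /asboolP[]. Qed.

Lemma afock_dotDr F G H : afock_dot F (G + H) = afock_dot F G + afock_dot F H.
Proof.
have [[N HN] [M HM]] := (afock_bound G, afock_bound H).
have HN' s : (maxn N M <= size s)%N -> G s = 0.
  by rewrite geq_max => /andP[? _]; exact: HN.
have HM' s : (maxn N M <= size s)%N -> H s = 0.
  by rewrite geq_max => /andP[_ ?]; exact: HM.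
rewrite !(@afock_dotE F _ (maxn N M))//; last first.
  by move=> s h; rewrite -[LHS]/(G s + H s) HN'// HM'// addr0.
rewrite -big_split/=; apply: eq_bigr => n _.
rewrite /Lambda_dot -mulrDr; congr (_ * _); apply: cintegral_dotD;
  [exact: measurable_orthant|exact: afock_L2..].
Qed.

Lemma afock_dotZr a F G : afock_dot F (a *: G) = a * afock_dot F G.
Proof.
have [N HN] := afock_bound G.
rewrite !(@afock_dotE F _ N)//; last first.
  by move=> s h; rewrite -[LHS]/(a * G s) HN// mulr0.
rewrite mulr_sumr; apply: eq_bigr => n _.
rewrite /Lambda_dot mulrCA; congr (_ * _); apply: cintegral_dotZ;
  [exact: measurable_orthant|exact: afock_L2..].
Qed.

Lemma afock_dotC F G : afock_dot F G = (afock_dot G F)^*%C.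
Proof.
have [[N HN] [M HM]] := (afock_bound F, afock_bound G).
rewrite (@afock_dotE F G (maxn N M)); last first.
  by move=> s; rewrite geq_max => /andP[_ ?]; exact: HM.
rewrite (@afock_dotE G F (maxn N M)); last first.
  by move=> s; rewrite geq_max => /andP[? _]; exact: HN.
rewrite rmorph_sum/=; apply: eq_bigr => n _.
rewrite /Lambda_dot rmorphM/= conjc_nat; congr (_ * _).
apply: cintegral_dotC;
  [exact: measurable_orthant|exact: afock_L2..].
Qed.

Lemma afock_dot_ge0 F : 0 <= afock_dot F F.
Proof.
have [N HN] := afock_bound F; rewrite (@afock_dotE F F N)//.
by apply: sumr_ge0 => n _; rewrite mulr_ge0// cintegral_dot_ge0.
Qed.

HB.instance Definition _ := Lmodule_isPreHilbert.Build R afock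
  afock_dotDr afock_dotZr afock_dotC afock_dot_ge0.

End algebraic_fock.
Arguments component {R} n F.

(* The anti-symmetric Fock space, the Hilbert direct sum of the Lambda_n. *)
Definition fock (R : realType) : hilbertType R := completion (afock R).


Section chaos.
Variable R : realType.
Local Notation mR := (measurableTypeR R).

Definition chaos_val n (f : n.-tuple mR -> R[i]) : seq mR -> R[i] :=
  fun s => if insub s is Some t then f t else 0.

Lemma component_chaos_val n (f : n.-tuple mR -> R[i]) :
  component n (chaos_val f) = f.
Proof.
by apply/funext => t; rewrite /component /chaos_val valK.
Qed.

Lemma chaos_valP n (f : n.-tuple mR -> R[i]) :
  Lambda f -> chaos_val f \in @afock_pred R.
Proof.
move=> Lf; apply/asboolP; split=> [m|].
  have [->|mn] := eqVneq m n; first by rewrite component_chaos_val.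
  rewrite (_ : component m _ = fun=> 0); first exact: Lambda0.
  apply/funext => t; rewrite /component /chaos_val insubF//.
  by rewrite size_tuple (negPf mn).
exists n.+1 => s ns; rewrite /chaos_val insubF//.
by rewrite gtn_eqF.
Qed.

(* The inclusion of Lambda_n in the Fock space, with value 0 outside Lambda_n. *)
Definition chaos n (f : n.-tuple mR -> R[i]) : fock R :=
  emb (insubd (0 : afock R) (chaos_val f)).

Definition vacuum : fock R := chaos (fun _ : 0.-tuple mR => 1).

End chaos.

Section operators.
Variables (R : realType) (H : hilbertType R).

Definition bounded_operator (K : hilbertType R) (T : H -> K) :=
  linear T /\ exists c : R, forall x, hnorm (T x) <= c * hnorm x.

Definition is_adjoint (T S : H -> H) := forall x y, dot (T x) y = dot x (S y).

(* xget x0 P is some element of P, or x0 if P is empty. Below, as here, P has a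
   unique element in the cases of interest. *)
Definition adjoint (T : H -> H) : H -> H :=
  xget 0 [set S | bounded_operator S /\ is_adjoint T S].

(* Operators are total functions, so commutants are taken in the set of bounded
   operators. *)
Definition commutant (S : set (H -> H)) : set (H -> H) :=
  [set T | bounded_operator T /\ forall s, S s -> T \o s = s \o T].

Definition von_neumann_algebra (M : set (H -> H)) :=
  [/\ M `<=` @bounded_operator H,
      forall u, M u -> exists2 v, M v & is_adjoint u v &
      commutant (commutant M) = M].

Definition generated_von_neumann (S : set (H -> H)) : set (H -> H) :=
  \bigcap_(M in [set M | von_neumann_algebra M /\ S `<=` M]) M.

Lemma generated_von_neumann_linear S (a : R[i]) u v :
  generated_von_neumann S u -> generated_von_neumann S v ->
  generated_von_neumann S (a *: u + v).
Proof.
move=> Su Sv M [vM SM]; have [Mb _ MM] := vM.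
have [Mu Mv] : M u /\ M v by split; [exact: Su|exact: Sv].
have [[lu [c Hc]] [lv [d Hd]]] := (Mb _ Mu, Mb _ Mv).
rewrite -MM; split.
  split.
    move=> b x y; rewrite -[LHS]/(a *: u (b *: x + y) + v (b *: x + y)).
    rewrite -[RHS]/(b *: (a *: u x + v x) + (a *: u y + v y)).
    rewrite lu lv !scalerDr !scalerA mulrC -!addrA; congr (_ + _).
    by rewrite addrCA.
  exists (normc a * c + d) => x.
  rewrite -[X in hnorm X]/(a *: u x + v x) (le_trans (hnorm_triangle _ _))//.
  rewrite hnormZ mulrDl lerD// -mulrA ler_wpM2l//.
  by case: (a) => ? ?; exact: sqrtr_ge0.
move=> s [[ls _] sM]; apply/funext => x.
rewrite -[LHS]/(a *: u (s x) + v (s x)) -[RHS]/(s (a *: u x + v x)) ls.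
have := congr1 (@^~ x) (sM _ Mu); have := congr1 (@^~ x) (sM _ Mv).
by move=> /= -> ->.
Qed.

Lemma generated_von_neumann0 S : generated_von_neumann S 0.
Proof.
move=> M [[_ _ MM] _]; rewrite -MM; split.
  split; first by move=> a x y; rewrite -[LHS]/0 -[RHS]/(a *: 0 + 0) scaler0 addr0.
  by exists 0 => x; rewrite mul0r -[X in hnorm X]/0 hnorm0.
move=> s [[ls _] _]; apply/funext => x.
rewrite -[LHS]/0 -[RHS]/(s 0).
by have := ls (-1) 0 0; rewrite scaler0 addr0 scaleN1r addNr.
Qed.

End operators.

Section clifford.
Variable R : realType.
Local Notation mR := (measurableTypeR R).
Local Notation fock := (fock R).

Definition tensor n (z : mR -> R[i]) (w : n.-tuple mR -> R[i]) :
    n.+1.-tuple mR -> R[i] :=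
  fun t => z (thead t) * w [tuple of behead t].

(* The bounded extension to the Fock space of w |-> antisymmetrization (z (x) w). *)
Definition creation (z : mR -> R[i]) : fock -> fock :=
  xget 0 [set T | bounded_operator T /\
    forall n (w : n.-tuple mR -> R[i]), Lambda w ->
      T (chaos w) = chaos (antisymmetrization (tensor z w))].

Definition annihilation (z : mR -> R[i]) : fock -> fock := adjoint (creation z).

Definition Psi (z : mR -> R[i]) : fock -> fock :=
  creation z + annihilation (fun t => (z t)^*%C).

Definition clifford_algebra : set (fock -> fock) :=
  generated_von_neumann [set Psi z | z in @L2half R].

(* The von Neumann algebra of the fields with supp z contained in [0,t]. *)
Definition clifford_filtration (t : R) : set (fock -> fock) :=
  generated_von_neumann [set Psi z | z in [set z : mR -> R[i] | L2half z /\
    {ae @lebesgue_measure R, forall s, half_line s -> t < s -> z s = 0}]].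

Definition clifford_pred : {pred fock -> fock} :=
  [pred u : fock -> fock | `[< clifford_algebra u >]].

Lemma clifford_pred_submod : submod_closed clifford_pred.
Proof.
split=> [|a u v]; first by apply/asboolP; exact: generated_von_neumann0.
move=> /asboolP Cu /asboolP Cv; apply/asboolP.
exact: generated_von_neumann_linear.
Qed.
HB.instance Definition _ := GRing.isSubmodClosed.Build R[i] (fock -> fock)
  clifford_pred clifford_pred_submod.

Record clifford := Clifford {
  clifford_val :> fock -> fock; _ : clifford_val \in clifford_pred }.
HB.instance Definition _ := [isSub for clifford_val].
HB.instance Definition _ := [Choice of clifford by <:].
HB.instance Definition _ := [SubChoice_isSubLmodule of clifford by <:].

Definition vacuum_state (u : fock -> fock) : R[i] := dot (vacuum R) (u (vacuum R)).

(* m(u^* v) = <Omega, u^* v Omega> = <u Omega, v Omega>, see clifford_dotE. *)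
Definition clifford_dot (u v : clifford) : R[i] :=
  dot (u (vacuum R)) (v (vacuum R)).

Lemma clifford_dotE (u v u' : clifford) : is_adjoint u u' ->
  clifford_dot u v = vacuum_state (u' \o v).
Proof.
by move=> uu'; rewrite /clifford_dot uu'.
Qed.

Lemma clifford_dotDr u v w :
  clifford_dot u (v + w) = clifford_dot u v + clifford_dot u w.
Proof. exact: dotDr. Qed.
Lemma clifford_dotZr a u v : clifford_dot u (a *: v) = a * clifford_dot u v.
Proof. exact: dotZr. Qed.
Lemma clifford_dotC u v : clifford_dot u v = (clifford_dot v u)^*%C.
Proof. exact: dotC. Qed.
Lemma clifford_dot_ge0 u : 0 <= clifford_dot u u.
Proof. exact: dot_ge0. Qed.
HB.instance Definition _ := Lmodule_isPreHilbert.Build R clifford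
  clifford_dotDr clifford_dotZr clifford_dotC clifford_dot_ge0.

Definition L2C : hilbertType R := completion clifford.

(* The continuous extension of u |-> u Omega. *)
Definition gns_unitary : L2C -> fock :=
  xget 0 [set U | bounded_operator U /\
    forall u : clifford, U (emb u) = u (vacuum R)].

(* The preimage of f in Lambda_n under the unitary L2C -> fock. *)
Definition Jn n (f : n.-tuple mR -> R[i]) : L2C :=
  xget 0 [set xi | gns_unitary xi = chaos f].

(* The left C-module structure of L2C: the continuous extension of u |-> x u. *)
Definition left_action (x : fock -> fock) : L2C -> L2C :=
  xget 0 [set T | bounded_operator T /\
    forall u v : clifford, x \o u = v -> T (emb u) = emb v].

Definition L2C_filtration (t : R) : set L2C :=
  [set xi | exists u : nat -> clifford,
    (forall k, clifford_filtration t (u k)) /\ hcvg (fun k => emb (u k)) xi].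

End clifford.

Section bochner.
Variables (R : realType) (V : hilbertType R).
Local Notation mR := (measurableTypeR R).
Implicit Types (D : set mR) (u v : mR -> V).

Definition simple_function u := exists n (A : 'I_n -> set mR) (x : 'I_n -> V),
  (forall i, measurable (A i)) /\
    u = fun t => \sum_(i < n) (\1_(A i) t)%:C *: x i.

(* A pointwise limit of simple functions everywhere on D: every class of
   L^2(D; V) has such a representative. *)
Definition strongly_measurable D u := exists2 s : nat -> mR -> V,
  forall k, simple_function (s k) & forall t, D t -> hcvg (s ^~ t) (u t).

Definition bochner_L2 D u := strongly_measurable D u /\
    (\int[@lebesgue_measure R]_(t in D) (hnorm (u t) ^+ 2)%:E < +oo)%E.

Definition bochner_dot D u v : R[i] :=
  cintegral (@lebesgue_measure R) D (fun t => dot (u t) (v t)).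

Definition bochner_cvg D (U : nat -> mR -> V) u :=
  (\int[@lebesgue_measure R]_(t in D) (hnorm (U k t - u t) ^+ 2)%:E)%E
    @[k --> \oo] --> 0%E.

End bochner.

Section malliavin.
Variable R : realType.
Local Notation mR := (measurableTypeR R).
Local Notation L2C := (L2C R).

Definition derivative_chaos n : (n.-tuple mR -> R[i]) -> mR -> L2C :=
  match n with
  | 0 => fun _ _ => 0
  | m.+1 => fun v t => m.+1%:R *: Jn (fun s : m.-tuple mR => v [tuple of t :: s])
  end.

(* The graph of D on finite sums of Jn (v_n). *)
Definition derivative_finite (F : L2C) (G : mR -> L2C) :=
  exists N (v : forall n, n.-tuple mR -> R[i]),
    [/\ forall n, Lambda (v n),
        F = \sum_(n < N) Jn (v n) &
        G = fun t => \sum_(n < N) derivative_chaos (v n) t].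

(* The graph of the closure of D. *)
Definition derivative (F : L2C) (G : mR -> L2C) :=
  bochner_L2 (@half_line R) G /\
    exists (Fk : nat -> L2C) (Gk : nat -> mR -> L2C),
    [/\ forall k, derivative_finite (Fk k) (Gk k),
        hcvg Fk F & bochner_cvg (@half_line R) Gk G].

Definition dom_divergence (u : mR -> L2C) :=
  bochner_L2 (@half_line R) u /\
    exists c : R, forall F G, derivative F G ->
    normc (bochner_dot (@half_line R) G u) <= c * hnorm F.

Definition divergence (u : mR -> L2C) : L2C :=
  xget 0 [set x | forall F G, derivative F G ->
    dot F x = bochner_dot (@half_line R) G u].

End malliavin.

Section ito_clifford.
Variable R : realType.
Local Notation mR := (measurableTypeR R).
Local Notation L2C := (L2C R).

Definition unit_interval : set mR := [set t | 0 <= t <= 1].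

(* The space H[0,1]; the values of u outside [0,1] are irrelevant. *)
Definition adapted01 (u : mR -> L2C) := bochner_L2 unit_interval u /\
    {ae @lebesgue_measure R, forall s, unit_interval s -> L2C_filtration s (u s)}.

Definition extend0 (u : mR -> L2C) : mR -> L2C :=
  fun s => if 0 <= s <= 1 then u s else 0.

Definition Psi_process (t : R) : fock R -> fock R :=
  Psi (fun s : mR => if 0 <= s <= t then 1 else 0).

Record simple_process := SimpleProcess {
  sp_size : nat; sp_time : nat -> R; sp_val : nat -> L2C }.

(* h = sum_(k < n) h_k 1_[t_k, t_(k+1)), where sp_val h k stands for h_k. *)
Definition simple_adapted (h : simple_process) :=
  [/\ 0 <= sp_time h 0, sp_time h (sp_size h) <= 1,
      forall k, (k < sp_size h)%N -> sp_time h k <= sp_time h k.+1 &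
      forall k, (k < sp_size h)%N -> L2C_filtration (sp_time h k) (sp_val h k)].

Definition simple_process_fun (h : simple_process) (s : mR) : L2C :=
  \sum_(k < sp_size h)
    if sp_time h k <= s < sp_time h k.+1 then sp_val h k else 0.

Definition simple_integral (h : simple_process) : L2C :=
  \sum_(k < sp_size h)
    left_action (Psi_process (sp_time h k.+1) - Psi_process (sp_time h k))
      (sp_val h k).

(* The continuous extension of simple_integral, as the limit along any sequence
   of simple adapted processes converging to u. *)
Definition ito_integral (u : mR -> L2C) : L2C :=
  xget 0 [set y | exists h : nat -> simple_process,
    [/\ forall k, simple_adapted (h k),
        bochner_cvg unit_interval (fun k => simple_process_fun (h k)) u &
        hcvg (fun k => simple_integral (h k)) y]].

End ito_clifford.

(* Main.v *)
Require Import Defs.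
From HB Require Import structures.
From mathcomp Require Import all_boot all_order all_algebra.
From mathcomp Require Import all_classical all_reals all_analysis.
From mathcomp Require Import perm complex measurable_realfun ring lra.
Set Implicit Arguments. Unset Strict Implicit. Unset Printing Implicit Defensive.
Import Order.TTheory GRing.Theory Num.Theory.
Import numFieldNormedType.Exports.
Import ComplexField.Normc.
Local Open Scope classical_set_scope.
Local Open Scope ring_scope.
Local Open Scope complex_scope.

(** Proof idea. On the Fock space the increment Psi_b - Psi_a sends a vector x
    adapted to time a to b^*(1_]a,b]) x, because b(1_]a,b]) annihilates x: a field
    supported in [0,a] commutes with b(1_]a,b]) up to the parity operator, and
    b(1_]a,b]) kills the vacuum. Since n v_n(t,.) is paired with b^* by Fubini's
    theorem, < D F, 1_[a,b[ x > = < F, (Psi_b - Psi_a) x > for every finite chaos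
    sum F, so D is adjoint to the integral on simple adapted processes. The
    anticommutation relations give the Ito isometry, since the cross term
    < b(g) x, b(f) x' > always contains an annihilated vector. Projecting a
    continuous approximation of u at the left ends of a fine grid shows that
    simple adapted processes are dense, and the duality passes to the limit.
    The images of wedges of indicator functions under D are simple functions; as
    such wedges are total, the duality determines both sides uniquely. *)

(** * Hilbert spaces *)

(** Creation operators, adjoints, [gns_unitary], [Jn], [left_action] and both sides of the final
    identity are obtained by choice, so each of them can be used only after an existence proof. For
    creation this calls for a bound on b^*(z) uniform in the degree. Contractivity of
    anti-symmetrization gives only sqrt(n + 1) |z|; the bound |z| comes from the expansion of a
    bordered Gram determinant, which is the anticommutation relation tested on wedges: |b^*(z) x|^2
    = |z|^2 |x|^2 - |b(z) x|^2. The other obstacle is measurability. Elements of Lambda_n are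
    representatives, anti-symmetric only almost everywhere, and [chaos] is 0 off [Lambda], so
    sections of a kernel are meaningful only at almost every time. Approximants in the closure of
    the derivative are shown to be weakly measurable, and their convergence is a statement about
    lower integrals; the limit of the pairings is taken under these conditions. In the same way no
    regularity in t of the projections onto the filtration is assumed: their errors are controlled
    by measurable majorants built from grids. *)

Section linear_predicate.
Variables (K : pzRingType) (U V : lmodType K) (T : U -> V).
Hypothesis lT : linear T.

Lemma lin0 : T 0 = 0.
Proof. by have := lT (-1) 0 0; rewrite scaler0 addr0 scaleN1r addNr. Qed.

Lemma linD u v : T (u + v) = T u + T v.
Proof. by have := lT 1 u v; rewrite !scale1r. Qed.

Lemma linZ a u : T (a *: u) = a *: T u.
Proof. by have := lT a u 0; rewrite lin0 !addr0. Qed.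

Lemma linN u : T (- u) = - T u.
Proof. by rewrite -scaleN1r linZ scaleN1r. Qed.

Lemma linB u v : T (u - v) = T u - T v.
Proof. by rewrite linD linN. Qed.

Lemma lin_sum I (r : seq I) (P : pred I) (F : I -> U) :
  T (\sum_(i <- r | P i) F i) = \sum_(i <- r | P i) T (F i).
Proof. exact: (big_morph T linD lin0). Qed.

End linear_predicate.

Section prehilbert_more.
Variables (R : realType) (V : preHilbertType R).
Implicit Types u v w : V.

Lemma dotBr u v w : dot u (v - w) = dot u v - dot u w.
Proof. by rewrite dotDr dotNr. Qed.

Lemma dotBl u v w : dot (u - v) w = dot u w - dot v w.
Proof. by rewrite dotDl dotNl. Qed.

Lemma dot0l u : dot 0 u = 0.
Proof. by rewrite dotC dot0r conjc0. Qed.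

Lemma dot_sumr I (r : seq I) (P : pred I) (F : I -> V) u :
  dot u (\sum_(i <- r | P i) F i) = \sum_(i <- r | P i) dot u (F i).
Proof. by apply: (big_morph (dot u)) => [x y|]; [exact: dotDr|exact: dot0r]. Qed.

Lemma dot_suml I (r : seq I) (P : pred I) (F : I -> V) u :
  dot (\sum_(i <- r | P i) F i) u = \sum_(i <- r | P i) dot (F i) u.
Proof. by apply: (big_morph (dot^~ u)) => [x y|]; [exact: dotDl|exact: dot0l]. Qed.

Lemma hnorm_dot_eq0 u : hnorm u = 0 -> dot u u = 0.
Proof. by move=> u0; rewrite dotuu u0 expr0n. Qed.

Lemma hnorm2 u : hnorm u ^+ 2 = complex.Re (dot u u).
Proof. by rewrite dotuu. Qed.

(** With [a = dot u v], the number [dot (a *: u) v] is |a|^2, so the bound on real parts gives |a|^2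
    <= |a| |u| |v|, and a nonzero |a| cancels. *)
Lemma normc_dot_le u v : normc (dot u v) <= hnorm u * hnorm v.
Proof.
set a := dot u v.
have [a0|a0] := eqVneq a 0.
  by rewrite a0 normc0 mulr_ge0// hnorm_ge0.
have na : 0 < normc a.
  rewrite lt_neqAle; apply/andP; split; last by case: (a) => ? ?; exact: sqrtr_ge0.
  by apply/eqP => /esym /eq0_normc h; rewrite h eqxx in a0.
rewrite -(ler_pM2l na).
have := Re_dot_le (a *: u) v; rewrite dotZl -/a mulrC -sqr_normc normc_def hnormZ.
rewrite -rmorphXn /= -mulrA; apply: le_trans.
by case: (a) => x y /=; rewrite expr2.
Qed.

Lemma normc_Re (a : R[i]) : `|complex.Re a| <= normc a.
Proof.
case: a => x y /=; rewrite -sqrtr_sqr ler_sqrt ?addr_ge0 ?sqr_ge0//.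
by rewrite lerDl sqr_ge0.
Qed.

Lemma normc_Im (a : R[i]) : `|complex.Im a| <= normc a.
Proof.
case: a => x y /=; rewrite -sqrtr_sqr ler_sqrt ?addr_ge0 ?sqr_ge0//.
by rewrite lerDr sqr_ge0.
Qed.

Lemma normc_ge0 (a : R[i]) : 0 <= normc a.
Proof. by case: a => ? ?; exact: sqrtr_ge0. Qed.

Lemma hcvgP (x : nat -> V) l : hcvg x l <->
  forall e : R, 0 < e -> exists N, forall n, (N <= n)%N -> hnorm (x n - l) < e.
Proof.
split=> [/cvgrPdist_lt h e e0|h].
  have [N _ HN] := h _ e0; exists N => n Nn; have := HN n Nn.
  by rewrite sub0r normrN ger0_norm ?hnorm_ge0.
apply/cvgrPdist_lt => e e0; have [N HN] := h _ e0.
by exists N => // n Nn; rewrite sub0r normrN ger0_norm ?hnorm_ge0 ?HN.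
Qed.

Lemma hcvg_cst u : hcvg (fun=> u) u.
Proof. by apply/hcvgP => e e0; exists 0%N => n _; rewrite subrr hnorm0. Qed.

Lemma hcvg_cauchy (x : nat -> V) l : hcvg x l -> hcauchy x.
Proof.
move=> /hcvgP h e e0; have e2 : 0 < e / 2 by rewrite divr_gt0.
have [N HN] := h _ e2; exists N => m n Nm Nn.
rewrite (le_lt_trans (hnorm_dist _ l _))// [ltRHS]splitr.
by rewrite ltrD ?HN// hnormBC HN.
Qed.

Lemma hcvgD (x y : nat -> V) k l : hcvg x k -> hcvg y l ->
  hcvg (fun n => x n + y n) (k + l).
Proof.
move=> /hcvgP hx /hcvgP hy; apply/hcvgP => e e0.
have e2 : 0 < e / 2 by rewrite divr_gt0.
have [[N HN] [M HM]] := (hx _ e2, hy _ e2); exists (maxn N M) => n.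
rewrite geq_max => /andP[Nn Mn]; rewrite opprD addrACA.
by rewrite (le_lt_trans (hnorm_triangle _ _))// [ltRHS]splitr ltrD ?HN ?HM.
Qed.

(** The sign of [c] is left free, so that callers need not check it; a positive [x] is refuted at e
    = x / (2 (|c| + 1)). *)
Lemma le_small (x c : R) : (forall e : R, 0 < e -> x <= c * e) -> x <= 0.
Proof.
move=> h; rewrite leNgt; apply/negP => x0.
have d0 : 0 < `|c| + 1 by rewrite ltr_wpDl.
have := h (x / (2 * (`|c| + 1))); rewrite divr_gt0 ?mulr_gt0// => /(_ isT).
rewrite mulrA ler_pdivlMr ?mulr_gt0// => h'.
by have := ler_norm c; nra.
Qed.

Lemma hcvg_dot_eq (x : nat -> V) l y a :
  hcvg x l -> (forall k, dot y (x k) = a) -> dot y l = a.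
Proof.
move=> /hcvgP xl h; apply/eqP; rewrite -subr_eq0; apply/eqP/eq0_normc.
apply/eqP; rewrite eq_le normc_ge0 andbT; apply: (@le_small _ (hnorm y)) => e e0.
have [N HN] := xl _ e0; rewrite -(h N) -dotBr (le_trans (normc_dot_le _ _))//.
by rewrite ler_wpM2l ?hnorm_ge0// hnormBC ltW// HN.
Qed.

Lemma hnorm_parallelogram u v :
  hnorm (u + v) ^+ 2 + hnorm (u - v) ^+ 2 = 2 * (hnorm u ^+ 2 + hnorm v ^+ 2).
Proof.
by rewrite !hnormD2 Defs.hnormN dotNr; case: (dot u v) => a b /=; ring.
Qed.

End prehilbert_more.

Section bounded_maps.
Variables (R : realType) (V W : preHilbertType R).

Definition bounded_map (T : V -> W) :=
  linear T /\ exists c : R, forall x, hnorm (T x) <= c * hnorm x.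

Lemma hcvg_map (T : V -> W) (c : R) x l : linear T ->
  (forall u, hnorm (T u) <= c * hnorm u) -> hcvg x l -> hcvg (T \o x) (T l).
Proof.
move=> lT Tc /hcvgP xl; apply/hcvgP => e e0.
have d0 : 0 < `|c| + 1 by rewrite ltr_wpDl.
have [|N HN] := xl (e / (`|c| + 1)); first by rewrite divr_gt0.
exists N => n Nn; rewrite /= -linB// (le_lt_trans (Tc _))//.
have := HN _ Nn; rewrite ltr_pdivlMr// => h; apply: le_lt_trans h.
rewrite mulrC ler_wpM2l ?hnorm_ge0//; have := ler_norm c; lra.
Qed.

End bounded_maps.

Section closed_subspaces.
Variables (R : realType) (V : preHilbertType R).

Definition subspace (M : set V) :=
  M 0 /\ forall a u v, M u -> M v -> M (a *: u + v).

Definition closed_subspace (M : set V) := subspace M /\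
  forall x l, (forall k, M (x k)) -> hcvg x l -> M l.

Definition adherence (M : set V) : set V :=
  [set l | forall e : R, 0 < e -> exists2 x, M x & hnorm (x - l) < e].

Lemma subspaceD M u v : subspace M -> M u -> M v -> M (u + v).
Proof. by move=> [_ h] Mu Mv; rewrite -[u]scale1r; exact: h. Qed.

Lemma subspaceZ M a u : subspace M -> M u -> M (a *: u).
Proof. by move=> [M0 h] Mu; rewrite -[_ *: _]addr0; exact: h. Qed.

Lemma subspaceN M u : subspace M -> M u -> M (- u).
Proof. by move=> h Mu; rewrite -scaleN1r; exact: subspaceZ. Qed.

Lemma subspaceB M u v : subspace M -> M u -> M v -> M (u - v).
Proof. by move=> h Mu Mv; apply: subspaceD => //; exact: subspaceN. Qed.

Lemma subspace_sum M I (r : seq I) (P : pred I) (F : I -> V) : subspace M ->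
  (forall i, P i -> M (F i)) -> M (\sum_(i <- r | P i) F i).
Proof.
move=> sM h; apply: (big_ind M) => //; first by case: sM.
by move=> x y; exact: subspaceD.
Qed.

Lemma adherence_hcvg (M : set V) l :
  adherence M l -> exists2 x, (forall k, M (x k)) & hcvg x l.
Proof.
move=> h; have /choice[x Hx] : forall k : nat, exists x, M x /\ hnorm (x - l) < k.+1%:R^-1.
  by move=> k; have [|x] := h k.+1%:R^-1; [rewrite invr_gt0|exists x].
exists x => [k|]; first by case: (Hx k).
apply/hcvgP => e e0; have [N _ HN] := near_infty_natSinv_lt (PosNum e0).
by exists N => n Nn; case: (Hx n) => _ h'; rewrite (lt_trans h')//; exact: HN.
Qed.

Lemma adherence_closed M : subspace M -> closed_subspace (adherence M).
Proof.
move=> sM; have [M0 _] := sM; split; first split.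
- by move=> e e0; exists 0; rewrite // subrr hnorm0.
- move=> a u v /adherence_hcvg[x Mx xu] /adherence_hcvg[y My yv] e e0.
  have := hcvgD (hcvg_map (T := *:%R a) _ _ xu) yv.
  move=> /(_ (normc a) _ _)/hcvgP/(_ _ e0)[||N HN].
  + by move=> b p q; rewrite scalerDr !scalerA mulrC.
  + by move=> p; rewrite hnormZ.
  exists (a *: x N + y N); last exact: HN.
  by apply: subspaceD => //; exact: subspaceZ.
- move=> x l Mx /hcvgP xl e e0; have e2 : 0 < e / 2 by rewrite divr_gt0.
  have [N HN] := xl _ e2; have [y My yx] := Mx N _ e2.
  exists y => //; rewrite (le_lt_trans (hnorm_dist _ (x N) _))// [ltRHS]splitr.
  by rewrite ltrD// HN.
Qed.

Lemma sub_adherence M : M `<=` adherence M.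
Proof. by move=> x Mx e e0; exists x; rewrite // subrr hnorm0. Qed.

Lemma dot_closed_subspace (y : V) : closed_subspace [set x | dot y x = 0].
Proof.
split; first split.
- exact: dot0r.
- by move=> a u v /= u0 v0; rewrite dotDr dotZr u0 v0 mulr0 addr0.
- by move=> x l h xl; exact: (hcvg_dot_eq xl h).
Qed.

End closed_subspaces.

Section hilbert.
Variables (R : realType) (H : hilbertType R).
Implicit Types (u v x y : H) (M : set H).

Lemma hnorm_eq0 u : hnorm u = 0 -> u = 0.
Proof. by move=> /hnorm_dot_eq0; exact: dot_eq0. Qed.

Lemma hcvg_unique (x : nat -> H) k l : hcvg x k -> hcvg x l -> k = l.
Proof.
move=> /hcvgP xk /hcvgP xl; apply/eqP; rewrite -subr_eq0; apply/eqP/hnorm_eq0.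
apply/eqP; rewrite eq_le hnorm_ge0 andbT; apply: (@le_small _ _ 2) => e e0.
have [[N HN] [M HM]] := (xk _ e0, xl _ e0).
have Nn := leq_maxl N M; have Mn := leq_maxr N M.
rewrite (le_trans (hnorm_dist _ (x (maxn N M)) _))// mulr2n mulrDl mul1r.
by rewrite lerD// ?[hnorm (k - _)]hnormBC ltW ?HN ?HM.
Qed.

Lemma eq_dot u v : (forall x, dot x u = dot x v) -> u = v.
Proof.
move=> h; apply/eqP; rewrite -subr_eq0; apply/eqP/dot_eq0.
by rewrite dotBr h subrr.
Qed.

(** The form in which density arguments use boundedness: two bounded maps that agree on a total set
    agree everywhere. *)
Lemma closed_subspace_eq (V : preHilbertType R) (T T' : V -> H) :
  bounded_map T -> bounded_map T' ->
  closed_subspace [set x | T x = T' x].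
Proof.
move=> [lT [c Tc]] [lT' [c' Tc']]; split; first split.
- by rewrite /= !lin0.
- by move=> a u v /= uE vE; rewrite lT lT' uE vE.
- move=> x l h xl; apply: (@hcvg_unique (T \o x)) => //.
    exact: (hcvg_map lT Tc xl).
  rewrite (_ : T \o x = T' \o x); first exact: (hcvg_map lT' Tc' xl).
  by apply/funext.
Qed.

(** A minimizing sequence is Cauchy: midpoints stay in [M], so the parallelogram law bounds |p_m -
    p_n|^2 by the excess of the two squared distances over d^2. *)
Lemma projection M x : closed_subspace M ->
  exists2 p, M p & forall m, M m -> dot m (x - p) = 0.
Proof.
move=> [sM cM]; have [M0 Ml] := sM.
pose D := [set r : R | exists2 m, M m & r = hnorm (x - m)].
have D0 : D !=set0 by exists (hnorm (x - 0)); exists 0.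
have lbD : lbound D 0 by move=> _ [m _ ->]; exact: hnorm_ge0.
have hD : has_inf D by split=> //; exists 0.
pose d := inf D.
have dD m : M m -> d <= hnorm (x - m).
  by move=> Mm; apply: ge_inf; [exists 0|exists m].
have d0 : 0 <= d by exact: lb_le_inf.
have /choice[p Hp] : forall k : nat, exists m, M m /\ hnorm (x - m) < d + k.+1%:R^-1.
  move=> k; have [|_ [m Mm ->] h] := @inf_adherent _ D k.+1%:R^-1 _ hD.
    by rewrite invr_gt0.
  by exists m.
have key m n : hnorm (p m - p n) ^+ 2 <=
    2 * (hnorm (x - p m) ^+ 2 - d ^+ 2) + 2 * (hnorm (x - p n) ^+ 2 - d ^+ 2).
  have := hnorm_parallelogram (x - p m) (x - p n).
  rewrite (_ : x - p m - (x - p n) = p n - p m); last first.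
    by rewrite opprB addrC addrA subrK.
  rewrite [hnorm (p n - p m)]hnormBC => pl.
  have Mmid : M (2^-1 *: (p m + p n)).
    by apply: subspaceZ => //; apply: subspaceD => //; [case: (Hp m)|case: (Hp n)].
  have := dD _ Mmid.
  have -> : hnorm (x - 2^-1 *: (p m + p n)) = 2^-1 * hnorm (x - p m + (x - p n)).
    rewrite -[in RHS](_ : 2 *: (x - 2^-1 *: (p m + p n)) = x - p m + (x - p n)).
      rewrite hnormZ mulrA (_ : 2^-1 * normc _ = 1) ?mul1r//.
      rewrite (_ : 2 = 2%:C) ?normc_def /normc /= ?expr0n/= ?addr0 ?sqrtr_sqr ?normr_nat ?mulVf//.
      by rewrite rmorph_nat.
    rewrite scalerBr scalerA divff ?pnatr_eq0// scale1r scaler_nat mulr2n.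
    by rewrite opprD addrACA.
  move: pl (hnorm_ge0 (x - p m + (x - p n))).
  move: (hnorm _) (hnorm _) (hnorm (x - p m)) (hnorm (x - p n)) => a b e f pl a0 da.
  have : d ^+ 2 <= (2^-1 * b) ^+ 2 by rewrite lerXn2r ?nnegrE ?mulr_ge0.
  by rewrite exprMn; lra.
have cp : hcauchy p.
  move=> e e0.
  (* As e' <= 1, the excess (d + e')^2 - d^2 is at most (2 d + 1) e' <= e^2 / 4, and [key] adds up
     four such quarters. *)
  pose e' := Num.min 1 (e ^+ 2 / (8 * (d + 1))).
  have d1 : 0 < 8 * (d + 1) by rewrite mulr_gt0// ltr_wpDl.
  have e'0 : 0 < e' by rewrite lt_min ltr01 divr_gt0// exprn_gt0.
  have [N _ HN] := near_infty_natSinv_lt (PosNum e'0).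
  exists N => m n Nm Nn; rewrite -(@ltr_pXn2r _ 2%N)// ?nnegrE ?hnorm_ge0 ?ltW//.
  apply: le_lt_trans (key m n) _.
  have h k : (N <= k)%N -> hnorm (x - p k) ^+ 2 - d ^+ 2 < e ^+ 2 / 4.
    move=> Nk; have [_ h1] := Hp k; have := HN k Nk; rewrite /= => h2.
    have h3 : hnorm (x - p k) < d + e' by rewrite (lt_trans h1)// ltrD2l.
    have h4 : hnorm (x - p k) ^+ 2 < (d + e') ^+ 2.
      by rewrite ltr_pXn2r// nnegrE ?hnorm_ge0// addr_ge0// ltW.
    have e1 : e' <= 1 by rewrite ge_min lexx.
    have : e' <= e ^+ 2 / (8 * (d + 1)) by rewrite ge_min lexx orbT.
    rewrite ler_pdivlMr// => e2; nra.
  by have := h _ Nm; have := h _ Nn; lra.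
have [l pl] : exists l : H, hcvg p l by exact: hcomplete.
have Ml' : M l by apply: cM pl => k; case: (Hp k).
have ld : hnorm (x - l) <= d.
  rewrite -subr_le0; apply: (@le_small _ _ 2) => e e0.
  move/hcvgP : pl => /(_ _ e0)[N HN].
  have [N' _ HN'] := near_infty_natSinv_lt (PosNum e0).
  have h1 := HN _ (leq_maxl N N'); have h2 := HN' _ (leq_maxr N N').
  have [_ h3] := Hp (maxn N N'); rewrite /= in h2.
  have h4 : hnorm (x - p (maxn N N')) < d + e by rewrite (lt_trans h3)// ltrD2l.
  have h5 := hnorm_dist x (p (maxn N N')) l.
  by move: (hnorm _) (hnorm _) (hnorm _) h1 h4 h5 => a b c; lra.
exists l => // m Mm.
(* First variation of the distance in the direction m'. The step [s] has |m'|^2 + 1 as denominator,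
   so that m' = 0 is no special case. The imaginary part is reached afterwards through the direction
   i m. *)
have Re0 m' : M m' -> complex.Re (dot m' (x - l)) = 0.
  move=> Mm'; set c := complex.Re _; pose s := c / (hnorm m' ^+ 2 + 1).
  have := dD (l + s%:C *: m') (subspaceD sM Ml' (subspaceZ _ sM Mm')).
  rewrite -(@ler_pXn2r _ 2%N)// ?nnegrE ?hnorm_ge0//.
  rewrite opprD addrA hnormD2 Defs.hnormN hnormZ dotNr dotZr dotC.
  have : hnorm (x - l) ^+ 2 <= d ^+ 2 by rewrite lerXn2r ?nnegrE ?hnorm_ge0.
  rewrite /c; case: (dot m' (x - l)) @c @s => a b c s /= h1 h2.
  have h3 : 0 <= s ^+ 2 * hnorm m' ^+ 2 - 2 * s * a.
    move: h2; rewrite /normc /= expr0n/= addr0 sqrtr_sqr exprMn real_normK ?num_real//.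
    rewrite mul0r; lra.
  have dd : 0 < hnorm m' ^+ 2 + 1 by rewrite ltr_wpDl// sqr_ge0.
  have sE : s * (hnorm m' ^+ 2 + 1) = a by rewrite /s mulfVK// gt_eqF.
  have h4 : 0 <= - s ^+ 2 * (hnorm m' ^+ 2 + 2).
    apply: le_trans h3 _; rewrite -sE; lra.
  have : s ^+ 2 = 0.
    apply/eqP; rewrite eq_le sqr_ge0 andbT.
    have := sqr_ge0 s; have := sqr_ge0 (hnorm m'); nra.
  by move=> /eqP; rewrite sqrf_eq0 => /eqP s0; rewrite -sE s0 mul0r.
have := Re0 _ Mm; have := Re0 _ (subspaceZ ('i)%C sM Mm).
by rewrite dotZl; case: (dot _ _) => a b /= ? ?; congr (_ +i* _); lra.
Qed.

(** If [w] is the component orthogonal to the kernel of a vector [z] with f z != 0, then x - (f x /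
    f w) w lies in the kernel, hence is orthogonal to [w]; this determines f x. *)
Lemma riesz (f : H -> R[i]) (c : R) :
  (forall a u v, f (a *: u + v) = a * f u + f v) ->
  (forall u, normc (f u) <= c * hnorm u) ->
  exists y, forall x, f x = dot y x.
Proof.
move=> lf fc.
have f0 : f 0 = 0.
  by have := lf (-1) 0 0; rewrite scaler0 addr0 mulN1r addNr.
have fZ a u : f (a *: u) = a * f u by have := lf a u 0; rewrite f0 !addr0.
have fD u v : f (u + v) = f u + f v by have := lf 1 u v; rewrite scale1r mul1r.
have fB u v : f (u - v) = f u - f v by rewrite fD -scaleN1r fZ mulN1r.
have cM : closed_subspace [set x | f x = 0].
  split; first by split=> //= a u v u0 v0; rewrite lf u0 v0 mulr0 addr0.
  move=> x l h /hcvgP xl; apply/eq0_normc/eqP; rewrite eq_le normc_ge0 andbT.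
  apply: (@le_small _ _ `|c|) => e e0; have [N HN] := xl _ e0.
  rewrite -[f l]subr0 -(h N) -fB (le_trans (fc _))//.
  rewrite (le_trans (ler_wpM2r (hnorm_ge0 _) (ler_norm c)))//.
  by rewrite ler_wpM2l// hnormBC ltW// HN.
have [[z fz]|] := pselect (exists z, f z != 0); last first.
  move=> /forallNP h; exists 0 => x; rewrite dot0l; apply/eqP.
  by apply/negP => /negP; exact: h.
have [p fp hp] := projection z cM; pose w := z - p.
have fw : f w = f z by rewrite fB fp subr0.
have w0 : dot w w != 0.
  by apply/eqP => /dot_eq0 w0; move: fz; rewrite -fw w0 f0 eqxx.
exists (((f w)^*%C / dot w w) *: w) => x; rewrite dotZl.
have : dot (x - (f x / f w) *: w) w = 0.
  by apply: hp => /=; rewrite fB fZ mulfVK ?subrr// fw.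
move/(congr1 (fun a : R[i] => a^*%C)); rewrite -dotC dotBr dotZr conjc0.
move=> /eqP; rewrite subr_eq0 => /eqP E.
have fw0 : f w != 0 by rewrite fw.
have -> : ((f w)^*%C / dot w w)^*%C = f w / dot w w.
  rewrite rmorphM fmorphV/= -dotC; congr (_ / _).
  by case: (f w) => a b /=; rewrite opprK.
by rewrite E; field; rewrite w0 fw0.

Qed.

(** [S y] represents the functional x -> <y, T x>. Its bound comes from |S x|^2 = Re <T (S x), x>
    after division by |S x|. *)
Lemma adjoint_exists (T : H -> H) : bounded_operator T ->
  exists S, bounded_operator S /\ is_adjoint T S.
Proof.
move=> [lT [c Tc]].
have c0 : 0 <= `|c| by [].
have Tc' x : hnorm (T x) <= `|c| * hnorm x.
  by rewrite (le_trans (Tc x))// ler_wpM2r ?hnorm_ge0// ler_norm.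
have /choice[S HS] : forall y, exists z, forall x, dot y (T x) = dot z x.
  move=> y; apply: (@riesz _ (`|c| * hnorm y)) => [a u v|u].
    by rewrite lT dotDr dotZr.
  rewrite (le_trans (normc_dot_le _ _))// -mulrA mulrCA ler_wpM2l ?hnorm_ge0//.
have adj : is_adjoint T S.
  by move=> x y; rewrite dotC HS -dotC.
exists S; split=> //; split.
  by move=> a u v; apply: eq_dot => x; rewrite -adj !dotDr !dotZr -!adj.
exists `|c| => x; have [->|x0] := eqVneq (hnorm (S x)) 0.
  by rewrite mulr_ge0// hnorm_ge0.
have Sx : 0 < hnorm (S x) by rewrite lt_neqAle eq_sym x0 hnorm_ge0.
rewrite -(ler_pM2r Sx) -expr2 hnorm2 -adj (le_trans (Re_dot_le _ _))//.
by rewrite mulrAC ler_wpM2r// hnorm_ge0.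
Qed.

Lemma is_adjoint_sym (T S : H -> H) : is_adjoint T S -> is_adjoint S T.
Proof. by move=> h x y; rewrite dotC -h -dotC. Qed.

Lemma adjointP (T : H -> H) : bounded_operator T ->
  bounded_operator (adjoint T) /\ is_adjoint T (adjoint T).
Proof.
move=> /adjoint_exists[S HS].
exact: (@xgetPex _ 0 [set S | bounded_operator S /\ is_adjoint T S]) (ex_intro _ S HS).
Qed.

Lemma bounded_add (T S : H -> H) : bounded_operator T -> bounded_operator S ->
  bounded_operator (T + S).
Proof.
move=> [lT [c Tc]] [lS [d Sd]]; split.
  move=> a u v; rewrite -[LHS]/(T _ + S _) lT lS.
  by rewrite -[RHS]/(a *: (T u + S u) + (T v + S v)) scalerDr addrACA.
exists (c + d) => x; rewrite -[X in hnorm X]/(T x + S x) mulrDl.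
by rewrite (le_trans (hnorm_triangle _ _))// lerD.
Qed.

Lemma bounded_scale a (T : H -> H) : bounded_operator T -> bounded_operator (a *: T).
Proof.
move=> [lT [c Tc]]; split.
  move=> b u v; rewrite -[LHS]/(a *: T _) -[RHS]/(b *: (a *: T u) + a *: T v) lT.
  by rewrite scalerDr !scalerA mulrC.
exists (normc a * c) => x; rewrite -[X in hnorm X]/(a *: T x) hnormZ -mulrA.
by rewrite ler_wpM2l// normc_ge0.
Qed.

Lemma bounded_comp (T S : H -> H) : bounded_operator T -> bounded_operator S ->
  bounded_operator (T \o S).
Proof.
move=> [lT [c Tc]] [lS [d Sd]]; split.
  by move=> a u v; rewrite /= lS lT.
exists (`|c| * d) => x /=; rewrite (le_trans (Tc _))//.
rewrite -mulrA (le_trans (ler_wpM2r (hnorm_ge0 _) (ler_norm c)))//.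
by rewrite ler_wpM2l.
Qed.

Lemma bounded_id : bounded_operator (@id H).
Proof. by split=> //; exists 1 => x; rewrite mul1r. Qed.

Lemma bounded_zero : bounded_operator (0 : H -> H).
Proof.
split=> [a u v|]; first by rewrite -[LHS]/0 -[RHS]/(a *: 0 + 0) scaler0 addr0.
by exists 0 => x; rewrite mul0r -[X in hnorm X]/0 hnorm0.
Qed.

Lemma commutant_adjoint (S : set (H -> H)) (T T' : H -> H) :
  (forall s, S s -> exists2 s', S s' & is_adjoint s s') ->
  commutant S T -> bounded_operator T' -> is_adjoint T T' -> commutant S T'.
Proof.
move=> hS [bT cT] bT' adj; split=> // s Ss; have [s' Ss' ss'] := hS _ Ss.
have h := congr1 (@^~ _) (cT _ Ss').
apply/funext => y; apply: eq_dot => x /=.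
rewrite -adj -(is_adjoint_sym ss') -[RHS](is_adjoint_sym ss') -adj.
by have /= -> := h x.
Qed.

(** This is how commutation passes from generators to the algebra they generate: once the generators
    lie in the commutant of a self-adjoint set, so does everything generated. The bicommutant
    condition is the usual S''' = S'. *)
Lemma commutant_von_neumann (S : set (H -> H)) :
  (forall s, S s -> bounded_operator s) ->
  (forall s, S s -> exists2 s', S s' & is_adjoint s s') ->
  von_neumann_algebra (commutant S).
Proof.
move=> Sb hS; split.
- by move=> T [].
- move=> T ST; have [bT _] := ST; have [T' [bT' adj]] := adjoint_exists bT.
  by exists T' => //; exact: commutant_adjoint ST bT' adj.
- apply/seteqP; split=> T [bT cT]; split=> // s Ss.
    by apply: cT; split; [exact: Sb|move=> t [_ /(_ s Ss)]].
  by have [_] := Ss; move=> /(_ T) <-.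
Qed.

Lemma generated_von_neumann_sub (S M : set (H -> H)) : von_neumann_algebra M -> S `<=` M ->
  @generated_von_neumann _ H S `<=` M.
Proof. by move=> vM SM u; apply. Qed.

Lemma sub_generated_von_neumann S : S `<=` @generated_von_neumann _ H S.
Proof. by move=> x Sx M [_]; exact. Qed.

Lemma generated_von_neumann_comp S (u v : H -> H) : @generated_von_neumann _ H S u ->
  @generated_von_neumann _ H S v -> @generated_von_neumann _ H S (u \o v).
Proof.
move=> Su Sv M [vM SM]; have [Mb _ MM] := vM.
have [Mu Mv] : M u /\ M v by split; [exact: Su|exact: Sv].
rewrite -MM; split; first by apply: bounded_comp; exact: Mb.
move=> s [_ cs]; apply/funext => x /=.
have /= <- := congr1 (@^~ x) (cs _ Mv).
by have /= <- := congr1 (@^~ (v x)) (cs _ Mu).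
Qed.

(** An upper bound for all generated algebras, from which the boundedness of their elements is read
    off. *)
Lemma von_neumann_all : von_neumann_algebra [set T : H -> H | bounded_operator T].
Proof.
split=> //.
  by move=> u /adjoint_exists[v [bv uv]]; exists v.
apply/seteqP; split=> T; first by case.
by move=> bT; split=> // s [_]; move=> /(_ _ bT) <-.
Qed.

Lemma generated_von_neumann_bounded S (u : H -> H) : (forall s, S s -> bounded_operator s) ->
  @generated_von_neumann _ H S u -> bounded_operator u.
Proof. by move=> Sb; exact: (generated_von_neumann_sub von_neumann_all). Qed.

Lemma generated_von_neumann_id S : @generated_von_neumann _ H S id.
Proof.
move=> M [[_ _ <-] _]; split; first exact: bounded_id.
by move=> s _; apply/funext.
Qed.

End hilbert.

Section completion_extension.
Variables (R : realType) (V : preHilbertType R).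

Lemma emb_hcvg (x : completion V) : exists y : nat -> V, hcvg (fun k => emb (y k)) x.
Proof.
elim/class_ind: x => x; exists x; apply/hcvgP => e e0.
have [|N HN] := @emb_dense _ _ x (e / 2); first by rewrite divr_gt0.
exists N => n Nn; rewrite hnormBC (le_lt_trans (HN _ Nn))//.
by rewrite ltr_pdivrMr// ltr_pMr// ltr1n.
Qed.

Lemma closed_subspace_emb (M : set (completion V)) : closed_subspace M ->
  (forall v, M (emb v)) -> forall x, M x.
Proof. by move=> [_ cM] h x; have [y yx] := emb_hcvg x; exact: cM yx. Qed.

Variable K : hilbertType R.

Lemma completion_ext (T T' : completion V -> K) : bounded_map T -> bounded_map T' ->
  (forall v, T (emb v) = T' (emb v)) -> T = T'.
Proof.
move=> bT bT' h; apply/funext => x.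
exact: (closed_subspace_emb (closed_subspace_eq bT bT')).
Qed.

Lemma completion_extend (T : V -> K) : bounded_map T ->
  exists T' : completion V -> K, bounded_map T' /\ forall v, T' (emb v) = T v.
Proof.
move=> [lT [c0 Tc0]].
have c_ge0 : 0 <= `|c0| by [].
pose c : R := `|c0|.
have Tc x : hnorm (T x) <= c * hnorm x.
  by rewrite (le_trans (Tc0 x))// ler_wpM2r ?hnorm_ge0// ler_norm.
have cau (x : completion V) (y : nat -> V) : hcvg (fun k => emb (y k)) x ->
    exists z, hcvg (T \o y) z.
  move=> /hcvg_cauchy cy; apply: hcomplete => e e0.
  have c1 : 0 < c + 1 by exact: ltr_wpDl.
  have [|N HN] := cy (e / (c + 1)); first by rewrite divr_gt0.
  exists N => m n Nm Nn; have := HN _ _ Nm Nn.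
  rewrite -raddfB hnorm_emb ltr_pdivlMr// /= -linB// => h.
  rewrite (le_lt_trans (Tc _))// (le_lt_trans _ h)// mulrC.
  by rewrite ler_wpM2l ?hnorm_ge0// lerDl.
have /choice[T' HT'] : forall x : completion V, exists z, exists y : nat -> V,
    hcvg (fun k => emb (y k)) x /\ hcvg (T \o y) z.
  move=> x; have [y yx] := emb_hcvg x; have [z yz] := cau _ _ yx.
  by exists z, y.
(* The bound is shown along every approximating sequence, not only the chosen one. Applied to the
   difference of two sequences with the same limit, it gives independence of the sequence, hence
   linearity. *)
have key (x : completion V) (y : nat -> V) (z : K) :
    hcvg (fun k => emb (y k)) x -> hcvg (T \o y) z -> hnorm z <= c * hnorm x.
  move=> /hcvgP yx /hcvgP yz; rewrite -subr_le0; apply: (@le_small _ _ (c + 1)) => e e0.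
  have [[N HN] [M HM]] := (yx _ e0, yz _ e0).
  have h1 := HN _ (leq_maxl N M); have h2 := HM _ (leq_maxr N M).
  set k := maxn N M in h1 h2.
  have h3 := hnorm_triangle (z - T (y k)) (T (y k)); rewrite subrK hnormBC in h3.
  have h4 := Tc (y k); rewrite -(hnorm_emb (y k)) in h4.
  have h5 := hnorm_triangle (emb (y k) - x) x; rewrite subrK in h5.
  have h6 : c * hnorm (emb (y k)) <= c * (hnorm (emb (y k) - x) + hnorm x).
    by rewrite ler_wpM2l.
  have h7 : c * hnorm (emb (y k) - x) <= c * e by rewrite ler_wpM2l// ltW.
  rewrite /= in h2; lra.
have uniq (x : completion V) (y : nat -> V) (z : K) :
    hcvg (fun k => emb (y k)) x -> hcvg (T \o y) z -> z = T' x.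
  move=> yx yz; have [y' [yx' yz']] := HT' x.
  apply/eqP; rewrite -subr_eq0; apply/eqP/hnorm_eq0/eqP; rewrite eq_le hnorm_ge0 andbT.
  have := @key 0 (fun k => y k - y' k) (z - T' x); rewrite hnorm0 mulr0; apply.
    have := hcvgD yx (hcvg_map (T := -%R) (c := 1) _ _ yx').
    rewrite subrr; have -> : (fun k => emb (y k - y' k)) =
      (fun n => emb (y n) + (-%R \o (fun k => emb (y' k))) n).
      by apply/funext => k; rewrite raddfB.
    apply; first by move=> a u v; rewrite opprD scalerN.
    by move=> u; rewrite Defs.hnormN mul1r.
  have := hcvgD yz (hcvg_map (T := -%R) (c := 1) _ _ yz').
  have -> : (T \o (fun k => y k - y' k)) =
      (fun n => (T \o y) n + (-%R \o (T \o y')) n).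
    by apply/funext => k; rewrite /= linB.
  apply; first by move=> a u v; rewrite opprD scalerN.
  by move=> u; rewrite Defs.hnormN mul1r.
exists T'; split; last first.
  by move=> v; apply/esym/(uniq _ (fun=> v)); exact: hcvg_cst.
split; last first.
  by exists c => x; have [y [yx yz]] := HT' x; exact: key yx yz.
move=> a u v; have [y [yu yTu]] := HT' u; have [y' [yv yTv]] := HT' v.
apply/esym/(uniq _ (fun k => a *: y k + y' k)).
  rewrite (_ : (fun _ => _) = fun n => (( *:%R a) \o (fun k => emb (y k))) n + emb (y' n)).
    apply: hcvgD yv; apply: (hcvg_map (c := normc a)) yu.
      by move=> b p q; rewrite scalerDr !scalerA mulrC.
    by move=> p; rewrite hnormZ.
  by apply/funext => k; rewrite linearP.
rewrite (_ : _ \o _ = fun n => (( *:%R a) \o (T \o y)) n + (T \o y') n).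
  apply: hcvgD yTv; apply: (hcvg_map (c := normc a)) yTu.
    by move=> b p q; rewrite scalerDr !scalerA mulrC.
  by move=> p; rewrite hnormZ.
by apply/funext => k; rewrite /= lT.
Qed.

End completion_extension.

(** * Lebesgue measure on tuples *)

Section rectangles.
Variable R : realType.
Local Notation mR := (measurableTypeR R).

Definition rect n (A : 'I_n -> set mR) : set (n.-tuple mR) :=
  [set t | forall i, A i (tnth t i)].

Definition rects n : set (set (n.-tuple mR)) :=
  [set rect A | A in [set A | forall i, measurable (A i)]].

Arguments rects n : clear implicits.

Lemma measurable_rect n (A : 'I_n -> set mR) :
  (forall i, measurable (A i)) -> measurable (rect A).
Proof.
move=> mA; rewrite (_ : rect A = \big[setI/setT]_(i < n) ((@tnth n mR)^~ i @^-1` A i)).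
  apply: bigsetI_measurable => i _.
  by rewrite -[X in measurable X]setTI; apply: measurable_tnth.
apply/seteqP; split=> t.
  by move=> h; rewrite -bigcap_seq => i /= _; exact: h.
by rewrite -bigcap_seq => h i; apply: (h i); rewrite /= mem_index_enum.
Qed.

Lemma rects_measurable n : rects n `<=` measurable.
Proof. by move=> _ [A mA <-]; exact: measurable_rect. Qed.

Lemma rectI n (A B : 'I_n -> set mR) :
  rect A `&` rect B = rect (fun i => A i `&` B i).
Proof.
apply/seteqP; split=> t /=; first by move=> [? ?].
by move=> h; split=> i; case: (h i).
Qed.

Lemma setI_closed_rects n : setI_closed (rects n).
Proof.
move=> _ _ [A mA <-] [B mB <-]; exists (fun i => A i `&` B i); last by rewrite rectI.
by move=> i; exact: measurableI.
Qed.

(** One-coordinate cylinders generate the sigma-algebra but are not stable under intersection.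
    Rectangles are, so they can feed the uniqueness theorem for measures and Dynkin induction. *)
Lemma measurable_tupleE n : @measurable _ (n.-tuple mR) = <<s rects n >>.
Proof.
apply/seteqP; split; last first.
  by apply: smallest_sub; [exact: sigma_algebra_measurable|exact: rects_measurable].
apply: smallest_sub; first exact: smallest_sigma_algebra.
move=> B; rewrite -bigcup_seq/= => -[i _ [A mA <-]].
apply: sub_sigma_algebra; exists (fun j => if j == i then A else setT).
  by move=> j; case: ifP.
apply/seteqP; split=> t /=.
  by move=> /(_ i); rewrite eqxx.
by move=> [_ h] j; case: eqP => // ->.
Qed.

Lemma nlebesgue_rect n (A : 'I_n -> set mR) : (forall i, measurable (A i)) ->
  nlebesgue R n (rect A) = (\prod_(i < n) @lebesgue_measure R (A i))%E.
Proof.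
elim: n A => [A mA|n IHn A mA].
  rewrite big_ord0 /= diracE mem_set//=; by case.
rewrite big_ord_recl -IHn//.
transitivity ((@lebesgue_measure R \x nlebesgue R n)%E
    (A ord0 `*` rect (fun i => A (lift ord0 i)))).
  rewrite /= /lebesgue_cons /pushforward; congr (_ _).
  apply/seteqP; split=> -[x t] /=.
    move=> h; split; first by have := h ord0.
    by move=> i; have := h (lift ord0 i); rewrite /tuple_cons tnthS.
  move=> [h0 h] i; case: (unliftP ord0 i) => [j ->|->//].
  by rewrite /tuple_cons tnthS; exact: h.
by rewrite product_measure1E//; exact: measurable_rect.
Qed.

Lemma measurable_perm_tuple n (s : 'S_n) :
  measurable_fun setT (@perm_tuple R n s).
Proof.
apply/measurable_fun_tnthP => i.
rewrite (_ : _ \o _ = (@tnth n mR)^~ (s i)); first exact: measurable_tnth.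
by apply/funext => t /=; rewrite tnth_mktuple.
Qed.

Lemma perm_tuple_orthant n (s : 'S_n) (t : n.-tuple mR) :
  orthant (perm_tuple s t) <-> orthant t.
Proof.
split=> h i; last by rewrite tnth_mktuple; exact: h.
by have := h ((s^-1)%g i); rewrite tnth_mktuple permKV.
Qed.

Lemma perm_tuple_rect n (s : 'S_n) (A : 'I_n -> set mR) :
  @perm_tuple R n s @^-1` rect A = rect (fun i => A ((s^-1)%g i)).
Proof.
apply/seteqP; split=> t /= h i.
  by have := h ((s^-1)%g i); rewrite tnth_mktuple permKV.
by have := h (s i); rewrite tnth_mktuple permK.
Qed.

(** * Invariance of Lebesgue measure under permutations of the coordinates *)

Section perm_invariance.
Variables (n : nat) (s : 'S_n).

Definition nlebesgue_perm : set (n.-tuple mR) -> \bar R :=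
  pushforward (nlebesgue R n) (@perm_tuple R n s).

Let preim A : measurable A -> measurable (@perm_tuple R n s @^-1` A).
Proof. by move=> mA; rewrite -[X in measurable X]setTI; exact: measurable_perm_tuple. Qed.

Let nlp0 : nlebesgue_perm set0 = 0%E.
Proof. by rewrite /nlebesgue_perm /pushforward preimage_set0 measure0. Qed.

Let nlp_ge0 A : (0 <= nlebesgue_perm A)%E.
Proof. by rewrite /nlebesgue_perm /pushforward; exact: measure_ge0. Qed.

Let nlp_sigma_additive : semi_sigma_additive nlebesgue_perm.
Proof.
move=> F mF tF mUF; rewrite /nlebesgue_perm /pushforward preimage_bigcup.
apply: measure_semi_sigma_additive.
- by move=> k; exact: preim.
- apply/trivIsetP => /= i j _ _ ij; rewrite -preimage_setI.
  by move/trivIsetP : tF => /(_ _ _ _ _ ij) ->//; rewrite preimage_set0.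
- by rewrite -preimage_bigcup; exact: preim.
Qed.

HB.instance Definition _ := isMeasure.Build _ _ _ nlebesgue_perm
  nlp0 nlp_ge0 nlp_sigma_additive.

(** A permutation only reorders the factors in the measure of a rectangle. The cubes [-k, k]^n have
    finite measure and exhaust the space, so agreement on rectangles suffices. *)
Lemma nlebesgue_permE A : measurable A ->
  nlebesgue R n (@perm_tuple R n s @^-1` A) = nlebesgue R n A.
Proof.
rewrite measurable_tupleE => mA.
apply: (@g_sigma_algebra_measure_unique _ R (n.-tuple mR) (rects n)
  (@rects_measurable n) (fun k => rect (fun _ => `[- k%:R, k%:R]%classic)) _ _
  nlebesgue_perm (nlebesgue R n)).
- by move=> k; exists (fun=> `[- k%:R, k%:R]%classic).
- apply/seteqP; split=> // t _.
  pose b := \big[Num.max/0]_(i < n) `|tnth t i|.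
  exists (Num.truncn b).+1 => // i /=.
  have : `|tnth t i| <= (Num.truncn b).+1%:R.
    apply: (@le_trans _ _ b); last by rewrite ltW// truncnS_gt.
    exact: (le_bigmax _ (fun i => `|tnth t i|)).
  by rewrite ler_norml in_itv.
- exact: setI_closed_rects.
- move=> _ [B mB <-]; rewrite /= /nlebesgue_perm /pushforward.
  rewrite perm_tuple_rect [LHS]nlebesgue_rect// [RHS]nlebesgue_rect//.
  by rewrite [RHS](reindex_inj (@perm_inj _ (s^-1)%g)).
- move=> k; rewrite /= /nlebesgue_perm /pushforward.
  rewrite perm_tuple_rect nlebesgue_rect//.
  under eq_bigr do rewrite lebesgue_measure_itv/= lte_fin.
  suff h : (0 <= \prod_(i < n) (if (- (k%:R : R) < k%:R)%R then
      (k%:R : R)%:E + (- - k%:R)%:E else 0) < +oo)%E by case/andP: h.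
  apply: (big_ind (fun x : \bar R => (0 <= x < +oo)%E)).
  + by rewrite lee01 ltry.
  + move=> x y /andP[x0 xoo] /andP[y0 yoo].
    by rewrite mule_ge0//= lte_mul_pinfty// ge0_fin_numE.
  + move=> i _; case: ifP => _; last by rewrite lexx ltry.
    by rewrite -EFinD ltry andbT lee_fin opprK addr_ge0.
- exact: mA.
Qed.

End perm_invariance.

Lemma ge0_nlebesgue_perm n (s : 'S_n) (f : n.-tuple mR -> \bar R) :
  measurable_fun (@orthant R n) f -> (forall t, orthant t -> (0 <= f t)%E) ->
  (\int[nlebesgue R n]_(t in @orthant R n) f (perm_tuple s t) =
   \int[nlebesgue R n]_(t in @orthant R n) f t)%E.
Proof.
move=> mf f0; have mO := @measurable_orthant R n.
have -> : (\int[nlebesgue R n]_(t in @orthant R n) f t =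
    \int[pushforward (nlebesgue R n) (@perm_tuple R n s)]_(t in @orthant R n) f t)%E.
  apply: eq_measure_integral => [|mp A mA _]; first exact: measurable_perm_tuple.
  by rewrite -[LHS](nlebesgue_permE s mA).
rewrite (ge0_integral_pushforward (@measurable_perm_tuple n s))//.
  rewrite [in RHS](_ : _ @^-1` _ = @orthant R n)//.
  by apply/seteqP; split=> t /(perm_tuple_orthant s).
by move=> t; rewrite inE => /f0.
Qed.

Lemma measurable_fun_perm n (s : 'S_n) d (U : measurableType d) (f : n.-tuple mR -> U) :
  measurable_fun (@orthant R n) f ->
  measurable_fun (@orthant R n) (fun t => f (perm_tuple s t)).
Proof.
move=> mf; apply: (measurable_comp (F := @orthant R n) (f := f)) => //.
- exact: measurable_orthant.
- by move=> _ [t ot <-]; exact/perm_tuple_orthant.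
- apply: measurable_funS (measurable_perm_tuple s) => //.
Qed.

Lemma nlebesgue_perm_integral n (s : 'S_n) (f : n.-tuple mR -> \bar R) :
  measurable_fun (@orthant R n) f ->
  (\int[nlebesgue R n]_(t in @orthant R n) f (perm_tuple s t) =
   \int[nlebesgue R n]_(t in @orthant R n) f t)%E.
Proof.
move=> mf; rewrite [LHS]integralE [RHS]integralE; congr (_ - _)%E.
  have h := ge0_nlebesgue_perm s (measurable_funepos mf) (fun t _ => funepos_ge0 f t).
  by rewrite -h; congr (integral _ _ _); exact: (funepos_comp f).
have h := ge0_nlebesgue_perm s (measurable_funeneg mf) (fun t _ => funeneg_ge0 f t).
by rewrite -h; congr (integral _ _ _); exact: (funeneg_comp f).
Qed.

(** * Fubini's theorem for the splitting of the first coordinate *)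

Section fubini_cons.
Variable n : nat.
Local Notation leb := (@lebesgue_measure R).
Local Notation nleb := (nlebesgue R).

Lemma orthant_cons x (t : n.-tuple mR) :
  orthant (tuple_cons (x, t)) <-> half_line x /\ orthant t.
Proof.
split=> [h|[hx ht] i].
  split; first by have := h ord0.
  by move=> i; have := h (lift ord0 i); rewrite /tuple_cons tnthS.
case: (unliftP ord0 i) => [j ->|->//]; rewrite /tuple_cons tnthS; exact: ht.
Qed.

Lemma patch_cons (f : n.+1.-tuple mR -> \bar R) x (t : n.-tuple mR) :
  (f \_ (@orthant R n.+1)) (tuple_cons (x, t)) =
  if x \in @half_line R then ((fun t => f (tuple_cons (x, t))) \_ (@orthant R n)) t else 0%E.
Proof.
rewrite !patchE; have [/set_mem hx|/negP hx] := boolP (x \in _).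
  have [/set_mem ot|/negP ot] := boolP (t \in _).
    by rewrite mem_set//; apply/orthant_cons.
  by rewrite memNset// => /orthant_cons[_ /mem_set].
by rewrite memNset// => /orthant_cons[/mem_set].
Qed.

Lemma measurable_fun_cons d (U : measurableType d) (f : n.+1.-tuple mR -> U) x :
  half_line x -> measurable_fun (@orthant R n.+1) f ->
  measurable_fun (@orthant R n) (fun t => f (tuple_cons (x, t))).
Proof.
move=> hx mf; apply: (measurable_comp (F := @orthant R n.+1) (f := f)) => //.
- exact: measurable_orthant.
- by move=> _ [t ot <-]; apply/orthant_cons.
- apply: measurable_funTS.
  by apply: (measurableT_comp (@measurable_tuple_cons R n)); exact: measurable_pair1.
Qed.

Section ge0.
Variable f : n.+1.-tuple mR -> \bar R.
Hypothesis mf : measurable_fun (@orthant R n.+1) f.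
Hypothesis f0 : forall t, orthant t -> (0 <= f t)%E.

Let g (p : mR * n.-tuple mR) := (f \_ (@orthant R n.+1)) (tuple_cons p).

Let mg : measurable_fun setT g.
Proof.
apply: measurableT_comp (@measurable_tuple_cons R n).
apply/(measurable_restrictT _ _).1 => //; exact: measurable_orthant.
Qed.

Let g0 p : (0 <= g p)%E.
Proof. by apply: erestrict_ge0. Qed.

Let gE : fubini_F (nleb n) g =
  (fun x => \int[nleb n]_(t in @orthant R n) f (tuple_cons (x, t)))%E \_ (@half_line R).
Proof.
apply/funext => x; rewrite patchE /fubini_F.
under eq_integral do rewrite /g patch_cons.
by case: ifP => _; rewrite -?integral_mkcond// integral0.
Qed.

Lemma measurable_ge0_integral_cons : measurable_fun (@half_line R)
  (fun x => \int[nleb n]_(t in @orthant R n) f (tuple_cons (x, t)))%E.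
Proof.
have mH := @measurable_half_line R.
have := measurable_fun_fubini_tonelli_F g mg g0 (m2 := nleb n).
by rewrite [X in measurable_fun _ X -> _]gE => h; apply/(measurable_restrictT _ mH).
Qed.

Lemma ge0_integral_cons :
  (\int[nleb n.+1]_(t in @orthant R n.+1) f t =
   \int[leb]_(x in @half_line R) \int[nleb n]_(t in @orthant R n) f (tuple_cons (x, t)))%E.
Proof.
rewrite integral_mkcond.
transitivity (\int[pushforward (leb \x nleb n)%E (@tuple_cons R n)]_t
    (f \_ (@orthant R n.+1)) t)%E.
  apply: eq_measure_integral => [|mp A mA _]; [exact: measurable_tuple_cons|by []].
rewrite (ge0_integral_pushforward (@measurable_tuple_cons R n))//; last 2 first.
- apply/(measurable_restrictT _ _).1 => //; exact: measurable_orthant.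
- by move=> t _; exact: erestrict_ge0.
rewrite preimage_setT [LHS](fubini_tonelli1 g mg g0) gE.
by rewrite [RHS]integral_mkcond.
Qed.

End ge0.

Section integrable.
Variable f : n.+1.-tuple mR -> \bar R.
Hypothesis intf : (nleb n.+1).-integrable (@orthant R n.+1) f.

Let F x : \bar R := (\int[nleb n]_(t in @orthant R n) f (tuple_cons (x, t)))%E.
Let mf : measurable_fun (@orthant R n.+1) f.
Proof. exact: (measurable_int _ intf). Qed.

Let Fp x : \bar R := (\int[nleb n]_(t in @orthant R n) f^\+ (tuple_cons (x, t)))%E.
Let Fn x : \bar R := (\int[nleb n]_(t in @orthant R n) f^\- (tuple_cons (x, t)))%E.

Let FE : F = (Fp \- Fn)%E.
Proof. apply/funext => x; rewrite /F integralE /Fp /Fn.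
congr (_ - _)%E; congr (integral _ _ _); first exact: (funepos_comp f).
exact: (funeneg_comp f). Qed.

Let intFp : leb.-integrable (@half_line R) Fp.
Proof.
apply/integrableP; split.
  by apply: measurable_ge0_integral_cons => //; exact: measurable_funepos.
rewrite (eq_integral Fp) => [|x _]; last first.
  by rewrite gee0_abs//; apply: integral_ge0 => t _; exact: funepos_ge0.
rewrite -ge0_integral_cons//; last exact: measurable_funepos.
have mO := @measurable_orthant R n.+1.
have /integrableP[_] := integrable_funepos mO intf.
by under eq_integral => x _ do rewrite gee0_abs ?funepos_ge0//.
Qed.

Let intFn : leb.-integrable (@half_line R) Fn.
Proof.
apply/integrableP; split.
  by apply: measurable_ge0_integral_cons => //; exact: measurable_funeneg.
rewrite (eq_integral Fn) => [|x _]; last first.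
  by rewrite gee0_abs//; apply: integral_ge0 => t _; exact: funeneg_ge0.
rewrite -ge0_integral_cons//; last exact: measurable_funeneg.
have mO := @measurable_orthant R n.+1.
have /integrableP[_] := integrable_funeneg mO intf.
by under eq_integral => x _ do rewrite gee0_abs ?funeneg_ge0//.
Qed.

Lemma integrable_integral_cons : leb.-integrable (@half_line R)
  (fun x => \int[nleb n]_(t in @orthant R n) f (tuple_cons (x, t)))%E.
Proof. by rewrite -/F FE; apply: integrableB => //; exact: measurable_half_line. Qed.

Lemma integral_cons :
  (\int[nleb n.+1]_(t in @orthant R n.+1) f t =
   \int[leb]_(x in @half_line R) \int[nleb n]_(t in @orthant R n) f (tuple_cons (x, t)))%E.
Proof.
rewrite -/F FE integralB//; last exact: measurable_half_line.
rewrite [LHS]integralE; congr (_ - _)%E.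
  exact: (ge0_integral_cons (measurable_funepos mf)).
exact: (ge0_integral_cons (measurable_funeneg mf)).
Qed.

End integrable.

Lemma Rintegral_cons (f : n.+1.-tuple mR -> R) :
  (nleb n.+1).-integrable (@orthant R n.+1) (EFin \o f) ->
  (\int[nleb n.+1]_(t in @orthant R n.+1) f t =
   \int[leb]_(x in @half_line R) \int[nleb n]_(t in @orthant R n) f (tuple_cons (x, t)))%R.
Proof.
move=> intf; rewrite /Rintegral integral_cons//; congr fine.
have mH := @measurable_half_line R.
have intF := integrable_integral_cons intf.
have mF := measurable_int _ intF.
(* The inner extended integral is finite almost everywhere; off this set [fine] would change its
   value. *)
apply: ae_eq_integral => //.
  apply/measurable_EFinP.
  by apply: (measurableT_comp (@fine_measurable R setT measurableT) mF).
apply: filterS (integrable_ae mH intF) => x /= h hx.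
by rewrite fineK// h.
Qed.

End fubini_cons.

End rectangles.
Arguments rects R n : clear implicits.

(** * Anti-symmetric functions *)

Section complex_integral.
Context d (T : measurableType d) (R : realType) (mu : {measure set T -> \bar R}).
Variables (D : set T) (mD : measurable D).
Implicit Types f g : T -> R[i].

Definition cintegrable f :=
  mu.-integrable D (EFin \o (fun x => complex.Re (f x))) /\
  mu.-integrable D (EFin \o (fun x => complex.Im (f x))).

Definition cmeasurable f :=
  measurable_fun D (fun x => complex.Re (f x)) /\
  measurable_fun D (fun x => complex.Im (f x)).

Lemma cintegrable_measurable f : cintegrable f -> cmeasurable f.
Proof.
by move=> [/measurable_int/measurable_EFinP ? /measurable_int/measurable_EFinP ?].
Qed.

Lemma L2_measurable f : square_integrable mu D f -> cmeasurable f.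
Proof. by case. Qed.

Lemma cintegrable_dot f g : square_integrable mu D f -> square_integrable mu D g ->
  cintegrable (fun x => (f x)^*%C * g x).
Proof. by split; [exact: integrable_Re_conj|exact: integrable_Im_conj]. Qed.

Lemma eq_cintegral f g : (forall x, D x -> f x = g x) ->
  cintegral mu D f = cintegral mu D g.
Proof.
by move=> h; congr (_ +i* _); apply: eq_Rintegral => x; rewrite inE => /h ->.
Qed.

Lemma ReD (a b : R[i]) : complex.Re (a + b) = complex.Re a + complex.Re b.
Proof. by case: a b => [? ?] []. Qed.

Lemma ImD (a b : R[i]) : complex.Im (a + b) = complex.Im a + complex.Im b.
Proof. by case: a b => [? ?] []. Qed.

Lemma ReM (a b : R[i]) : complex.Re (a * b) =
  complex.Re a * complex.Re b - complex.Im a * complex.Im b.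
Proof. by case: a b => [? ?] []. Qed.

Lemma ImM (a b : R[i]) : complex.Im (a * b) =
  complex.Re a * complex.Im b + complex.Im a * complex.Re b.
Proof. by case: a b => [? ?] []. Qed.

Lemma cintegrableD f g : cintegrable f -> cintegrable g ->
  cintegrable (fun x => f x + g x).
Proof.
move=> [fr fi] [gr gi]; split.
  rewrite (_ : _ \o _ = (EFin \o (fun x => complex.Re (f x))) \+
    (EFin \o (fun x => complex.Re (g x))))%E; first exact: integrableD.
  by apply/funext => x /=; rewrite ReD.
rewrite (_ : _ \o _ = (EFin \o (fun x => complex.Im (f x))) \+
  (EFin \o (fun x => complex.Im (g x))))%E; first exact: integrableD.
by apply/funext => x /=; rewrite ImD.
Qed.

Lemma cintegralD f g : cintegrable f -> cintegrable g ->
  cintegral mu D (fun x => f x + g x) = cintegral mu D f + cintegral mu D g.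
Proof.
move=> [fr fi] [gr gi]; rewrite [RHS]/(_ + _)/=; congr (_ +i* _).
  by rewrite -RintegralD//; apply: eq_Rintegral => x _; rewrite ReD.
by rewrite -RintegralD//; apply: eq_Rintegral => x _; rewrite ImD.
Qed.

Let integrableZ (r : R) (h : T -> R) : mu.-integrable D (EFin \o h) ->
  mu.-integrable D (EFin \o (fun x => r * h x)).
Proof.
by move=> ih; rewrite (_ : _ \o _ = fun x => r%:E * (h x)%:E)%E//; exact: integrableZl.
Qed.

Lemma cintegrableZ a f : cintegrable f -> cintegrable (fun x => a * f x).
Proof.
move=> [fr fi]; split.
  rewrite (_ : _ \o _ = ((EFin \o (fun x => complex.Re a * complex.Re (f x))%R) \-
    (EFin \o (fun x => complex.Im a * complex.Im (f x))%R))%E).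
    by apply: integrableB => //; exact: integrableZ.
  by apply/funext => x /=; rewrite ReM.
rewrite (_ : _ \o _ = ((EFin \o (fun x => complex.Re a * complex.Im (f x))%R) \+
  (EFin \o (fun x => complex.Im a * complex.Re (f x))%R))%E).
  by apply: integrableD => //; exact: integrableZ.
by apply/funext => x /=; rewrite ImM.
Qed.

Lemma cintegralZ a f : cintegrable f ->
  cintegral mu D (fun x => a * f x) = a * cintegral mu D f.
Proof.
move=> [fr fi]; case: a => a b; rewrite [RHS]/(_ * _)/=; congr (_ +i* _).
  rewrite -RintegralZl// -[X in _ - X]RintegralZl// -RintegralB//; [|exact: integrableZ..].
  by apply: eq_Rintegral => x _; rewrite ReM.
rewrite -RintegralZl// -[X in _ + X]RintegralZl// -RintegralD//; [|exact: integrableZ..].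
by apply: eq_Rintegral => x _; rewrite ImM.
Qed.

Lemma cintegrable0 : cintegrable (fun=> 0).
Proof. by split; exact: integrable0. Qed.

Lemma cintegral0 : cintegral mu D (fun=> 0) = 0.
Proof. by congr (_ +i* _); rewrite /Rintegral integral0_eq. Qed.

Lemma cintegrable_sum I (r : seq I) (f : I -> T -> R[i]) :
  (forall i, cintegrable (f i)) -> cintegrable (fun x => \sum_(i <- r) f i x).
Proof.
move=> h; elim: r => [|i r IHr].
  by under eq_fun do rewrite big_nil; exact: cintegrable0.
by under eq_fun do rewrite big_cons; exact: cintegrableD.
Qed.

Lemma cintegral_sum I (r : seq I) (f : I -> T -> R[i]) :
  (forall i, cintegrable (f i)) ->
  cintegral mu D (fun x => \sum_(i <- r) f i x) = \sum_(i <- r) cintegral mu D (f i).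
Proof.
move=> h; elim: r => [|i r IHr].
  by under eq_fun do rewrite big_nil; rewrite big_nil cintegral0.
under eq_fun do rewrite big_cons; rewrite cintegralD ?IHr ?big_cons//.
exact: cintegrable_sum.
Qed.

Lemma cmeasurableM f g : cmeasurable f -> cmeasurable g ->
  cmeasurable (fun x => f x * g x).
Proof.
move=> [fr fi] [gr gi]; split.
  under eq_fun do rewrite ReM.
  by apply: measurable_funB; apply: measurable_funM.
under eq_fun do rewrite ImM.
by apply: measurable_funD; apply: measurable_funM.
Qed.

Lemma cmeasurableD f g : cmeasurable f -> cmeasurable g ->
  cmeasurable (fun x => f x + g x).
Proof.
move=> [fr fi] [gr gi]; split.
  by under eq_fun do rewrite ReD; exact: measurable_funD.
by under eq_fun do rewrite ImD; exact: measurable_funD.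
Qed.

Lemma cmeasurable_cst a : cmeasurable (fun=> a).
Proof. by split; exact: measurable_cst. Qed.

Lemma cmeasurableZ a f : cmeasurable f -> cmeasurable (fun x => a * f x).
Proof. by apply: cmeasurableM; exact: cmeasurable_cst. Qed.

Lemma cmeasurable_conj f : cmeasurable f -> cmeasurable (fun x => (f x)^*%C).
Proof.
move=> [fr fi]; split; first by apply: eq_measurable_fun fr => x _; case: (f x).
by apply: (eq_measurable_fun (fun x => - complex.Im (f x)));
  [move=> x _; case: (f x)|exact: measurable_funN].
Qed.

Lemma cmeasurable_sum I (r : seq I) (f : I -> T -> R[i]) :
  (forall i, cmeasurable (f i)) -> cmeasurable (fun x => \sum_(i <- r) f i x).
Proof.
move=> h; elim: r => [|i r IHr].
  by under eq_fun do rewrite big_nil; exact: cmeasurable_cst.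
by under eq_fun do rewrite big_cons; exact: cmeasurableD.
Qed.

Lemma normc2 (a : R[i]) : normc a ^+ 2 = complex.Re a ^+ 2 + complex.Im a ^+ 2.
Proof. by case: a => a b; rewrite /normc sqr_sqrtr// addr_ge0 ?sqr_ge0. Qed.

Lemma measurable_normc2 f : cmeasurable f -> measurable_fun D (fun x => normc (f x) ^+ 2).
Proof.
move=> [mr mi]; under eq_fun do rewrite normc2.
by apply: measurable_funD; apply: measurable_funX.
Qed.

Lemma cintegral_ae f g : cmeasurable f -> cmeasurable g ->
  {ae mu, forall x, D x -> f x = g x} -> cintegral mu D f = cintegral mu D g.
Proof.
move=> [fr fi] [gr gi] h; congr (_ +i* _); congr fine; apply: ae_eq_integral => //.
- exact/measurable_EFinP.
- exact/measurable_EFinP.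
- by apply: filterS h => x /= h Dx; rewrite h.
- exact/measurable_EFinP.
- exact/measurable_EFinP.
- by apply: filterS h => x /= h Dx; rewrite h.
Qed.

Lemma L2_sum I (r : seq I) (f : I -> T -> R[i]) :
  (forall i, square_integrable mu D (f i)) ->
  square_integrable mu D (fun x => \sum_(i <- r) f i x).
Proof.
move=> h; elim: r => [|i r IHr].
  by under eq_fun do rewrite big_nil; exact: square_integrable0.
by under eq_fun do rewrite big_cons; exact: square_integrableD.
Qed.

Lemma L2_conj f : square_integrable mu D f -> square_integrable mu D (fun x => (f x)^*%C).
Proof.
move=> [fr fi foo]; have [mr mi] := cmeasurable_conj (conj fr fi).
split=> //; apply: le_lt_trans foo; rewrite le_eqVlt; apply/orP; left.
by apply/eqP/eq_integral => x _; congr EFin; rewrite !normc2; case: (f x) => a b /=; rewrite sqrrN.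
Qed.

Lemma L2_dotC f g : square_integrable mu D f -> square_integrable mu D g ->
  cintegral mu D (fun x => (f x)^*%C * g x) = (cintegral mu D (fun x => (g x)^*%C * f x))^*%C.
Proof. exact: cintegral_dotC. Qed.

End complex_integral.

(** * Determinant of a bordered matrix *)

Section complement.
Variable R : comNzRingType.

(** Expansion along the first row, then of every cofactor but the first along the first column. On
    Gram matrices it becomes the anticommutation relation, see [det_gram_fcons]. *)
Lemma expand_det_bordered n (M : 'M[R]_n.+2) :
  \det M = M ord0 ord0 * \det (row' ord0 (col' ord0 M)) -
    \sum_(i < n.+1) \sum_(j < n.+1) (-1) ^+ (i + j) *
      (M (lift ord0 i) ord0 * M ord0 (lift ord0 j)) *
      \det (row' i (col' j (row' ord0 (col' ord0 M)))).
Proof.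
rewrite (expand_det_row M ord0) big_ord_recl /cofactor addn0 expr0 mul1r.
congr (_ + _); rewrite exchange_big/= -sumrN; apply: eq_bigr => j _.
rewrite (expand_det_col _ ord0) mulrA mulr_sumr -sumrN; apply: eq_bigr => i _.
rewrite /cofactor !mxE addn0 add0n.
have -> : lift (lift ord0 j) ord0 = ord0 :> 'I_n.+2 by apply/val_inj.
have -> : row' i (col' ord0 (row' ord0 (col' (lift ord0 j) M))) =
    row' i (col' j (row' ord0 (col' ord0 M))).
  apply/matrixP => k l; rewrite !mxE; congr (M _ _); apply/val_inj => /=.
  by rewrite /bump/= !add1n ltnS; case: leqP; rewrite ?addSn ?addnS.
rewrite /= /bump/= add1n exprS exprD.
move: (M _ _) (M _ _) (\det _) => a b e.
by rewrite mulN1r; ring.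
Qed.

End complement.

Section antisymmetric_functions.
Variable R : realType.
Local Notation mR := (measurableTypeR R).
Local Notation leb := (@lebesgue_measure R).
Local Notation nleb := (nlebesgue R).
Local Notation cint n := (cintegral (nlebesgue R n) (@orthant R n)).

Lemma cmeasurable_perm n (s : 'S_n) (f : n.-tuple mR -> R[i]) :
  cmeasurable (@orthant R n) f -> cmeasurable (@orthant R n) (fun t => f (perm_tuple s t)).
Proof.
move=> [fr fi]; split.
  exact: (measurable_fun_perm s (f := fun t => complex.Re (f t))).
exact: (measurable_fun_perm s (f := fun t => complex.Im (f t))).
Qed.

Lemma cintegral_perm n (s : 'S_n) (f : n.-tuple mR -> R[i]) :
  cmeasurable (@orthant R n) f -> cint n (fun t => f (perm_tuple s t)) = cint n f.
Proof.
move=> [fr fi]; congr (_ +i* _); congr fine.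
  by apply: (nlebesgue_perm_integral s (f := fun t => (complex.Re (f t))%:E)); exact/measurable_EFinP.
by apply: (nlebesgue_perm_integral s (f := fun t => (complex.Im (f t))%:E)); exact/measurable_EFinP.
Qed.

Lemma L2n_perm n (s : 'S_n) (f : n.-tuple mR -> R[i]) :
  L2n f -> L2n (fun t => f (perm_tuple s t)).
Proof.
move=> [fr fi foo]; have [mr mi] := cmeasurable_perm s (conj fr fi).
split=> //; apply: le_lt_trans foo.
rewrite -(nlebesgue_perm_integral s (f := fun t => (normc (f t) ^+ 2)%:E))//.
by apply/measurable_EFinP; exact: measurable_normc2.
Qed.

Lemma L2nZ n a (f : n.-tuple mR -> R[i]) : L2n f -> L2n (fun t => a * f t).
Proof. by apply: square_integrableZ; exact: measurable_orthant. Qed.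

Lemma L2nD n (f g : n.-tuple mR -> R[i]) : L2n f -> L2n g -> L2n (fun t => f t + g t).
Proof. by apply: square_integrableD; exact: measurable_orthant. Qed.

Lemma L2n_antisymmetrization n (h : n.-tuple mR -> R[i]) :
  L2n h -> L2n (antisymmetrization h).
Proof.
move=> hh; apply: L2nZ; apply: L2_sum; first exact: measurable_orthant.
by move=> s; apply: L2nZ; exact: L2n_perm.
Qed.

Lemma perm_tupleM n (r s : 'S_n) (t : n.-tuple mR) :
  perm_tuple r (perm_tuple s t) = perm_tuple (r * s)%g t.
Proof. by apply: eq_from_tnth => i; rewrite !tnth_mktuple permM. Qed.

Lemma antisymmetrization_perm n (h : n.-tuple mR -> R[i]) (s : 'S_n) t :
  antisymmetrization h (perm_tuple s t) = (-1) ^+ s * antisymmetrization h t.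
Proof.
rewrite /antisymmetrization mulrCA; congr (_ * _); rewrite mulr_sumr.
rewrite [RHS](reindex_inj (mulIg s))/=; apply: eq_bigr => r _.
rewrite perm_tupleM odd_permM; case: (odd_perm r); case: (odd_perm s) => /=;
  by rewrite ?expr1 ?expr0 ?mul1r ?mulN1r ?opprK.
Qed.

Lemma Lambda_antisymmetrization n (h : n.-tuple mR -> R[i]) :
  L2n h -> Lambda (antisymmetrization h).
Proof.
move=> hh; split; first exact: L2n_antisymmetrization.
by move=> s; apply: aeW => t _; exact: antisymmetrization_perm.
Qed.

Lemma fact_neq0 n : n`!%:R != 0 :> R[i].
Proof. by rewrite pnatr_eq0 -lt0n fact_gt0. Qed.

(** Each permutation has its own exceptional null set. There are finitely many of them, and off
    their union the n! terms of the sum coincide. *)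
Lemma antisymmetrization_id n (f : n.-tuple mR -> R[i]) : Lambda f ->
  {ae nleb n, forall t, orthant t -> antisymmetrization f t = f t}.
Proof.
move=> [_ af].
have : {ae nleb n, forall t, forall s : 'S_n, orthant t -> f (perm_tuple s t) = (-1) ^+ s * f t}.
  by apply: filter_forall => s; exact: af.
apply: filterS => t h ot; rewrite /antisymmetrization.
under eq_bigr do rewrite h// mulrA -signr_addb addbb mul1r.
by rewrite sumr_const card_Sn -[X in _ * X]mulr_natl mulKf// fact_neq0.
Qed.

(** Anti-symmetrization is the orthogonal projection onto the anti-symmetric functions. After a
    permutation of the variables the sign produced by [F] cancels the sign of the term, so the n!
    terms are equal. *)
Lemma Lambda_dot_antisymmetrization n (F h : n.-tuple mR -> R[i]) :
  Lambda F -> L2n h ->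
  Lambda_dot F (antisymmetrization h) = n`!%:R * cint n (fun t => (F t)^*%C * h t).
Proof.
move=> [sF aF] sh; rewrite /Lambda_dot; congr (_ * _).
have mO := @measurable_orthant R n.
have term (s : 'S_n) : cintegrable (nleb n) (@orthant R n)
    (fun t => (F t)^*%C * ((-1) ^+ s * h (perm_tuple s t))).
  by apply: cintegrable_dot => //; apply: L2nZ; exact: L2n_perm.
transitivity (n`!%:R^-1 * \sum_(s : 'S_n) cint n
    (fun t => (F t)^*%C * ((-1) ^+ s * h (perm_tuple s t)))).
  rewrite -cintegral_sum// -cintegralZ//; last exact: cintegrable_sum.
  by apply: eq_cintegral => t _; rewrite /antisymmetrization mulrCA mulr_sumr.
rewrite (eq_bigr (fun=> cint n (fun t => (F t)^*%C * h t))) => [|s _].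
  by rewrite sumr_const card_Sn -[X in _ * X]mulr_natl mulKf// fact_neq0.
have mF : cmeasurable (@orthant R n) (fun t => (F t)^*%C * h t).
  by apply: cintegrable_measurable (cintegrable_dot mO sF sh).
rewrite -[RHS](cintegral_perm s)//; apply: cintegral_ae => //.
- exact: (cintegrable_measurable (term s)).
- exact: (cmeasurable_perm s mF).
apply: filterS (aF s) => t hF ot; rewrite hF// rmorphM rmorph_sign/=.
by rewrite mulrCA mulrA.
Qed.

Definition halfdot (z w : mR -> R[i]) : R[i] :=
  cintegral leb (@half_line R) (fun x => (z x)^*%C * w x).

Lemma cintegral_cons n (f : n.+1.-tuple mR -> R[i]) :
  cintegrable (nleb n.+1) (@orthant R n.+1) f ->
  cint n.+1 f = cintegral leb (@half_line R) (fun x => cint n (fun t => f (tuple_cons (x, t)))).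
Proof.
by move=> [fr fi]; congr (_ +i* _); rewrite Rintegral_cons.
Qed.

Lemma tensor_cons n z (w : n.-tuple mR -> R[i]) x t :
  tensor z w (tuple_cons (x, t)) = z x * w t.
Proof. by rewrite /tensor; congr (_ * w _); apply/val_inj. Qed.

Lemma measurable_fun_thead n d (U : measurableType d) (f : mR -> U) :
  measurable_fun (@half_line R) f ->
  measurable_fun (@orthant R n.+1) (fun t => f (thead t)).
Proof.
move=> mf; apply: (measurable_comp (F := @half_line R) (f := f)) => //.
- exact: measurable_half_line.
- by move=> _ [t ot <-]; exact: ot.
- exact: measurable_funTS (measurable_tnth _).
Qed.

Lemma measurable_fun_behead n d (U : measurableType d) (f : n.-tuple mR -> U) :
  measurable_fun (@orthant R n) f ->
  measurable_fun (@orthant R n.+1) (fun t => f [tuple of behead t]).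
Proof.
move=> mf; apply: (measurable_comp (F := @orthant R n) (f := f)) => //.
- exact: measurable_orthant.
- by move=> _ [t ot <-] i; rewrite tnth_behead; exact: ot.
- by apply: measurable_funTS; exact: measurable_behead.
Qed.

Lemma cmeasurable_tensor n z (w : n.-tuple mR -> R[i]) :
  cmeasurable (@half_line R) z -> cmeasurable (@orthant R n) w ->
  cmeasurable (@orthant R n.+1) (tensor z w).
Proof.
move=> [zr zi] [wr wi]; apply: cmeasurableM; split.
- exact: (measurable_fun_thead (f := fun x => complex.Re (z x))).
- exact: (measurable_fun_thead (f := fun x => complex.Im (z x))).
- exact: (measurable_fun_behead (f := fun x => complex.Re (w x))).
- exact: (measurable_fun_behead (f := fun x => complex.Im (w x))).
Qed.

Lemma L2n_tensor n z (w : n.-tuple mR -> R[i]) :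
  L2half z -> L2n w -> L2n (tensor z w).
Proof.
move=> [zr zi zoo] [wr wi woo].
have mt := cmeasurable_tensor (conj zr zi) (conj wr wi); have [tr ti] := mt.
split=> //.
rewrite ge0_integral_cons; last 2 first.
- by apply/measurable_EFinP; exact: measurable_normc2.
- by move=> t _; rewrite lee_fin sqr_ge0.
have mH := @measurable_half_line R; have mO := @measurable_orthant R n.
under eq_integral => x _.
  under eq_integral => t _ do rewrite tensor_cons normcM exprMn EFinM.
  rewrite ge0_integralZl//=; last 3 first.
  - by apply/measurable_EFinP; exact: measurable_normc2.
  - by move=> t _; rewrite lee_fin sqr_ge0.
  - by rewrite lee_fin sqr_ge0.
  over.
rewrite ge0_integralZr//=.
- by rewrite lte_mul_pinfty//; [apply: integral_ge0 => x _; rewrite lee_fin sqr_ge0|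
    rewrite ge0_fin_numE//; apply: integral_ge0 => x _; rewrite lee_fin sqr_ge0].
- by apply/measurable_EFinP; exact: measurable_normc2.
- by move=> t _; rewrite lee_fin sqr_ge0.
- by apply: integral_ge0 => x _; rewrite lee_fin sqr_ge0.
Qed.

Lemma cintegral_tensor n z z' (w w' : n.-tuple mR -> R[i]) :
  L2half z -> L2half z' -> L2n w -> L2n w' ->
  cint n.+1 (fun t => (tensor z w t)^*%C * tensor z' w' t) =
  halfdot z z' * cint n (fun t => (w t)^*%C * w' t).
Proof.
move=> sz sz' sw sw'; have mH := @measurable_half_line R; have mO := @measurable_orthant R.
rewrite cintegral_cons; last by apply: cintegrable_dot; [exact: mO|exact: L2n_tensor..].
rewrite mulrC -cintegralZ//; last exact: cintegrable_dot.
apply: eq_cintegral => x _; rewrite mulrC -cintegralZ; [|exact: mO|exact: (cintegrable_dot (mO n))].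
by apply: eq_cintegral => t _; rewrite !tensor_cons rmorphM/= mulrACA.
Qed.

Definition prodfun n (Z : 'I_n -> mR -> R[i]) : n.-tuple mR -> R[i] :=
  fun t => \prod_(i < n) Z i (tnth t i).

Lemma prodfunS n (Z : 'I_n.+1 -> mR -> R[i]) :
  prodfun Z = tensor (Z ord0) (prodfun (fun i => Z (lift ord0 i))).
Proof.
apply/funext => t; rewrite /prodfun /tensor big_ord_recl; congr (_ * _).
apply: eq_bigr => i _; congr (Z _ _); rewrite tnth_behead; congr tnth.
by apply/val_inj; rewrite /= inordK// ltnS ltn_ord.
Qed.

Lemma L2n_prodfun n (Z : 'I_n -> mR -> R[i]) : (forall i, L2half (Z i)) -> L2n (prodfun Z).
Proof.
elim: n Z => [|n IHn] Z hZ; last by rewrite prodfunS; apply: L2n_tensor => //; exact: IHn.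
rewrite (_ : prodfun Z = fun=> 1); last by apply/funext => t; rewrite /prodfun big_ord0.
split; [exact: measurable_cst|exact: measurable_cst|].
have mO := @measurable_orthant R 0.
rewrite /= integral_cst//= diracE.
by rewrite mem_set ?mule1 ?ltry//; case.
Qed.

Lemma cintegral_prodfun n (Z W : 'I_n -> mR -> R[i]) :
  (forall i, L2half (Z i)) -> (forall i, L2half (W i)) ->
  cint n (fun t => (prodfun Z t)^*%C * prodfun W t) = \prod_(i < n) halfdot (Z i) (W i).
Proof.
elim: n Z W => [|n IHn] Z W hZ hW.
  rewrite big_ord0 (@eq_cintegral _ _ _ _ _ _ (fun=> 1)); last first.
    by move=> t _; rewrite /prodfun !big_ord0 conjc1 mulr1.
  have mO := @measurable_orthant R 0.
  have mu1 : nleb 0 (@orthant R 0) = 1%E by rewrite /= diracE mem_set//; case.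
  transitivity (1 +i* 0 : R[i]) => //; congr (_ +i* _).
    rewrite /Rintegral (eq_integral (cst 1%E))// integral_cst// mul1e.
    exact: (congr1 fine mu1).
  by rewrite /Rintegral (eq_integral (cst 0%E))// integral_cst// mul0e.
rewrite !prodfunS cintegral_tensor//; [|exact: L2n_prodfun..].
by rewrite IHn// big_ord_recl.
Qed.

Definition wedge n (Z : 'I_n -> mR -> R[i]) : n.-tuple mR -> R[i] :=
  antisymmetrization (prodfun Z).

Lemma Lambda_wedge n (Z : 'I_n -> mR -> R[i]) : (forall i, L2half (Z i)) -> Lambda (wedge Z).
Proof. by move=> hZ; apply: Lambda_antisymmetrization; exact: L2n_prodfun. Qed.

Lemma prodfun_perm n (Z : 'I_n -> mR -> R[i]) (s : 'S_n) t :
  prodfun Z (perm_tuple s t) = prodfun (fun i => Z ((s^-1)%g i)) t.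
Proof.
rewrite /prodfun [RHS](reindex_inj (@perm_inj _ s)); apply: eq_bigr => i _.
by rewrite tnth_mktuple permK.
Qed.

Definition gram n (Z W : 'I_n -> mR -> R[i]) : 'M[R[i]]_n :=
  \matrix_(i, j) halfdot (Z i) (W j).

(** The right wedge may be replaced by a plain product, its projection being absorbed by the left
    one. The n! of the inner product cancels the 1/n! of the left wedge, and the Leibniz formula
    remains. *)
Lemma Lambda_dot_wedge n (Z W : 'I_n -> mR -> R[i]) :
  (forall i, L2half (Z i)) -> (forall i, L2half (W i)) ->
  Lambda_dot (wedge Z) (wedge W) = \det (gram Z W).
Proof.
move=> hZ hW; have mO := @measurable_orthant R n.
rewrite Lambda_dot_antisymmetrization; [|exact: Lambda_wedge|exact: L2n_prodfun].
have term (s : 'S_n) : cintegrable (nleb n) (@orthant R n)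
    (fun t => (prodfun (fun i => Z ((s^-1)%g i)) t)^*%C * prodfun W t).
  by apply: cintegrable_dot => //; exact: L2n_prodfun.
transitivity (\sum_(s : 'S_n) (-1) ^+ s * cint n
    (fun t => (prodfun (fun i => Z ((s^-1)%g i)) t)^*%C * prodfun W t)).
  under eq_bigr do rewrite -cintegralZ//.
  rewrite -cintegral_sum//; last by move=> s; exact: cintegrableZ.
  rewrite -cintegralZ//; last first.
    by apply: cintegrable_dot => //; [apply: L2n_antisymmetrization|]; exact: L2n_prodfun.
  apply: eq_cintegral => t _.
  rewrite /wedge /antisymmetrization rmorphM/= fmorphV rmorph_nat !mulrA.
  rewrite mulfV ?fact_neq0// mul1r rmorph_sum/= mulr_suml; apply: eq_bigr => s _.
  by rewrite prodfun_perm rmorphM rmorph_sign mulrA.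
apply: eq_bigr => s _; congr (_ * _); rewrite cintegral_prodfun//.
rewrite (reindex_inj (@perm_inj _ s)); apply: eq_bigr => i _.
by rewrite permK mxE.
Qed.

Definition fcons n (z : mR -> R[i]) (Z : 'I_n -> mR -> R[i]) : 'I_n.+1 -> mR -> R[i] :=
  fun i => if unlift ord0 i is Some j then Z j else z.

Lemma fcons0 n z (Z : 'I_n -> mR -> R[i]) : fcons z Z ord0 = z.
Proof. by rewrite /fcons unlift_none. Qed.

Lemma fconsS n z (Z : 'I_n -> mR -> R[i]) i : fcons z Z (lift ord0 i) = Z i.
Proof. by rewrite /fcons liftK. Qed.

Lemma fcons_L2 n z (Z : 'I_n -> mR -> R[i]) : L2half z -> (forall i, L2half (Z i)) ->
  forall i, L2half (fcons z Z i).
Proof. by move=> hz hZ i; rewrite /fcons; case: unliftP. Qed.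

(** A permutation [r] of the last n variables extends, with the same sign, to one of all n + 1
    variables that fixes the first. For fixed [r] the sum over the larger group is invariant under
    translation by this extension, so the average over [r] has no effect. *)
Lemma antisymmetrization_tensor n z (h : n.-tuple mR -> R[i]) :
  antisymmetrization (tensor z (antisymmetrization h)) = antisymmetrization (tensor z h).
Proof.
apply/funext => t; rewrite {1 3}/antisymmetrization; congr (_ * _).
pose G (r : 'S_n) (s : 'S_n.+1) := (-1) ^+ (lift_perm ord0 ord0 r * s)%g *
  tensor z h (perm_tuple (lift_perm ord0 ord0 r * s)%g t).
transitivity (n`!%:R^-1 * \sum_(s : 'S_n.+1) \sum_(r : 'S_n) G r s).
  rewrite mulr_sumr; apply: eq_bigr => s _.
  rewrite /tensor /antisymmetrization !mulrA [_ * n`!%:R^-1]mulrC -!mulrA; congr (_ * _).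
  rewrite !mulr_sumr; apply: eq_bigr => r _.
  rewrite /G /tensor odd_permM odd_lift_perm addbb addFb signr_addb /thead !tnth_mktuple permM lift_perm_id.
  have -> : perm_tuple r [tuple of behead (perm_tuple s t)] =
      [tuple of behead (perm_tuple (lift_perm ord0 ord0 r * s)%g t)].
    apply: eq_from_tnth => i; rewrite tnth_mktuple !tnth_behead !tnth_mktuple permM.
    have E (k : 'I_n) : inord k.+1 = lift ord0 k.
      by apply/val_inj; rewrite /= inordK// ltnS ltn_ord.
    by rewrite !E lift_perm_lift.
  have gen (a b c e : R[i]) : a * (c * (b * e)) = b * a * (c * e) by ring.
  exact: gen.
rewrite exchange_big/= (eq_bigr (fun=> \sum_(s : 'S_n.+1) (-1) ^+ s *
    tensor z h (perm_tuple s t))) => [|r _]; last first.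
  by rewrite [RHS](reindex_inj (mulgI (lift_perm ord0 ord0 r))).
by rewrite sumr_const card_Sn -[X in _ * X]mulr_natl mulKf// fact_neq0.
Qed.

Lemma antisymmetrization_tensor_wedge n z (Z : 'I_n -> mR -> R[i]) :
  antisymmetrization (tensor z (wedge Z)) = wedge (fcons z Z).
Proof.
rewrite antisymmetrization_tensor /wedge; congr antisymmetrization.
rewrite prodfunS fcons0; congr tensor; congr prodfun.
by apply/funext => i; rewrite fconsS.
Qed.

(** A wedge is a Slater determinant, which makes determinant expansions available for the signs. *)
Lemma wedge_det n (Z : 'I_n -> mR -> R[i]) t :
  wedge Z t = n`!%:R^-1 * \det (\matrix_(i, j) Z i (tnth t j)).
Proof.
rewrite /wedge /antisymmetrization; congr (_ * _); apply: eq_bigr => s _.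
by congr (_ * _); apply: eq_bigr => i _; rewrite mxE tnth_mktuple.
Qed.

(** Expansion of the Slater determinant along its first column, the one that contains [x]. The left
    side is the kernel of the derivative of the wedge at time [x]. *)
Lemma wedge_cons n (Z : 'I_n.+1 -> mR -> R[i]) x t :
  n.+1%:R * wedge Z (tuple_cons (x, t)) =
  \sum_(i < n.+1) (-1) ^+ i * Z i x * wedge (fun j => Z (lift i j)) t.
Proof.
rewrite wedge_det factS natrM invfM mulrA mulrA mulfV ?pnatr_eq0// mul1r.
rewrite (expand_det_col _ ord0) mulr_sumr; apply: eq_bigr => i _.
rewrite /cofactor addn0 wedge_det.
rewrite (_ : row' i _ = \matrix_(k, l) Z (lift i k) (tnth t l)); last first.
  by apply/matrixP => k l; rewrite !mxE /tuple_cons tnthS.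
by rewrite mxE; ring.
Qed.

(** Read on wedges, this is b(g) b^*(z) = <g, z> - b^*(z) b(g): the double sum is the inner product
    of b(z) applied to the wedge of [W] with b(g) applied to the wedge of [Z]. *)
Lemma det_gram_fcons n g z (W Z : 'I_n.+1 -> mR -> R[i]) :
  \det (gram (fcons g W) (fcons z Z)) = halfdot g z * \det (gram W Z) -
  \sum_(i < n.+1) \sum_(j < n.+1) (-1) ^+ (i + j) *
    (halfdot (W i) z * halfdot g (Z j)) *
    \det (gram (fun k => W (lift i k)) (fun k => Z (lift j k))).
Proof.
have E : row' ord0 (col' ord0 (gram (fcons g W) (fcons z Z))) = gram W Z.
  by apply/matrixP => i j; rewrite !mxE !fconsS.
rewrite expand_det_bordered E mxE !fcons0; congr (_ - _).
apply: eq_bigr => i _; apply: eq_bigr => j _; rewrite !mxE !fcons0 !fconsS.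
by congr (_ * \det _); apply/matrixP => k l; rewrite !mxE.
Qed.

Lemma det_gram_fcons0 g z (W Z : 'I_0 -> mR -> R[i]) :
  \det (gram (fcons g W) (fcons z Z)) = halfdot g z.
Proof. by rewrite det_mx11 mxE !fcons0. Qed.

(** Row expansion that supplies the coefficients of the adjoint of creation in
    [annihilation_wedge]. *)
Lemma det_gram_fcons_row n g (W : 'I_n -> mR -> R[i]) (Z : 'I_n.+1 -> mR -> R[i]) :
  \det (gram (fcons g W) Z) =
  \sum_(j < n.+1) (-1) ^+ j * halfdot g (Z j) * \det (gram W (fun k => Z (lift j k))).
Proof.
rewrite (expand_det_row _ ord0); apply: eq_bigr => j _.
rewrite mxE fcons0 /cofactor add0n mulrCA mulrA; congr (_ * \det _).
by apply/matrixP => k l; rewrite !mxE fconsS.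
Qed.

End antisymmetric_functions.

(** * The Fock space *)

Section completion_dot.
Variables (R : realType) (V : preHilbertType R).

Lemma dot_emb (u v : V) : dot (emb u) (emb v) = dot u v.
Proof.
rewrite [LHS]class_dotE /=; case: (dot u v) => a b /=.
by congr (_ +i* _); apply/cvg_lim => //; exact: cvg_cst.
Qed.

End completion_dot.

Section fock_chaos.
Variable R : realType.
Local Notation mR := (measurableTypeR R).
Local Notation leb := (@lebesgue_measure R).
Local Notation nleb := (nlebesgue R).
Local Notation cint n := (cintegral (nlebesgue R n) (@orthant R n)).

Definition achaos n (f : n.-tuple mR -> R[i]) : afock R := insubd 0 (chaos_val f).

Lemma achaosE n (f : n.-tuple mR -> R[i]) : Lambda f -> achaos f = chaos_val f :> (seq mR -> R[i]).
Proof. by move=> Lf; rewrite /achaos insubdK// chaos_valP. Qed.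

Lemma achaos_notin n (f : n.-tuple mR -> R[i]) : ~ Lambda f -> achaos f = 0.
Proof.
move=> nL; rewrite /achaos /insubd insubF//; apply/negP => /asboolP[h _].
by apply: nL; have := h n; rewrite component_chaos_val.
Qed.

(** The default value of [insubd] is 0. It matters because sections of anti-symmetric functions are
    given to [chaos] at every time, while they belong to [Lambda] only at almost every time. *)
Lemma chaos_notin n (f : n.-tuple mR -> R[i]) : ~ Lambda f -> chaos f = 0.
Proof. by move=> /achaos_notin h; rewrite /chaos -/(achaos f) h raddf0. Qed.

Lemma chaos_val_linear n a (f g : n.-tuple mR -> R[i]) s :
  chaos_val (fun t => a * f t + g t) s = a * chaos_val f s + chaos_val g s.
Proof. by rewrite /chaos_val; case: insub => [t|]; rewrite ?mulr0 ?addr0. Qed.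

Lemma achaos_linear n a (f g : n.-tuple mR -> R[i]) : Lambda f -> Lambda g ->
  achaos (fun t => a * f t + g t) = a *: achaos f + achaos g.
Proof.
move=> Lf Lg; apply/val_inj/funext => s.
rewrite [val _](achaosE (Lambda_linear a Lf Lg)) chaos_val_linear.
by rewrite -[RHS]/(a * achaos f s + achaos g s) (achaosE Lf) (achaosE Lg).
Qed.

Lemma chaos_linear n a (f g : n.-tuple mR -> R[i]) : Lambda f -> Lambda g ->
  chaos (fun t => a * f t + g t) = a *: chaos f + chaos g.
Proof.
move=> Lf Lg.
by rewrite /chaos -/(achaos (fun t => a * f t + g t)) achaos_linear// linearP.
Qed.

Lemma LambdaZ n a (f : n.-tuple mR -> R[i]) : Lambda f -> Lambda (fun t => a * f t).
Proof.
move=> Lf; have := Lambda_linear a Lf (Lambda0 R n).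
by under eq_fun do rewrite addr0.
Qed.

Lemma LambdaD n (f g : n.-tuple mR -> R[i]) : Lambda f -> Lambda g ->
  Lambda (fun t => f t + g t).
Proof.
move=> Lf Lg; have := Lambda_linear 1 Lf Lg.
by under eq_fun do rewrite mul1r.
Qed.

Lemma chaos0 n : chaos (fun _ : n.-tuple mR => 0) = 0 :> fock R.
Proof.
have L0 := Lambda0 R n; have := chaos_linear (-1) L0 L0.
by under eq_fun do rewrite mulr0 addr0; rewrite scaleN1r addNr.
Qed.

Lemma chaosZ n a (f : n.-tuple mR -> R[i]) : Lambda f ->
  chaos (fun t => a * f t) = a *: chaos f.
Proof.
move=> Lf; have := chaos_linear a Lf (Lambda0 R n); rewrite chaos0 addr0.
by under eq_fun do rewrite addr0.
Qed.

Lemma chaosD n (f g : n.-tuple mR -> R[i]) : Lambda f -> Lambda g ->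
  chaos (fun t => f t + g t) = chaos f + chaos g.
Proof.
move=> Lf Lg; have := chaos_linear 1 Lf Lg; rewrite scale1r.
by under eq_fun do rewrite mul1r.
Qed.

Lemma chaosB n (f g : n.-tuple mR -> R[i]) : Lambda f -> Lambda g ->
  chaos (fun t => f t - g t) = chaos f - chaos g.
Proof.
move=> Lf Lg; rewrite -[- chaos g]scaleN1r -chaosZ// -chaosD//; last exact: LambdaZ.
by under [in RHS]eq_fun do rewrite mulN1r.
Qed.

Lemma Lambda_sum n I (r : seq I) (f : I -> n.-tuple mR -> R[i]) :
  (forall i, Lambda (f i)) -> Lambda (fun t => \sum_(i <- r) f i t).
Proof.
move=> h; elim: r => [|i r IHr].
  by under eq_fun do rewrite big_nil; exact: Lambda0.
by under eq_fun do rewrite big_cons; exact: LambdaD.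
Qed.

Lemma chaos_sum n I (r : seq I) (f : I -> n.-tuple mR -> R[i]) :
  (forall i, Lambda (f i)) -> chaos (fun t => \sum_(i <- r) f i t) = \sum_(i <- r) chaos (f i).
Proof.
move=> h; elim: r => [|i r IHr].
  by under eq_fun do rewrite big_nil; rewrite big_nil chaos0.
under eq_fun do rewrite big_cons; rewrite big_cons chaosD ?IHr//.
exact: Lambda_sum.
Qed.

Lemma component_chaos_val_neq m n (f : n.-tuple mR -> R[i]) : m != n ->
  component m (chaos_val f) = fun=> 0.
Proof.
move=> mn; apply/funext => t; rewrite /component /chaos_val insubF//.
by rewrite size_tuple (negPf mn).
Qed.

Lemma Lambda_dot0 n (f : n.-tuple mR -> R[i]) : Lambda_dot f (fun=> 0) = 0.
Proof.
rewrite /Lambda_dot (@eq_cintegral _ _ _ _ _ _ (fun=> 0)) ?cintegral0 ?mulr0//.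
by move=> t _; rewrite mulr0.
Qed.

Lemma dot_achaos n (F : afock R) (g : n.-tuple mR -> R[i]) : Lambda g ->
  dot F (achaos g) = Lambda_dot (component n F) g.
Proof.
move=> Lg; rewrite [LHS](@afock_dotE _ _ _ n.+1); last first.
  by move=> s ns; rewrite achaosE// /chaos_val insubF// gtn_eqF.
rewrite big_ord_recr/= big1 ?add0r => [|i _]; rewrite achaosE//.
  by rewrite component_chaos_val.
by rewrite component_chaos_val_neq ?Lambda_dot0// ltn_eqF.
Qed.

Lemma dot_chaos n (f g : n.-tuple mR -> R[i]) : Lambda f -> Lambda g ->
  dot (chaos f) (chaos g) = Lambda_dot f g.
Proof.
move=> Lf Lg; rewrite /chaos dot_emb -/(achaos g) dot_achaos//.
by rewrite -/(achaos f) achaosE// component_chaos_val.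
Qed.

Lemma dot_chaos_neq m n (f : m.-tuple mR -> R[i]) (g : n.-tuple mR -> R[i]) :
  m != n -> dot (chaos f) (chaos g) = 0.
Proof.
move=> mn; have [Lf|/chaos_notin->] := pselect (Lambda f); last by rewrite dot0l.
have [Lg|/chaos_notin->] := pselect (Lambda g); last by rewrite dot0r.
rewrite dotC /chaos dot_emb -/(achaos f) dot_achaos// -/(achaos g) achaosE//.
rewrite component_chaos_val_neq//= /Lambda_dot (@eq_cintegral _ _ _ _ _ _ (fun=> 0)).
  by rewrite cintegral0 mulr0 conjc0.
by move=> t _; rewrite conjc0 mul0r.
Qed.

Lemma afock_bound (F : afock R) : exists N, forall s, (N <= size s)%N -> F s = 0.
Proof. by case: F => F /= /asboolP[]. Qed.

Lemma emb_afock (F : afock R) N : (forall s, (N <= size s)%N -> F s = 0) ->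
  emb F = \sum_(n < N) chaos (component n F).
Proof.
move=> HN; rewrite /chaos -raddf_sum/=; congr emb; apply/val_inj/funext => s /=.
pose ev (G : afock R) := G s.
rewrite -[LHS]/(ev F) -[RHS]/(ev _) (big_morph ev (id1 := 0) (op1 := +%R))//.
have E (n : 'I_N) : ev (insubd 0 (chaos_val (component n F))) =
    if size s == n then F s else 0.
  rewrite /ev -/(achaos (component n F)) achaosE; last exact: afock_Lambda.
  rewrite /chaos_val; case: insubP => [t _ <-|/negPf->//].
  by rewrite size_tuple eqxx.
rewrite (eq_bigr _ (fun n _ => E n)).
have [sN|Ns] := ltnP (size s) N.
  rewrite (bigD1 (Ordinal sN))//= eqxx big1 ?addr0// => i iN.
  by case: eqP => // h; move: iN; rewrite -val_eqE/= h eqxx.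
by rewrite /ev HN// big1// => i _; case: ifP.
Qed.

Lemma fock_chaos_ind (M : set (fock R)) : closed_subspace M ->
  (forall n (f : n.-tuple mR -> R[i]), Lambda f -> M (chaos f)) -> forall x, M x.
Proof.
move=> cM h; apply: closed_subspace_emb => // F.
have [N HN] := afock_bound F; rewrite (emb_afock HN).
apply: subspace_sum => [|i _]; first by case: cM.
by apply: h; exact: afock_Lambda.
Qed.

Definition l2 n (f : n.-tuple mR -> R[i]) : R :=
  (\int[nleb n]_(t in @orthant R n) (normc (f t) ^+ 2))%R.

Lemma l2_ge0 n (f : n.-tuple mR -> R[i]) : 0 <= l2 f.
Proof. by apply: Rintegral_ge0 => t _; exact: sqr_ge0. Qed.

Lemma cint_self n (f : n.-tuple mR -> R[i]) :
  cint n (fun t => (f t)^*%C * f t) = (l2 f)%:C.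
Proof.
congr (_ +i* _).
  by apply: eq_Rintegral => t _; rewrite normc2; case: (f t) => a b /=; ring.
rewrite /Rintegral integral0_eq// => t _.
by case: (f t) => a b /=; congr EFin; ring.
Qed.

Lemma hnorm_chaos n (f : n.-tuple mR -> R[i]) : Lambda f ->
  hnorm (chaos f) ^+ 2 = n`!%:R * l2 f.
Proof.
move=> Lf; rewrite hnorm2 dot_chaos// /Lambda_dot cint_self.
by rewrite -(rmorph_nat (@real_complex R)) -rmorphM.
Qed.

Lemma chaos_ae n (f g : n.-tuple mR -> R[i]) : Lambda f -> Lambda g ->
  {ae nleb n, forall t, orthant t -> f t = g t} -> chaos f = chaos g.
Proof.
move=> Lf Lg h; have mO := @measurable_orthant R n.
apply/eqP; rewrite -subr_eq0; apply/eqP/dot_eq0; rewrite -chaosB//.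
have Lfg : Lambda (fun t => f t - g t).
  have := LambdaD Lf (LambdaZ (-1) Lg); by under eq_fun do rewrite mulN1r.
rewrite dot_chaos// /Lambda_dot (@cintegral_ae _ _ _ _ _ mO _ (fun=> 0)).
- by rewrite cintegral0 mulr0.
- have [sfg _] := Lfg; exact: cintegrable_measurable (cintegrable_dot mO sfg sfg).
- exact: cmeasurable_cst.
- by apply: filterS h => t h ot; rewrite h// subrr mulr0.
Qed.

Lemma chaos_antisymmetrization n (f : n.-tuple mR -> R[i]) : Lambda f ->
  chaos (antisymmetrization f) = chaos f.
Proof.
move=> Lf; apply: chaos_ae => //; last exact: antisymmetrization_id.
by apply: Lambda_antisymmetrization; case: Lf.
Qed.

Definition hat n (f : n.-tuple mR -> R[i]) : fock R := chaos (antisymmetrization f).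

Lemma antisymmetrization_linear n a (f g : n.-tuple mR -> R[i]) :
  antisymmetrization (fun t => a * f t + g t) =
  fun t => a * antisymmetrization f t + antisymmetrization g t.
Proof.
apply/funext => t; rewrite /antisymmetrization mulrCA -mulrDr; congr (_ * _).
by rewrite mulr_sumr -big_split/=; apply: eq_bigr => s _; rewrite mulrDr mulrCA.
Qed.

Lemma hat_linear n a (f g : n.-tuple mR -> R[i]) : L2n f -> L2n g ->
  hat (fun t => a * f t + g t) = a *: hat f + hat g.
Proof.
move=> sf sg; rewrite /hat antisymmetrization_linear chaos_linear//;
  exact: Lambda_antisymmetrization.
Qed.

(** Both mixed inner products of [f] with its projection h equal |h|^2, so |f - h|^2 = |f|^2 -
    |h|^2, which is nonnegative. *)
Lemma hnorm_hat n (f : n.-tuple mR -> R[i]) : L2n f ->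
  hnorm (hat f) ^+ 2 <= n`!%:R * l2 f.
Proof.
move=> sf; have Lf := Lambda_antisymmetrization sf; have [sf' _] := Lf.
rewrite hnorm_chaos// ler_wpM2l//; set h := antisymmetrization f.
have mO := @measurable_orthant R n.
have e1 : cint n (fun t => (h t)^*%C * f t) = (l2 h)%:C.
  rewrite -cint_self; have := Lambda_dot_antisymmetrization Lf sf.
  by rewrite /Lambda_dot => /(mulfI (fact_neq0 R n)) ->.
have e2 : cint n (fun t => (f t)^*%C * h t) = (l2 h)%:C.
  by rewrite (L2_dotC mO sf sf') e1 conjc_real.
have sd : L2n (fun t => f t + -1 * h t) by apply: L2nD => //; exact: L2nZ.
suff E : l2 (fun t => f t + -1 * h t) = l2 f - l2 h.
  by rewrite -subr_ge0 -E l2_ge0.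
have := cint_self (fun t => f t + -1 * h t).
rewrite (cintegral_dotD mO sd sf (L2nZ _ sf')) (cintegral_dotZ mO _ sd sf').
rewrite (L2_dotC mO sd sf) (L2_dotC mO sd sf').
rewrite (cintegral_dotD mO sf sf (L2nZ _ sf')) (cintegral_dotZ mO _ sf sf').
rewrite (cintegral_dotD mO sf' sf (L2nZ _ sf')) (cintegral_dotZ mO _ sf' sf').
rewrite -/h e1 e2 !cint_self => /(congr1 (@complex.Re R)) /= <-.
by move: (l2 f) (l2 h) => a b; ring.
Qed.

Lemma L2_bounded n (f : n.-tuple mR -> R[i]) g :
  cmeasurable (@orthant R n) f -> L2n g ->
  (forall t, orthant t -> normc (f t) <= normc (g t)) -> L2n f.
Proof.
move=> mf [gr gi goo] fg; have [fr fi] := mf; split=> //; apply: le_lt_trans goo.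
have mO := @measurable_orthant R n.
apply: ge0_le_integral => //.
- by move=> t _; rewrite lee_fin sqr_ge0.
- by apply/measurable_EFinP; exact: measurable_normc2.
- by apply/measurable_EFinP; exact: measurable_normc2.
- by move=> t ot; rewrite lee_fin lerXn2r ?nnegrE ?normc_ge0// fg.
Qed.

Lemma l2_dominated n (f : nat -> n.-tuple mR -> R[i]) g : L2n g ->
  (forall k, cmeasurable (@orthant R n) (f k)) ->
  (forall k t, orthant t -> normc (f k t) <= normc (g t)) ->
  (forall t, orthant t -> normc (f k t) @[k --> \oo] --> (0 : R)) ->
  l2 (f k) @[k --> \oo] --> (0 : R).
Proof.
move=> sg mf fg f0; have mO := @measurable_orthant R n.
have [] := @dominated_convergence _ _ _ (nleb n) (@orthant R n) mO
  (fun k t => (normc (f k t) ^+ 2)%:E) (cst 0%E) (fun t => (normc (g t) ^+ 2)%:E).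
- by move=> k; apply/measurable_EFinP; exact: measurable_normc2.
- exact: measurable_cst.
- apply: aeW => t ot; apply: cvg_EFin; first by apply: nearW.
  rewrite [X in _ --> X](_ : _ = 0 ^+ 2 :> R); last by rewrite expr0n.
  under eq_fun do rewrite /= expr2; rewrite expr2.
  by apply: cvgM; exact: f0.
- exact: (integrable_normc2 mO).
- apply: aeW => t k ot.
  by rewrite gee0_abs ?lee_fin ?sqr_ge0// lerXn2r ?nnegrE ?normc_ge0// fg.
move=> _ _; rewrite integral0 => h.
by case/fine_cvgP : h.
Qed.

Lemma hat_cvg n (M : set (fock R)) (f : nat -> n.-tuple mR -> R[i]) h : closed_subspace M ->
  (forall k, L2n (f k)) -> L2n h -> (forall k, M (hat (f k))) ->
  l2 (fun t => h t - f k t) @[k --> \oo] --> (0 : R) -> M (hat h).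
Proof.
move=> [_ cM] sf sh Mf h0; apply: (cM _ _ Mf).
have c1 : n`!%:R * l2 (fun t => h t - f k t) @[k --> \oo] --> (0 : R).
  by rewrite -[0](mulr0 (n`!%:R : R)); exact: cvgMr.
apply/hcvgP => e e0; move/cvgrPdist_lt : c1 => /(_ (e ^+ 2)).
rewrite exprn_gt0// => /(_ isT)[N _ HN]; exists N => k Nk.
have := HN k Nk; rewrite sub0r normrN ger0_norm ?mulr_ge0 ?l2_ge0// => h1.
rewrite -(@ltr_pXn2r _ 2%N)// ?nnegrE ?hnorm_ge0 ?ltW//; apply: le_lt_trans h1.
rewrite hnormBC -scaleN1r addrC -hat_linear//.
rewrite (_ : (fun t => _) = fun t => h t - f k t); last first.
  by apply/funext => t; rewrite mulN1r addrC.
apply: hnorm_hat.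
have := L2nD sh (L2nZ (-1) (sf k)); by under eq_fun do rewrite mulN1r.
Qed.

End fock_chaos.

(** * Totality of wedges of indicator functions *)

Section density.
Variable R : realType.
Local Notation mR := (measurableTypeR R).
Local Notation leb := (@lebesgue_measure R).
Local Notation nleb := (nlebesgue R).

Definition ind T (A : set T) : T -> R[i] := fun x => (\1_A x)%:C.

Lemma ind_in T (A : set T) x : A x -> ind A x = 1.
Proof. by move=> Ax; rewrite /ind indicE mem_set. Qed.

Lemma ind_notin T (A : set T) x : ~ A x -> ind A x = 0.
Proof. by move=> Ax; rewrite /ind indicE memNset. Qed.

Lemma normc_real (r : R) : normc (r%:C) = `|r|.
Proof. by rewrite /normc /= expr0n/= addr0 sqrtr_sqr. Qed.

Lemma normc1 : normc (1 : R[i]) = 1.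
Proof. by rewrite normc_real normr1. Qed.

Lemma cmeasurable_ind d (T : measurableType d) (D A : set T) : measurable A ->
  cmeasurable D (ind A : T -> R[i]).
Proof.
move=> mA; split; last exact: measurable_cst.
exact: measurable_indic.
Qed.

Lemma L2half_ind (A : set mR) : measurable A -> (leb A < +oo)%E -> L2half (ind A).
Proof.
move=> mA Aoo; have mH := @measurable_half_line R.
have [mr mi] := cmeasurable_ind (@half_line R) mA; split=> //.
rewrite (eq_integral (fun x => (\1_A x)%:E)) => [|x _]; last first.
  by congr EFin; rewrite /ind normc_real indicE; case: (_ \in _); rewrite ?normr1 ?normr0 ?expr1n ?expr0n.
rewrite integral_indic//; apply: le_lt_trans Aoo.
by apply: le_measure; rewrite ?inE//; exact: measurableI.
Qed.

Lemma ind_rect n (A : 'I_n -> set mR) : ind (rect A) = prodfun (fun i => ind (A i)).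
Proof.
apply/funext => t; have [At|] := pselect (rect A t).
  by rewrite ind_in// /prodfun big1// => i _; rewrite ind_in.
move=> nA; rewrite ind_notin//; move/existsNP: nA => [i nAi].
by rewrite /prodfun (bigD1 i)//= ind_notin// mul0r.
Qed.

(** Bounded cubes serve as cutoffs: indicators of general measurable sets are not square
    integrable. *)
Definition itvk k : set mR := [set` `[- (k%:R : R), k%:R]].
Definition cubek n k : set (n.-tuple mR) := rect (fun _ : 'I_n => itvk k).
Arguments cubek n k : clear implicits.

Lemma measurable_itvk k : measurable (itvk k).
Proof. exact: measurable_itv. Qed.

Lemma leb_itvk k : (leb (itvk k) < +oo)%E.
Proof.
by rewrite /itvk lebesgue_measure_itv/=; case: ifP => _; rewrite ?ltry// -EFinD ltry.
Qed.

Lemma measurable_cubek n k : measurable (cubek n k).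
Proof. by apply: measurable_rect => i; exact: measurable_itvk. Qed.

Lemma in_cubek n (t : n.-tuple mR) : exists N, forall k, (N <= k)%N -> cubek n k t.
Proof.
pose b : R := \big[Num.max/0]_(i < n) `|tnth t i|.
exists (Num.truncn b).+1 => // k Nk i.
have : `|tnth t i| <= k%:R.
  apply: (@le_trans _ _ b); first exact: (le_bigmax _ (fun i => `|tnth t i|)).
  by rewrite (le_trans (ltW (truncnS_gt b)))// ler_nat.
by rewrite ler_norml /itvk /= in_itv.
Qed.

Lemma L2n_ind_cubek n k : L2n (ind (cubek n k)).
Proof.
rewrite /cubek ind_rect; apply: L2n_prodfun => i.
by apply: L2half_ind; [exact: measurable_itvk|exact: leb_itvk].
Qed.

Lemma normc_ind_le T (A B : set T) x : A `<=` B -> normc (ind A x) <= normc (ind B x).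
Proof.
move=> AB; have [Ax|Ax] := pselect (A x).
  by rewrite !ind_in//; exact: AB.
by rewrite ind_notin// normc0 normc_ge0.
Qed.

Lemma L2n_ind_sub n (B : set (n.-tuple mR)) k : measurable B -> L2n (ind (B `&` cubek n k)).
Proof.
move=> mB; apply: (L2_bounded _ (L2n_ind_cubek n k)).
  by apply: cmeasurable_ind; apply: measurableI => //; exact: measurable_cubek.
by move=> t _; apply: normc_ind_le; exact: subIsetr.
Qed.

Lemma hat0 n : hat (fun _ : n.-tuple mR => 0) = 0 :> fock R.
Proof.
rewrite /hat (_ : antisymmetrization _ = fun=> 0) ?chaos0//.
apply/funext => t; rewrite /antisymmetrization big1 ?mulr0// => s _.
by rewrite mulr0.
Qed.

Lemma hat_sum n I (r : seq I) (c : I -> R[i]) (f : I -> n.-tuple mR -> R[i]) :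
  (forall i, L2n (f i)) ->
  hat (fun t => \sum_(i <- r) c i * f i t) = \sum_(i <- r) c i *: hat (f i).
Proof.
move=> sf; have mO := @measurable_orthant R n.
elim: r => [|i r IHr].
  by under eq_fun do rewrite big_nil; rewrite big_nil hat0.
under eq_fun do rewrite big_cons; rewrite big_cons hat_linear ?IHr//.
apply: L2_sum => // j; exact: L2nZ.
Qed.

Section wedge_dense.
Import HBNNSimple.
Variables (n : nat) (M : set (fock R)).
Hypothesis cM : closed_subspace M.
Hypothesis hM : forall A : 'I_n -> set mR, (forall i, measurable (A i)) ->
  (forall i, (leb (A i) < +oo)%E) -> M (chaos (wedge (fun i => ind (A i)))).

Let sM : subspace M. Proof. by case: cM. Qed.

(** Dynkin induction. The predicate quantifies over all cubes, and complements are taken within a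
    cube, so every function involved is square integrable. *)
Let dense_ind (B : set (n.-tuple mR)) : measurable B ->
  forall k, M (hat (ind (B `&` cubek n k))).
Proof.
move=> mB; have mQ := @measurable_cubek n; move: (mB); rewrite measurable_tupleE.
move: B {mB}; apply: (@dynkin_induction _ (n.-tuple mR) (rects R n)
  (fun B => forall k, M (hat (ind (B `&` cubek n k))))).
- exact: measurable_tupleE.
- exact: setI_closed_rects.
- move=> k; rewrite setTI /cubek ind_rect; apply: hM => i.
    exact: measurable_itvk.
  exact: leb_itvk.
- move=> _ [A mA <-] k; rewrite /cubek rectI ind_rect; apply: hM => i.
    by apply: measurableI => //; exact: measurable_itvk.
  apply: le_lt_trans (leb_itvk k); apply: le_measure; rewrite ?inE//.
    by apply: measurableI => //; exact: measurable_itvk.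
  exact: measurable_itvk.
- move=> B mB hB k.
  have -> : ind (~` B `&` cubek n k) =
      fun t => -1 * ind (B `&` cubek n k) t + 1 * ind (setT `&` cubek n k) t.
    apply/funext => t; rewrite setTI mul1r mulN1r.
    have [Qt|Qt] := pselect (cubek n k t); last first.
      by rewrite !ind_notin ?oppr0 ?addr0// => -[].
    have [Bt|Bt] := pselect (B t).
      by rewrite ind_notin 1?ind_in 1?ind_in ?addNr// => -[].
    by rewrite ind_in// ind_notin 1?ind_in ?oppr0 ?add0r// => -[].
  have s1 := L2n_ind_sub k mB; have s2 := L2n_ind_sub k (@measurableT _ (n.-tuple mR)).
  rewrite hat_linear//; last exact: L2nZ.
  apply: subspaceD => //; first by apply: subspaceZ.
  rewrite (_ : (fun t => _) = ind (setT `&` cubek n k)); last by apply/funext => t; rewrite mul1r.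
  rewrite setTI /cubek ind_rect; apply: hM => i; [exact: measurable_itvk|exact: leb_itvk].
- move=> F mF tF hF k; pose U m := \big[setU/set0]_(i < m) F i.
  have mU m : measurable (U m) by apply: bigsetU_measurable.
  have mUF : measurable (\bigcup_i F i) by exact: bigcupT_measurable.
  have MU m : M (hat (ind (U m `&` cubek n k))).
    elim: m => [|m IHm].
      rewrite /U big_ord0 set0I (_ : ind set0 = fun=> 0); first by rewrite hat0; case: sM.
      by apply/funext => t; rewrite ind_notin.
    have -> : ind (U m.+1 `&` cubek n k) =
        fun t => 1 * ind (U m `&` cubek n k) t + ind (F m `&` cubek n k) t.
      apply/funext => t; rewrite mul1r /U big_ord_recr/= -/(U m).
      have [Qt|Qt] := pselect (cubek n k t); last first.
        by rewrite !ind_notin ?addr0// => -[].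
      have disj : ~ (U m t /\ F m t).
        rewrite /U -bigcup_mkord => -[[j /= jm Fj] Fm].
        have jE := tF j m I I (ex_intro _ t (conj Fj Fm)).
        by rewrite jE ltnn in jm.
      have [Ut|Ut] := pselect (U m t).
        rewrite ind_in; last by split=> //; left.
        rewrite ind_in// ind_notin ?addr0// => -[Ft _]; exact: disj.
      have [Ft|Ft] := pselect (F m t).
        rewrite ind_in; last by split=> //; right.
        by rewrite ind_notin 1?ind_in ?add0r// => -[].
      by rewrite !ind_notin ?addr0// => -[]// [].
    rewrite hat_linear; [|exact: L2n_ind_sub..].
    by apply: subspaceD => //; exact: subspaceZ.
  (* Inside a cube a countable disjoint union is the L^2 limit of its finite unions, by domination
     by the indicator of the cube. *)
  apply: (hat_cvg cM _ _ MU) => [m||]; [exact: L2n_ind_sub..|].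
  apply: (l2_dominated (L2n_ind_cubek n k)).
  + move=> m; rewrite (_ : (fun t => _) = fun t => ind (\bigcup_i F i `&` cubek n k) t +
        -1 * ind (U m `&` cubek n k) t); last by apply/funext => t; rewrite mulN1r.
    apply: cmeasurableD; [|apply: cmeasurableZ]; apply: cmeasurable_ind;
      apply: measurableI => //; exact: mQ.
  + move=> m t _; have [Qt|Qt] := pselect (cubek n k t); last first.
      by rewrite !ind_notin ?subr0// => -[].
    rewrite (ind_in Qt) normc1.
    have [Ut|Ut] := pselect (U m t).
      rewrite ind_in; last by split=> //; move: Ut; rewrite /U -bigcup_mkord => -[j _ Fj]; exists j.
      by rewrite ind_in// subrr normc0.
    rewrite [X in _ - X]ind_notin ?subr0; last by case.
    have [Ft|Ft] := pselect ((\bigcup_i F i) t); first by rewrite ind_in ?normc1.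
    by rewrite ind_notin ?normc0// => -[].
  + move=> t _; have [Qt|Qt] := pselect (cubek n k t); last first.
      apply: cvg_near_cst; exists 0%N => // m _.
      by rewrite !ind_notin ?subr0 ?normc0// => -[].
    have [[j _ Fj]|Ft] := pselect ((\bigcup_i F i) t).
      apply: cvg_near_cst; exists j.+1 => // m jm; have {}jm : (j < m)%N := jm.
      rewrite !ind_in ?subrr ?normc0//; split=> //; last by exists j.
      by rewrite /U -bigcup_mkord; exists j.
    apply: cvg_near_cst; exists 0%N => // m _.
    have -> : ind (U m `&` cubek n k) t = 0.
      apply: ind_notin => -[+ _].
      by rewrite /U -bigcup_mkord => -[j _ Fj]; apply: Ft; exists j.
    by rewrite ind_notin ?subr0 ?normc0// => -[].
Qed.

(** Increasing simple approximations cut off to growing cubes are finite combinations of the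
    indicators already treated, and their distance to [f] is dominated by [f]. *)
Let dense_nonneg (f : n.-tuple mR -> R) : (forall t, orthant t -> 0 <= f t) ->
  L2n (fun t => (f t)%:C) -> M (hat (fun t => (f t)%:C)).
Proof.
move=> f0 sf; have mO := @measurable_orthant R n.
have mf : measurable_fun (@orthant R n) (EFin \o f) by apply/measurable_EFinP; case: sf.
have f0' t : orthant t -> (0 <= (EFin \o f) t)%E by move=> ot; rewrite lee_fin f0.
pose g := nnsfun_approx mO mf.
pose fk k t := (g k t * \1_(cubek n k) t)%:C.
have fkE k : fk k = fun t => \sum_(y <- finmap.enum_fset (fset_set (range (g k))))
    y%:C * ind (g k @^-1` [set y] `&` cubek n k) t.
  apply/funext => t; rewrite /fk {1}fimfunE fsbig_finite//= mulr_suml rmorph_sum/=.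
  apply: eq_bigr => y _; rewrite -mulrA rmorphM/=; congr (_ * _).
  by rewrite /ind !indicE in_setI -natrM mulnb.
have sind k y : L2n (ind (g k @^-1` [set y] `&` cubek n k)).
  by apply: L2n_ind_sub; rewrite -[X in measurable X]setTI; exact: measurable_funP.
have sfk k : L2n (fk k).
  rewrite fkE; apply: L2_sum => // y; exact: L2nZ.
have Mfk k : M (hat (fk k)).
  rewrite fkE hat_sum//; apply: subspace_sum => // y _; apply: subspaceZ => //.
  by apply: dense_ind; rewrite -[X in measurable X]setTI; exact: measurable_funP.
have g0 k t : 0 <= g k t by [].
have gf k t : orthant t -> g k t <= f t.
  move=> ot; have := cvg_nnsfun_approx mO mf f0' ot => /fine_cvgP[_ /= gt].
  have <- := cvg_lim (@Rhausdorff R) gt.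
  apply: (nondecreasing_cvgn_le (u_ := fun k => g k t)); last by apply/cvg_ex; exists (f t).
  by move=> a b ab; exact/lefP/nd_nnsfun_approx.
apply: (hat_cvg cM sfk sf Mfk); apply: (l2_dominated sf).
- move=> k; rewrite (_ : (fun t => _) = fun t => (f t)%:C + -1 * fk k t); last first.
    by apply/funext => t; rewrite mulN1r.
  apply: cmeasurableD; first exact: (L2_measurable sf).
  by apply: cmeasurableZ; exact: (L2_measurable (sfk k)).
- move=> k t ot; rewrite /fk -rmorphB !normc_real.
  have [h0 h1] := (g0 k t, gf k t ot); have f0t := f0 t ot.
  rewrite (ger0_norm f0t) ger0_norm indicE; case: (_ \in _); rewrite ?mulr1 ?mulr0; lra.
- move=> t ot; have := cvg_nnsfun_approx mO mf f0' ot => /fine_cvgP[_ /=] gt.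
  have [N HN] := in_cubek t.
  have gt' : normc ((f t)%:C - (g k t)%:C) @[k --> \oo] --> (0 : R).
    under eq_fun do rewrite -rmorphB normc_real.
    apply/norm_cvg0P; rewrite -[0](subrr (f t)).
    by apply: cvgB => //; exact: cvg_cst.
  apply: cvg_trans gt'; apply: near_eq_cvg; exists N => // k Nk.
  by rewrite /fk indicE mem_set ?mulr1//; exact: HN.
Qed.

Lemma wedge_dense (f : n.-tuple mR -> R[i]) : L2n f -> M (hat f).
Proof.
move=> sf; have [mr mi _] := sf; have mO := @measurable_orthant R n.
have part (p : n.-tuple mR -> R) : measurable_fun (@orthant R n) p ->
    (forall t, 0 <= p t) -> (forall t, p t <= normc (f t)) ->
    L2n (fun t => (p t)%:C) /\ M (hat (fun t => (p t)%:C)).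
  move=> mp p0 pf; have sp : L2n (fun t => (p t)%:C).
    apply: L2_bounded sf _; first by split=> //; exact: measurable_cst.
    by move=> t _; rewrite normc_real ger0_norm.
  by split=> //; exact: dense_nonneg.
pose p1 t := Num.max (complex.Re (f t)) 0; pose p2 t := Num.max (- complex.Re (f t)) 0.
pose p3 t := Num.max (complex.Im (f t)) 0; pose p4 t := Num.max (- complex.Im (f t)) 0.
have max_le (a b : R) : `|a| <= b -> Num.max a 0 <= b /\ Num.max (- a) 0 <= b.
  by rewrite ler_norml => /andP[? ?]; split; rewrite ge_max; apply/andP; split; lra.
have [|||s1 M1] := part p1.
- by apply: measurable_maxr => //; exact: measurable_cst.
- by move=> t; rewrite /p1 /p2 /p3 /p4 le_max lexx orbT.
- by move=> t; case: (max_le _ _ (normc_Re (f t))).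
have [|||s2 M2] := part p2.
- by apply: measurable_maxr; [exact: measurable_funN|exact: measurable_cst].
- by move=> t; rewrite /p1 /p2 /p3 /p4 le_max lexx orbT.
- by move=> t; case: (max_le _ _ (normc_Re (f t))).
have [|||s3 M3] := part p3.
- by apply: measurable_maxr => //; exact: measurable_cst.
- by move=> t; rewrite /p1 /p2 /p3 /p4 le_max lexx orbT.
- by move=> t; case: (max_le _ _ (normc_Im (f t))).
have [|||s4 M4] := part p4.
- by apply: measurable_maxr; [exact: measurable_funN|exact: measurable_cst].
- by move=> t; rewrite /p1 /p2 /p3 /p4 le_max lexx orbT.
- by move=> t; case: (max_le _ _ (normc_Im (f t))).
rewrite (_ : f = fun t => 1 * (p1 t)%:C + (-1 * (p2 t)%:C +
   ('i%C * (p3 t)%:C + (- 'i%C) * (p4 t)%:C))).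
  have s34 := L2nD (L2nZ 'i%C s3) (L2nZ (- 'i%C) s4).
  have s234 := L2nD (L2nZ (-1) s2) s34.
  rewrite (hat_linear _ s1 s234).
  apply: subspaceD => //; first exact: subspaceZ.
  rewrite (hat_linear _ s2 s34).
  apply: subspaceD => //; first exact: subspaceZ.
  rewrite (hat_linear _ s3 (L2nZ _ s4)).
  apply: subspaceD => //; first exact: subspaceZ.
  (* Homogeneity of [hat] for the last of the four parts, obtained as a sum with one term. *)
  have := hat_sum [:: tt] (fun=> - 'i%C) (fun _ => s4); rewrite big_seq1.
  by under eq_fun do rewrite big_seq1; move=> ->; exact: subspaceZ.
apply/funext => t; rewrite /p1 /p2 /p3 /p4; case: (f t) => a b /=.
have mE (x : R) : Num.max x 0 - Num.max (- x) 0 = x.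
  have [x0|x0] := leP 0 x; first by rewrite max_r ?subr0// oppr_le0.
  by rewrite max_l ?oppr_ge0 ?ltW// sub0r opprK.
rewrite -[in LHS](mE a) -[in LHS](mE b).
move: (Num.max a 0) (Num.max (- a) 0) (Num.max b 0) (Num.max (- b) 0) => x y z w.
by apply/eqP; rewrite eq_complex/=; apply/andP; split; apply/eqP; ring.
Qed.

End wedge_dense.

Lemma chaos_dense n (M : set (fock R)) : closed_subspace M ->
  (forall A : 'I_n -> set mR, (forall i, measurable (A i)) ->
  (forall i, (leb (A i) < +oo)%E) -> M (chaos (wedge (fun i => ind (A i))))) ->
  forall f : n.-tuple mR -> R[i], Lambda f -> M (chaos f).
Proof.
move=> cM hM f Lf; rewrite -chaos_antisymmetrization//.
by apply: wedge_dense => //; case: Lf.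
Qed.

End density.
Arguments ind {R T} A.

(** * Operators defined degree by degree *)

Section graded.
Variable R : realType.
Local Notation mR := (measurableTypeR R).

Lemma fock_wedge_ind (M : set (fock R)) : closed_subspace M ->
  (forall n (A : 'I_n -> set mR), (forall i, measurable (A i)) ->
    (forall i, (@lebesgue_measure R (A i) < +oo)%E) ->
    M (chaos (wedge (fun i => ind (A i))))) -> forall x, M x.
Proof.
move=> cM h; apply: fock_chaos_ind => // n f Lf.
exact: (chaos_dense cM (h n)).
Qed.

Lemma fock_wedge_ext (T T' : fock R -> fock R) : bounded_operator T ->
  bounded_operator T' ->
  (forall n (Z : 'I_n -> mR -> R[i]), (forall i, L2half (Z i)) ->
    T (chaos (wedge Z)) = T' (chaos (wedge Z))) -> T = T'.
Proof.
move=> bT bT' h; apply/funext; apply: fock_wedge_ind.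
  exact: (closed_subspace_eq bT bT').
by move=> n A mA Aoo; apply: h => i; exact: L2half_ind.
Qed.

Lemma fock_wedge_dot0 (y : fock R) :
  (forall n (Z : 'I_n -> mR -> R[i]), (forall i, L2half (Z i)) ->
    dot (chaos (wedge Z)) y = 0) -> y = 0.
Proof.
move=> h; apply: dot_eq0; apply: (fock_wedge_ind (dot_closed_subspace y)).
move=> n A mA Aoo /=; rewrite dotC h ?conjc0// => i; exact: L2half_ind.
Qed.

Lemma hnorm_sum_orthogonal (V : preHilbertType R) n (x : 'I_n -> V) :
  (forall i j, i != j -> dot (x i) (x j) = 0) ->
  hnorm (\sum_(i < n) x i) ^+ 2 = \sum_(i < n) hnorm (x i) ^+ 2.
Proof.
move=> h; rewrite hnorm2 dot_suml (big_morph (@complex.Re R) (id1 := 0) (op1 := +%R))//; last exact: ReD.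
apply: eq_bigr => i _; rewrite dot_sumr (bigD1 i)//= big1 ?addr0 -?hnorm2// => j ji.
by rewrite h// eq_sym.
Qed.

Lemma sum_sqr_le n (x y : 'I_n -> R) (X Y c : R) : 0 <= c -> 0 <= X -> 0 <= Y ->
  (forall i, 0 <= x i) -> (forall i, x i <= c * y i) ->
  X ^+ 2 = \sum_(i < n) x i ^+ 2 -> Y ^+ 2 = \sum_(i < n) y i ^+ 2 -> X <= c * Y.
Proof.
move=> c0 X0 Y0 x0 xy XE YE; rewrite -(@ler_pXn2r _ 2%N)// ?nnegrE ?mulr_ge0//.
rewrite exprMn XE YE mulr_sumr; apply: ler_sum => i _; rewrite -exprMn.
by rewrite lerXn2r// nnegrE// (le_trans (x0 i)).
Qed.

(** Images of different degrees are orthogonal, so Pythagoras turns a bound uniform in the degree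
    into a bound on finite sums. Creation operators and the parity operator are both built in this
    way. *)
Lemma graded_extension (T : forall n, (n.-tuple mR -> R[i]) -> fock R) (c : R) :
  0 <= c ->
  (forall n a (f g : n.-tuple mR -> R[i]), Lambda f -> Lambda g ->
    T n (fun t => a * f t + g t) = a *: T n f + T n g) ->
  (forall n (f : n.-tuple mR -> R[i]), Lambda f -> hnorm (T n f) <= c * hnorm (chaos f)) ->
  (forall m n (f : m.-tuple mR -> R[i]) (g : n.-tuple mR -> R[i]), m != n ->
    dot (T m f) (T n g) = 0) ->
  exists T', bounded_operator T' /\
    forall n (f : n.-tuple mR -> R[i]), Lambda f -> T' (chaos f) = T n f.
Proof.
move=> c0 lT bT oT.
have T0 n : T n (fun=> 0) = 0.
  apply: hnorm_eq0; apply/eqP; rewrite eq_le hnorm_ge0 andbT.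
  by rewrite (le_trans (bT _ _ (Lambda0 R n)))// chaos0 hnorm0 mulr0.
(* A cutoff is chosen for each vector. By [BE] any larger cutoff gives the same sum, so linearity
   can be checked at a common one. *)
pose N (F : afock R) := sval (cid (afock_bound F)).
have HN (F : afock R) := svalP (cid (afock_bound F)).
pose B (F : afock R) : fock R := \sum_(n < N F) T n (component n F).
have BE (F : afock R) K : (forall s, (K <= size s)%N -> F s = 0) -> B F = \sum_(n < K) T n (component n F).
  have aux K1 K2 : (K1 <= K2)%N -> (forall s, (K1 <= size s)%N -> F s = 0) ->
      \sum_(n < K1) T n (component n F) = \sum_(n < K2) T n (component n F).
    move=> K12 h; rewrite (big_ord_widen K2 (fun n => T n (component n F)) K12) [RHS](bigID (fun i : 'I_K2 => (i < K1)%N))/=.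
    rewrite [X in _ = _ + X]big1 ?addr0// => i; rewrite -leqNgt => Ki.
    rewrite (_ : component i F = fun=> 0) ?T0//; apply/funext => t.
    by rewrite /component h// size_tuple.
  move=> hK; rewrite /B (aux _ _ (leq_maxl (N F) K) (HN F)).
  by rewrite [RHS](aux _ _ (leq_maxr (N F) K) hK).
have bB : bounded_map B.
  split=> [a F G|].
    pose K := maxn (N F) (N G).
    have hF s : (K <= size s)%N -> F s = 0 by rewrite geq_max => /andP[/HN].
    have hG s : (K <= size s)%N -> G s = 0 by rewrite geq_max => /andP[_ /HN].
    rewrite (BE F K)// (BE G K)// (BE (a *: F + G) K); last first.
      by move=> s Ks; rewrite -[LHS]/(a * F s + G s) hF// hG// mulr0 addr0.
    rewrite scaler_sumr -big_split/=; apply: eq_bigr => n _.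
    rewrite -lT; [|exact: afock_Lambda..]; congr T.
  exists c => F.
  have -> : hnorm F = hnorm (\sum_(n < N F) chaos (component n F)).
    by rewrite -(emb_afock (HN F)) hnorm_emb.
  apply: (@sum_sqr_le (N F) (fun n => hnorm (T n (component n F)))
    (fun n => hnorm (chaos (component n F)))).
  - exact: c0.
  - exact: hnorm_ge0.
  - exact: hnorm_ge0.
  - by move=> i; exact: hnorm_ge0.
  - by move=> i; apply: bT; exact: afock_Lambda.
  - by apply: hnorm_sum_orthogonal => i j ij; exact: oT.
  - by apply: hnorm_sum_orthogonal => i j ij; exact: dot_chaos_neq.
have [T' [bT' T'E]] := completion_extend bB; exists T'; split=> // n f Lf.
rewrite /chaos T'E -/(achaos f) (BE _ n.+1); last first.
  by move=> s ns; rewrite achaosE// /chaos_val insubF// gtn_eqF.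
rewrite big_ord_recr/= big1 ?add0r => [|i _]; rewrite achaosE//.
  by rewrite component_chaos_val.
by rewrite component_chaos_val_neq ?T0// ltn_eqF.
Qed.

End graded.

Arguments halfdot {R} z w : simpl never.

(** * Creation and annihilation operators *)

Section creation.
Variable R : realType.
Local Notation mR := (measurableTypeR R).
Local Notation leb := (@lebesgue_measure R).
Local Notation nleb := (nlebesgue R).

Lemma halfdotC (z w : mR -> R[i]) : L2half z -> L2half w -> halfdot z w = (halfdot w z)^*%C.
Proof. by move=> sz sw; apply: L2_dotC => //; exact: measurable_half_line. Qed.

Definition hz (z : mR -> R[i]) : R := complex.Re (halfdot z z).

Lemma halfdot_self (z : mR -> R[i]) : halfdot z z = (hz z)%:C.
Proof.
rewrite /hz; have := cintegral_dot_ge0 leb (@half_line R) z.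
by rewrite -/(halfdot z z) => /ger0_Im; case: (halfdot z z) => a b /= ->.
Qed.

Lemma hz_ge0 (z : mR -> R[i]) : 0 <= hz z.
Proof. by have := cintegral_dot_ge0 leb (@half_line R) z; rewrite lecE => /andP[]. Qed.

Lemma tensor_linear n z a (f g : n.-tuple mR -> R[i]) :
  tensor z (fun t => a * f t + g t) = fun t => a * tensor z f t + tensor z g t.
Proof. by apply/funext => t; rewrite /tensor mulrDr mulrCA. Qed.

Definition bstar n (z : mR -> R[i]) (w : n.-tuple mR -> R[i]) : fock R :=
  hat (tensor z w).

Lemma bstar_linear n z a (f g : n.-tuple mR -> R[i]) : L2half z -> Lambda f -> Lambda g ->
  bstar z (fun t => a * f t + g t) = a *: bstar z f + bstar z g.
Proof.
by move=> sz [sf _] [sg _]; rewrite /bstar tensor_linear hat_linear//; exact: L2n_tensor.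
Qed.

Lemma l2_tensor n z (w : n.-tuple mR -> R[i]) : L2half z -> L2n w ->
  l2 (tensor z w) = hz z * l2 w.
Proof.
move=> sz sw; have := cintegral_tensor sz sz sw sw.
by rewrite !cint_self halfdot_self -rmorphM => -[].
Qed.

(** The factor n + 1 = (n + 1)! / n! grows with the degree, so this bound cannot define an operator
    on the Fock space. It provides continuity within one degree, which is what the passage to the
    limit in [bstar_bounded] asks for. *)
Lemma bstar_crude n z (w : n.-tuple mR -> R[i]) : L2half z -> Lambda w ->
  hnorm (bstar z w) ^+ 2 <= (n.+1%:R * hz z) * hnorm (chaos w) ^+ 2.
Proof.
move=> sz Lw; have [sw _] := Lw.
rewrite (le_trans (hnorm_hat (L2n_tensor sz sw)))// l2_tensor// hnorm_chaos//.
rewrite factS natrM le_eqVlt; apply/orP; left; apply/eqP.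
by move: (n.+1%:R : R) (n`!%:R : R) (hz z) (l2 w) => a b c e; ring.
Qed.

Lemma le_sqrt_mul (x y c : R) : 0 <= c -> 0 <= x -> 0 <= y ->
  x ^+ 2 <= c * y ^+ 2 -> x <= Num.sqrt c * y.
Proof.
move=> c0 x0 y0 h; rewrite -(@ler_pXn2r _ 2%N)// ?nnegrE ?mulr_ge0 ?sqrtr_ge0//.
by rewrite exprMn sqr_sqrtr.
Qed.

(** Arithmetic of [bstar_bounded]: [a] is the sharp constant, available at the approximant, [b] the
    crude one, available everywhere, and [B] the distance to the approximant. *)
Lemma bound_of_approximation (A B C D E W a b e : R) :
  E <= a * D -> C <= b * B -> A <= C + E -> D <= B + W -> B < e ->
  0 <= a -> 0 <= b -> A - a * W <= (a + b) * e.
Proof.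
move=> k1 k2 k3 k4 k5 k6 k7.
have k8 : a * D <= a * (B + W) by rewrite ler_wpM2l.
have k9 : a * B <= a * e by rewrite ler_wpM2l// ltW.
have k10 : b * B <= b * e by rewrite ler_wpM2l// ltW.
lra.
Qed.

(** Integrability is bundled with the family, so that formal combinations of wedges are plain lists
    of pairs, over which inner products are double sums of Gram determinants. *)
Definition L2fam n := {Z : 'I_n -> mR -> R[i] | forall i, L2half (Z i)}.
Definition wterm n (p : R[i] * L2fam n) : fock R := p.1 *: chaos (wedge (sval p.2)).

Lemma dot_wterm n (p q : R[i] * L2fam n) :
  dot (wterm p) (wterm q) = p.1^*%C * q.1 * \det (gram (sval p.2) (sval q.2)).
Proof.
rewrite /wterm dotZl dotZr mulrA dot_chaos; [|apply: Lambda_wedge; exact: (svalP p.2)|apply: Lambda_wedge; exact: (svalP q.2)].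
by rewrite Lambda_dot_wedge//; [exact: (svalP p.2)|exact: (svalP q.2)].
Qed.

Lemma bstar_wedge n z (Z : 'I_n -> mR -> R[i]) :
  bstar z (wedge Z) = chaos (wedge (fcons z Z)).
Proof. by rewrite /bstar /hat antisymmetrization_tensor_wedge. Qed.

Lemma L2fam_lift_subproof n (Z : L2fam n.+1) i : forall j, L2half (sval Z (lift i j)).
Proof. by move=> j; exact: (svalP Z). Qed.
Definition L2fam_lift n (Z : L2fam n.+1) i : L2fam n := exist _ _ (L2fam_lift_subproof Z i).

Lemma L2fam_cons_subproof n z (sz : L2half z) (Z : L2fam n) : forall i, L2half (fcons z (sval Z) i).
Proof. by apply: fcons_L2 => //; exact: (svalP Z). Qed.
Definition L2fam_cons n z (sz : L2half z) (Z : L2fam n) : L2fam n.+1 :=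
  exist _ _ (L2fam_cons_subproof sz Z).

Lemma hnorm2_le (V W : preHilbertType R) (x y : V) (w : W) (c : R) :
  dot x x = c%:C * dot y y - dot w w -> hnorm x ^+ 2 <= c * hnorm y ^+ 2.
Proof.
move=> E; have xE := hnorm2 x; have yE := hnorm2 y; have w0 := Re_dot_ge0 w.
rewrite xE yE E; move: w0; case: (dot w w) => a b /= a0.
by case: (dot y y) => p q /=; rewrite mul0r subr0 lerBlDr lerDl.
Qed.

(* The positive term discarded here is the squared norm of b(z) x. *)
Lemma bstar_span n z (sz : L2half z) (r : seq (R[i] * L2fam n)) :
  hnorm (\sum_(p <- r) wterm (p.1, L2fam_cons sz p.2)) ^+ 2 <=
  hz z * hnorm (\sum_(p <- r) wterm p) ^+ 2.
Proof.
case: n r => [|n] r.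
  apply: (@hnorm2_le _ _ _ _ (0 : fock R)); rewrite dot0r subr0.
  rewrite !dot_suml mulr_sumr; apply: eq_bigr => p _.
  rewrite !dot_sumr mulr_sumr; apply: eq_bigr => q _.
  rewrite !dot_wterm/= det_gram_fcons0 det_mx00 halfdot_self.
  by rewrite mulr1 mulrC.
pose A (p : R[i] * L2fam n.+1) := \sum_(i < n.+1)
  wterm (p.1 * ((-1) ^+ i * halfdot z (sval p.2 i)), L2fam_lift p.2 i).
apply: (@hnorm2_le _ _ _ _ (\sum_(p <- r) A p)).
rewrite !dot_suml mulr_sumr -sumrB; apply: eq_bigr => p _.
rewrite !dot_sumr mulr_sumr -sumrB; apply: eq_bigr => q _.
rewrite !dot_wterm/= det_gram_fcons -halfdot_self mulrBr; congr (_ - _).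
  by rewrite mulrCA.
rewrite /A dot_suml mulr_sumr; apply: eq_bigr => i _.
rewrite dot_sumr mulr_sumr; apply: eq_bigr => j _.
rewrite dot_wterm (halfdotC (svalP p.2 i) sz).
move: (halfdot z (sval p.2 i)) (halfdot z (sval q.2 j)) => x y.
rewrite /= !rmorphM/= rmorph_sign exprD.
have gen (a b c d e f g : R[i]) :
  a * c * (f * g * (b * e) * d) = a * (f * b) * (c * (g * e)) * d by ring.
exact: gen.
Qed.

Definition wspan n : set (fock R) :=
  [set x | exists r : seq (R[i] * L2fam n), x = \sum_(p <- r) wterm p].

Lemma subspace_wspan n : subspace (wspan n).
Proof.
split; first by exists [::]; rewrite big_nil.
move=> a _ _ [r ->] [r' ->]; exists ([seq (a * p.1, p.2) | p <- r] ++ r').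
rewrite big_cat/= big_map scaler_sumr; congr (_ + _); apply: eq_bigr => p _.
by rewrite /wterm scalerA.
Qed.

Lemma chaos_wspan n (f : n.-tuple mR -> R[i]) : Lambda f -> adherence (wspan n) (chaos f).
Proof.
apply: chaos_dense; first by apply: adherence_closed; exact: subspace_wspan.
move=> A mA Aoo; apply: sub_adherence.
have sA i : L2half (ind (A i) : mR -> R[i]) by exact: L2half_ind.
by exists [:: (1, exist _ _ sA)]; rewrite big_seq1 /wterm scale1r.
Qed.

(** The sharp constant holds on combinations of wedges and extends by density: the error of the
    approximation is multiplied by the crude constant of the same degree, hence still tends to 0. *)
Lemma bstar_bounded n z (w : n.-tuple mR -> R[i]) : L2half z -> Lambda w ->
  hnorm (bstar z w) <= Num.sqrt (hz z) * hnorm (chaos w).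
Proof.
move=> sz Lw; rewrite -subr_le0.
apply: (@le_small _ _ (Num.sqrt (hz z) + Num.sqrt (n.+1%:R * hz z))) => e e0.
have [_ [r ->] hr] := chaos_wspan Lw e0.
pose v t := \sum_(p <- r) p.1 * wedge (sval p.2) t.
have Lp (p : R[i] * L2fam n) : Lambda (fun t => p.1 * wedge (sval p.2) t).
  by apply: LambdaZ; apply: Lambda_wedge; exact: (svalP p.2).
have Lv : Lambda v by exact: Lambda_sum.
have vE : \sum_(p <- r) wterm p = chaos v.
  rewrite chaos_sum//; apply: eq_bigr => p _.
  by rewrite chaosZ//; apply: Lambda_wedge; exact: (svalP p.2).
have bvE : bstar z v = \sum_(p <- r) wterm (p.1, L2fam_cons sz p.2).
  rewrite /bstar /v (_ : tensor z _ = fun t => \sum_(p <- r) p.1 * tensor z (wedge (sval p.2)) t).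
    have sT (p : R[i] * L2fam n) : L2n (tensor z (wedge (sval p.2))).
      by apply: L2n_tensor => //; case: (Lambda_wedge (svalP p.2)).
    by rewrite hat_sum//; apply: eq_bigr => p _; rewrite /wterm -bstar_wedge.
  by apply/funext => t; rewrite /tensor mulr_sumr; apply: eq_bigr => p _; rewrite mulrCA.
have h1 : hnorm (bstar z v) <= Num.sqrt (hz z) * hnorm (chaos v).
  have h0 := bstar_span sz r; rewrite vE -bvE in h0.
  by apply: le_sqrt_mul h0; [exact: hz_ge0|exact: hnorm_ge0|exact: hnorm_ge0].
have Ld : Lambda (fun t => -1 * v t + w t) by exact: Lambda_linear.
have h2 : hnorm (bstar z (fun t => -1 * v t + w t)) <=
    Num.sqrt (n.+1%:R * hz z) * hnorm (chaos (fun t => -1 * v t + w t)).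
  have h0 := bstar_crude sz Ld; have hn : 0 <= n.+1%:R * hz z by rewrite mulr_ge0// hz_ge0.
  by apply: le_sqrt_mul h0; [exact: hn|exact: hnorm_ge0|exact: hnorm_ge0].
rewrite vE in hr; move: h2; rewrite bstar_linear// chaos_linear// !scaleN1r.
rewrite [- bstar z v + _]addrC [- chaos v + _]addrC.
rewrite [hnorm (chaos w - _)]hnormBC => h2.
have h3 := hnorm_triangle (bstar z w - bstar z v) (bstar z v); rewrite subrK in h3.
have h4 := hnorm_triangle (chaos v - chaos w) (chaos w); rewrite subrK in h4.
have [a0 b0] := (sqrtr_ge0 (hz z), sqrtr_ge0 (n.+1%:R * hz z)).
exact: (bound_of_approximation h1 h2 h3 h4 hr a0 b0).
Qed.

Lemma creationP z : L2half z -> bounded_operator (creation z) /\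
  forall n (w : n.-tuple mR -> R[i]), Lambda w -> creation z (chaos w) = bstar z w.
Proof.
move=> sz; have [|n a f g Lf Lg|n f Lf|m n f g mn|T [bT TE]] :=
    @graded_extension R (fun n => bstar z) (Num.sqrt (hz z)).
- exact: sqrtr_ge0.
- exact: bstar_linear.
- exact: bstar_bounded.
- by apply: dot_chaos_neq; rewrite eqSS.
- exact: (@xgetPex _ 0 [set T | bounded_operator T /\
    forall n (w : n.-tuple mR -> R[i]), Lambda w ->
      T (chaos w) = chaos (antisymmetrization (tensor z w))])
    (ex_intro _ T (conj bT TE)).
Qed.

End creation.

Section adjoint_relations.
Variables (R : realType) (H : hilbertType R).

Lemma adjoint_anticommute (A B A' B' : H -> H) : is_adjoint A A' -> is_adjoint B B' ->
  (forall x, A (B x) = - B (A x)) -> forall x, A' (B' x) = - B' (A' x).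
Proof.
move=> a b AB x; apply: eq_dot => y.
by rewrite dotNr -a -b -b -a AB dotNl opprK.
Qed.

Lemma adjoint_comp (A B A' B' : H -> H) : is_adjoint A A' -> is_adjoint B B' ->
  is_adjoint (A \o B) (B' \o A').
Proof. by move=> a b x y; rewrite /= a b. Qed.

Lemma bounded_anticommutator (S T : H -> H) : bounded_operator S ->
  bounded_operator T -> bounded_operator ((S \o T) + (T \o S)).
Proof. by move=> bS bT; apply: bounded_add; apply: bounded_comp. Qed.

End adjoint_relations.

Opaque fock.

(** * Anticommutation relations and parity *)

Section anticommutation.
Variable R : realType.
Local Notation mR := (measurableTypeR R).
Local Notation leb := (@lebesgue_measure R).
Local Notation nleb := (nlebesgue R).
Implicit Types z f g : mR -> R[i].

Lemma fcons_lift0 n z (Z : 'I_n -> mR -> R[i]) :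
  (fun j => fcons z Z (lift ord0 j)) = Z.
Proof. by apply/funext => j; rewrite fconsS. Qed.

Lemma fcons_lift n z (Z : 'I_n.+1 -> mR -> R[i]) i :
  (fun j => fcons z Z (lift (lift ord0 i) j)) = fcons z (fun j => Z (lift i j)).
Proof.
apply/funext => j; case: (unliftP ord0 j) => [k ->|->].
  rewrite fconsS; have -> : lift (lift ord0 i) (lift ord0 k) = lift ord0 (lift i k) :> 'I_n.+2.
    by apply/val_inj; rewrite /= /bump/= !add1n ltnS; case: leqP; rewrite ?addSn ?addnS.
  by rewrite fconsS.
by have -> : lift (lift ord0 i) ord0 = ord0 :> 'I_n.+2; [apply/val_inj|rewrite !fcons0].
Qed.

Lemma creation_bounded z : L2half z -> bounded_operator (creation z).
Proof. by case/creationP. Qed.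

Lemma creation_linear z : L2half z -> linear (creation z).
Proof. by case/creation_bounded. Qed.

Lemma creation_wedge n z (Z : 'I_n -> mR -> R[i]) : L2half z -> (forall i, L2half (Z i)) ->
  creation z (chaos (wedge Z)) = chaos (wedge (fcons z Z)).
Proof.
by move=> sz sZ; case: (creationP sz) => _ ->; [exact: bstar_wedge|exact: Lambda_wedge].
Qed.

Lemma annihilation_bounded z : L2half z -> bounded_operator (annihilation z).
Proof. by move=> /creation_bounded /adjointP[]. Qed.

Lemma annihilation_linear z : L2half z -> linear (annihilation z).
Proof. by case/annihilation_bounded. Qed.

Lemma annihilation_adjoint z : L2half z -> is_adjoint (creation z) (annihilation z).
Proof. by move=> /creation_bounded /adjointP[]. Qed.

(** Only the adjoint property is known of [annihilation]. Pairing with wedges, which are total,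
    reduces the formula to the row expansion of a Gram determinant. *)
Lemma annihilation_wedge n g (Z : 'I_n.+1 -> mR -> R[i]) : L2half g -> (forall i, L2half (Z i)) ->
  annihilation g (chaos (wedge Z)) =
  \sum_(i < n.+1) ((-1) ^+ i * halfdot g (Z i)) *: chaos (wedge (fun j => Z (lift i j))).
Proof.
move=> sg sZ; apply/eqP; rewrite -subr_eq0; apply/eqP; apply: fock_wedge_dot0 => m W sW.
rewrite dotBr -annihilation_adjoint// creation_wedge//.
have [mn|mn] := eqVneq m n; last first.
  rewrite dot_chaos_neq ?eqSS// sub0r; apply/eqP; rewrite oppr_eq0; apply/eqP.
  by rewrite dot_sumr big1// => i _; rewrite dotZr dot_chaos_neq ?mulr0.
move: mn W sW => -> W sW {m}.
rewrite dot_chaos; [|apply: Lambda_wedge; exact: fcons_L2|exact: Lambda_wedge].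
rewrite Lambda_dot_wedge//; last exact: fcons_L2.
rewrite det_gram_fcons_row dot_sumr -sumrB big1// => i _.
rewrite dotZr dot_chaos; [|exact: Lambda_wedge|exact: Lambda_wedge].
by rewrite Lambda_dot_wedge// subrr.
Qed.

Lemma annihilation_wedge0 g (Z : 'I_0 -> mR -> R[i]) : L2half g ->
  annihilation g (chaos (wedge Z)) = 0.
Proof.
move=> sg; apply: fock_wedge_dot0 => m W sW.
by rewrite -annihilation_adjoint// creation_wedge// dot_chaos_neq.
Qed.

(** The two Slater matrices differ by the exchange of their first two rows. *)
Lemma wedge_swap n f g (Z : 'I_n -> mR -> R[i]) :
  wedge (fcons f (fcons g Z)) = fun t => -1 * wedge (fcons g (fcons f Z)) t.
Proof.
apply/funext => t; rewrite !wedge_det mulrCA; congr (_ * _).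
pose i1 : 'I_n.+2 := ord0; pose i2 : 'I_n.+2 := lift ord0 ord0.
have -> : (\matrix_(i, j) fcons f (fcons g Z) i (tnth t j)) =
    row_perm (tperm i1 i2) (\matrix_(i, j) fcons g (fcons f Z) i (tnth t j)).
  apply/matrixP => i j; rewrite !mxE.
  suff -> : fcons f (fcons g Z) i = fcons g (fcons f Z) (tperm i1 i2 i) by [].
  case: (unliftP ord0 i) => [k ->|->]; last first.
    by rewrite tpermL fcons0 /i2 fconsS fcons0.
  case: (unliftP ord0 k) => [l ->|->]; last by rewrite -/i2 tpermR fcons0 fconsS fcons0.
  rewrite tpermD; first by rewrite !fconsS.
    by [].
  by rewrite /i2 -val_eqE.
by rewrite row_permE det_mulmx det_perm odd_tperm.
Qed.

Lemma creation_anticomm f g x : L2half f -> L2half g ->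
  creation f (creation g x) = - creation g (creation f x).
Proof.
move=> sf sg; have bf := creation_bounded sf; have bg := creation_bounded sg.
have E : (creation f \o creation g) + (creation g \o creation f) = 0.
  apply: fock_wedge_ext; [exact: bounded_anticommutator|exact: bounded_zero|].
  move=> n Z sZ; rewrite -[LHS]/(creation f (creation g _) + creation g (creation f _)).
  rewrite -[RHS]/(0 : fock R) !creation_wedge//; try exact: fcons_L2.
  rewrite (wedge_swap f g) chaosZ ?scaleN1r ?addNr//; apply: Lambda_wedge.
  by do 2!apply: fcons_L2 => //.
have := congr1 (fun T => T x) E; rewrite -[LHS]/(creation f (creation g x) + creation g (creation f x)).
by rewrite -[RHS]/(0 : fock R) => /eqP; rewrite addr_eq0 => /eqP.
Qed.

Lemma annihilation_anticomm f g x : L2half f -> L2half g ->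
  annihilation f (annihilation g x) = - annihilation g (annihilation f x).
Proof.
move=> sf sg.
apply: (adjoint_anticommute (annihilation_adjoint sf) (annihilation_adjoint sg)).
by move=> y; exact: creation_anticomm.
Qed.

(** On a wedge, removing the created factor yields the scalar term. Every other term carries one
    sign more than its counterpart with the two operators exchanged, so these cancel in the
    anticommutator. *)
Lemma annihilation_creation f g x : L2half f -> L2half g ->
  annihilation f (creation g x) = halfdot f g *: x - creation g (annihilation f x).
Proof.
move=> sf sg; have bf := annihilation_bounded sf; have bg := creation_bounded sg.
have E : (annihilation f \o creation g) + (creation g \o annihilation f) = halfdot f g *: id.
  apply: fock_wedge_ext; first exact: bounded_anticommutator.
    by apply: bounded_scale; exact: bounded_id.
  move=> n Z sZ; rewrite -[LHS]/(annihilation f (creation g _) + creation g (annihilation f _)).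
  rewrite -[RHS]/(halfdot f g *: chaos (wedge Z)) creation_wedge// annihilation_wedge//; last exact: fcons_L2.
  rewrite big_ord_recl expr0 mul1r fcons0 fcons_lift0 -addrA -[RHS]addr0; congr (_ + _).
  case: n Z sZ => [|n] Z sZ.
    by rewrite big_ord0 annihilation_wedge0// (lin0 (creation_linear sg)) addr0.
  rewrite annihilation_wedge// (lin_sum (creation_linear sg)) -big_split big1// => i _.
  rewrite (linZ (creation_linear sg)) creation_wedge//.
  rewrite /= fcons_lift fconsS -scalerDl.
  by rewrite /bump/= add1n exprS mulN1r mulNr addNr scale0r.
have := congr1 (fun T => T x) E.
rewrite -[LHS]/(annihilation f (creation g x) + creation g (annihilation f x)).
by rewrite -[RHS]/(halfdot f g *: x) => <-; rewrite addrK.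
Qed.

Lemma vacuumE : vacuum R = chaos (wedge (fun i : 'I_0 => fun=> 0)).
Proof.
rewrite /vacuum; congr chaos; apply/funext => t.
by rewrite wedge_det det_mx00 fact0 invr1 mulr1.
Qed.

Lemma annihilation_vacuum g : L2half g -> annihilation g (vacuum R) = 0.
Proof. by move=> sg; rewrite vacuumE annihilation_wedge0. Qed.

Lemma L2half_conj z : L2half z -> L2half (fun t => (z t)^*%C).
Proof. exact: L2_conj. Qed.

Lemma Psi_bounded z : L2half z -> bounded_operator (Psi z).
Proof.
move=> sz; apply: bounded_add; first exact: creation_bounded.
by apply: annihilation_bounded; exact: L2half_conj.
Qed.

Lemma PsiE z x : Psi z x = creation z x + annihilation (fun t => (z t)^*%C) x.
Proof. by []. Qed.

(** [Psi z] contains b(conj z), so the pairing that has to vanish is the one of [g] with the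
    conjugate of [z]. *)
Lemma Psi_creation_anticomm z g x : L2half z -> L2half g ->
  halfdot (fun t => (z t)^*%C) g = 0 ->
  Psi z (creation g x) = - creation g (Psi z x).
Proof.
move=> sz sg zg; rewrite !PsiE annihilation_creation//; last exact: L2half_conj.
rewrite zg scale0r sub0r creation_anticomm// (linD (creation_linear sg)) opprD//.
Qed.

Lemma Psi_annihilation_anticomm z g x : L2half z -> L2half g ->
  halfdot g z = 0 ->
  Psi z (annihilation g x) = - annihilation g (Psi z x).
Proof.
move=> sz sg zg; rewrite !PsiE (linD (annihilation_linear sg)) annihilation_creation//.
rewrite zg scale0r sub0r annihilation_anticomm//; last exact: L2half_conj.
by rewrite opprD opprK.
Qed.

Section parity.

(** Parity is the second quantization of -1. It anticommutes with the fields, and its product with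
    b(g) turns anticommutation into commutation, the relation that passes to generated von Neumann
    algebras. *)
Lemma parity_exists : exists th : fock R -> fock R, bounded_operator th /\
  forall n (f : n.-tuple mR -> R[i]), Lambda f -> th (chaos f) = (-1) ^+ n *: chaos f.
Proof.
apply: (@graded_extension R (fun n (f : n.-tuple mR -> R[i]) => (-1) ^+ n *: chaos f) (1 : R)).
- by [].
- move=> n a f g Lf Lg; rewrite chaos_linear// scalerDr !scalerA; congr (_ *: _ + _).
  by rewrite mulrC.
- move=> n f Lf; rewrite hnormZ mul1r.
  suff -> : normc ((-1) ^+ n : R[i]) = 1 by rewrite mul1r.
  rewrite -signr_odd; case: (odd n); rewrite ?expr1 ?expr0 ?normcN; exact: normc1.
- by move=> m n f g mn; rewrite dotZl dotZr dot_chaos_neq// !mulr0.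
Qed.

Definition parity : fock R -> fock R := sval (cid parity_exists).

Lemma parity_bounded : bounded_operator parity.
Proof. by case: (svalP (cid parity_exists)). Qed.

Lemma parity_chaos n (f : n.-tuple mR -> R[i]) : Lambda f ->
  parity (chaos f) = (-1) ^+ n *: chaos f.
Proof. by case: (svalP (cid parity_exists)) => _; apply. Qed.

Lemma parityK : involutive parity.
Proof.
have E : parity \o parity = id.
  apply: fock_wedge_ext => [||n Z sZ].
  - by apply: bounded_comp; exact: parity_bounded.
  - exact: bounded_id.
  rewrite /= parity_chaos; last exact: Lambda_wedge.
  rewrite (linZ (proj1 parity_bounded)) parity_chaos; last exact: Lambda_wedge.
  by rewrite scalerA -expr2 sqrr_sign scale1r.
by move=> x; have := congr1 (fun T => T x) E.
Qed.

Lemma parity_creation z x : L2half z -> parity (creation z x) = - creation z (parity x).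
Proof.
move=> sz; have bth := parity_bounded; have bz := creation_bounded sz.
have E : parity \o creation z = (-1) *: (creation z \o parity).
  apply: fock_wedge_ext => [||n Z sZ].
  - exact: bounded_comp.
  - by apply: bounded_scale; exact: bounded_comp.
  rewrite -[RHS]/(-1 *: creation z (parity (chaos (wedge Z)))) /= creation_wedge//.
  rewrite !parity_chaos; [|exact: Lambda_wedge|apply: Lambda_wedge; exact: fcons_L2].
  rewrite (linZ (creation_linear sz)) creation_wedge// scalerA; congr (_ *: _).
  by rewrite exprS.
have := congr1 (fun T => T x) E.
by rewrite -[RHS]/(-1 *: creation z (parity x)) scaleN1r.
Qed.

Lemma parity_adjoint : is_adjoint parity parity.
Proof.
have [S [bS thS]] := adjoint_exists parity_bounded.
suff E : S = parity by rewrite -{2}E.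
apply: (fock_wedge_ext bS parity_bounded) => n Z sZ.
apply/eqP; rewrite -subr_eq0; apply/eqP; apply: fock_wedge_dot0 => m W sW.
rewrite dotBr -thS !parity_chaos; [|exact: Lambda_wedge..].
rewrite dotZl dotZr; have [mn|mn] := eqVneq m n; last by rewrite dot_chaos_neq// !mulr0 subrr.
by rewrite rmorphXn rmorphN1; apply/eqP; rewrite subr_eq0; apply/eqP; congr (_ ^+ _ * _).
Qed.

Lemma parity_annihilation z x : L2half z ->
  parity (annihilation z x) = - annihilation z (parity x).
Proof.
move=> sz; apply: (adjoint_anticommute parity_adjoint (annihilation_adjoint sz)).
by move=> y; exact: parity_creation.
Qed.

Lemma parity_Psi z x : L2half z -> parity (Psi z x) = - Psi z (parity x).
Proof.
move=> sz; rewrite !PsiE (linD (proj1 parity_bounded)) parity_creation//.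
by rewrite parity_annihilation ?opprD//; exact: L2half_conj.
Qed.

Lemma parity_vacuum : parity (vacuum R) = vacuum R.
Proof.
rewrite vacuumE parity_chaos ?expr0 ?scale1r//.
by apply: Lambda_wedge => -[].
Qed.

End parity.

(* The operators b(g) and b(g)^* times the parity commute with the fields
   Psi z for z orthogonal to g, hence with the von Neumann algebra they generate. *)
Lemma annihilation_generated (S : set (mR -> R[i])) g : L2half g ->
  (forall z, S z -> [/\ L2half z, halfdot g z = 0 & halfdot (fun t => (z t)^*%C) g = 0]) ->
  forall u, generated_von_neumann [set Psi z | z in S] u -> annihilation g (u (vacuum R)) = 0.
Proof.
move=> sg hS u Su.
have ba := annihilation_bounded sg; have bc := creation_bounded sg.
have bth := parity_bounded; have adj := annihilation_adjoint sg.
pose T1 := annihilation g \o parity; pose T2 := parity \o creation g.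
(* The commutant of a set closed under adjoints is a von Neumann algebra; [T1] alone would not do,
   but [T1] and [T2] are adjoint to each other. *)
pose M := commutant [set T | T = T1 \/ T = T2].
have bT1 : bounded_operator T1 by exact: bounded_comp.
have bT2 : bounded_operator T2 by exact: bounded_comp.
have a12 : is_adjoint T1 T2.
  exact: (adjoint_comp (is_adjoint_sym adj) parity_adjoint).
have vM : von_neumann_algebra M.
  apply: commutant_von_neumann => [T [->|->]//|T [->|->]].
    by exists T2; [right|].
  by exists T1; [left|exact: is_adjoint_sym].
have SM : [set Psi z | z in S] `<=` M.
  move=> _ [z Sz <-]; have [sz gz zg] := hS _ Sz; split; first exact: Psi_bounded.
  move=> T [->|->]; apply/funext => x; rewrite /T1 /T2 /=.
    by rewrite Psi_annihilation_anticomm// parity_Psi// (linN (annihilation_linear sg)).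
    have th0 := linN (proj1 parity_bounded).
  rewrite -[RHS]opprK -th0 -Psi_creation_anticomm// parity_Psi// opprK.
  by [].
have [bu cu] := generated_von_neumann_sub vM SM Su.
(* [u] commutes with [T1], and [T1] kills the vacuum, which is fixed by the parity. *)
have E : T1 (u (vacuum R)) = 0.
  have := congr1 (fun T => T (vacuum R)) (cu T1 (or_introl erefl)) => /= <-.
  rewrite /T1 /= parity_vacuum annihilation_vacuum//; case: bu => lu _.
  by rewrite (lin0 lu).
have : parity (annihilation g (u (vacuum R))) = 0.
  by rewrite parity_annihilation// -[annihilation g (parity _)]/(T1 _) E oppr0.
by move=> /(congr1 parity); rewrite parityK => ->; rewrite (lin0 (proj1 parity_bounded)).
Qed.

End anticommutation.

Opaque creation annihilation.

Lemma adjoint_sub (R : realType) (H : hilbertType R) (A B C A' B' C' : H -> H) :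
  is_adjoint A A' -> is_adjoint B B' -> is_adjoint C C' ->
  (forall x, A x - B x = C x) -> forall y, A' y - B' y = C' y.
Proof.
move=> a b c ABC y; apply: eq_dot => x.
by rewrite dotBr -a -b -c -ABC dotBl.
Qed.

(** * The Clifford algebra in standard form *)

Section isometries.
Variables (R : realType) (V : preHilbertType R) (H : hilbertType R).

(** The closed predicate through which identities between inner products are checked on a total set
    only; [b = 0] covers the vanishing of a pairing. *)
Lemma closed_dot_eq (T : V -> H) (a : H) (b : V) : bounded_map T ->
  closed_subspace [set x | dot a (T x) = dot b x].
Proof.
move=> [lT [c Tc]]; split; first split.
- by rewrite /= lin0// !dot0r.
- by move=> k u v /= uE vE; rewrite lT !dotDr !dotZr uE vE.
- move=> x l h xl; have /hcvgP xTl := hcvg_map lT Tc xl; move/hcvgP : xl => xl.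
  apply/eqP; rewrite /= -subr_eq0; apply/eqP/eq0_normc/eqP; rewrite eq_le normc_ge0 andbT.
  apply: (@le_small _ _ (hnorm a + hnorm b)) => e e0.
  have [[N HN] [M HM]] := (xTl _ e0, xl _ e0).
  pose k := maxn N M.
  have -> : dot a (T l) - dot b l = dot b (x k - l) - dot a (T (x k) - T l).
    by rewrite !dotBr (h k); move: (dot _ _) (dot _ _) (dot _ _) => p q r; ring.
  have t1 (p q : R[i]) : normc (p - q) <= normc p + normc q.
    by rewrite (le_trans (le_normcD _ _))// normcN.
  rewrite (le_trans (t1 _ _))// mulrDl addrC.
  apply: lerD; apply: le_trans (normc_dot_le _ _) _.
    by rewrite ler_wpM2l ?hnorm_ge0// ltW// HN// leq_maxl.
  by rewrite ler_wpM2l ?hnorm_ge0// ltW// HM// leq_maxr.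
Qed.

End isometries.

Section isometric_extension.
Variables (R : realType) (V : preHilbertType R) (H : hilbertType R).
Variable T : completion V -> H.
Hypothesis bT : bounded_map T.
Hypothesis iT : forall u v, dot (T (emb u)) (T (emb v)) = dot u v.

(** The arguments are extended one at a time, since each extension is a closed linear condition on a
    single argument. *)
Lemma isometric_extension x y : dot (T x) (T y) = dot x y.
Proof.
have h1 v z : dot (T (emb v)) (T z) = dot (emb v) z.
  apply: (closed_subspace_emb (closed_dot_eq (T (emb v)) (emb v) bT)) => u.
  by rewrite /= iT dot_emb.
apply: (closed_subspace_emb (closed_dot_eq (T x) x bT)) => v.
by rewrite /= dotC h1 -dotC.
Qed.

Lemma isometric_hnorm x : hnorm (T x) = hnorm x.
Proof. by rewrite /hnorm isometric_extension. Qed.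

Lemma isometric_inj : injective T.
Proof.
move=> x y xy; apply/eqP; rewrite -subr_eq0; apply/eqP/hnorm_eq0.
by rewrite -isometric_hnorm (linB (proj1 bT)) xy subrr hnorm0.
Qed.

(** Preimages of a convergent sequence form a Cauchy sequence because [T] preserves distances, and
    the completion contains their limit. *)
Lemma isometric_range_closed : closed_subspace (range T).
Proof.
have lT := proj1 bT; split; first split.
- by exists 0 => //; rewrite lin0.
- by move=> a _ _ [u _ <-] [v _ <-]; exists (a *: u + v); rewrite // lT.
- move=> y l hy yl; have /choice[x xy] : forall k, exists x, T x = y k.
    by move=> k; have [x _ <-] := hy k; exists x.
  have cx : hcauchy x.
    move=> e e0; have [N HN] := hcvg_cauchy yl e0; exists N => m n Nm Nn.
    by rewrite -isometric_hnorm (linB lT) !xy; exact: HN.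
  have [z xz] : exists z : completion V, hcvg x z by exact: hcomplete.
  exists z => //; apply: (@hcvg_unique _ _ y) => //.
  have [c Tc] := proj2 bT.
  by have := hcvg_map lT Tc xz; rewrite (_ : T \o x = y)//; apply/funext.
Qed.

End isometric_extension.

Section clifford_standard_form.
Variable R : realType.
Local Notation mR := (measurableTypeR R).
Local Notation leb := (@lebesgue_measure R).
Local Notation Omega := (vacuum R).
Local Notation G := (@gns_unitary R).

Lemma clifford_mem (u : clifford R) : clifford_algebra u.
Proof. by case: u => u /= /asboolP. Qed.

Definition mk_clifford (u : fock R -> fock R) (Cu : clifford_algebra u) : clifford R :=
  Clifford (introT (asboolP _) Cu).

Lemma clifford_bounded (u : fock R -> fock R) : clifford_algebra u -> bounded_operator u.
Proof.
apply: generated_von_neumann_bounded => _ [z sz <-]; exact: Psi_bounded.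
Qed.

Lemma gnsP : bounded_operator G /\ forall u : clifford R, G (emb u) = u Omega.
Proof.
pose T (u : clifford R) : fock R := u Omega.
have bT : bounded_map T.
  by split=> //; exists 1 => x; rewrite mul1r.
have [T' [bT' T'E]] := completion_extend bT.
exact: (@xgetPex _ 0 [set U | bounded_operator U /\
  forall u : clifford R, U (emb u) = u Omega]) (ex_intro _ T' (conj bT' T'E)).
Qed.

Lemma gns_bounded : bounded_operator G. Proof. exact: (proj1 gnsP). Qed.

Lemma gns_linear : linear G. Proof. exact: (proj1 gns_bounded). Qed.

Lemma gns_emb (u : clifford R) : G (emb u) = u Omega. Proof. exact: (proj2 gnsP). Qed.

Lemma gns_dot x y : dot (G x) (G y) = dot x y.
Proof. by apply: isometric_extension gns_bounded _ _ _ => u v; rewrite !gns_emb. Qed.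

Lemma gns_hnorm x : hnorm (G x) = hnorm x.
Proof. by rewrite /hnorm gns_dot. Qed.

Lemma gns_inj : injective G.
Proof. by apply: isometric_inj gns_bounded _ => u v; rewrite !gns_emb. Qed.

Definition cyclic : set (fock R) :=
  [set y | exists2 u : fock R -> fock R, clifford_algebra u & u Omega = y].

Lemma subspace_cyclic : subspace cyclic.
Proof.
split; first by exists 0; [exact: generated_von_neumann0|].
move=> a _ _ [u Cu <-] [v Cv <-]; exists (a *: u + v) => //.
exact: generated_von_neumann_linear.
Qed.

Lemma clifford_Psi z : L2half z -> clifford_algebra (@Psi R z).
Proof. by move=> sz; apply: sub_generated_von_neumann; exists z. Qed.

Lemma cyclic_Psi z y : L2half z -> cyclic y -> cyclic (Psi z y).
Proof.
move=> sz [u Cu <-]; exists (Psi z \o u) => //.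
by apply: generated_von_neumann_comp => //; exact: clifford_Psi.
Qed.

Lemma fcons_eta n (Z : 'I_n.+1 -> mR -> R[i]) :
  Z = fcons (Z ord0) (fun i => Z (lift ord0 i)).
Proof.
apply/funext => i; case: (unliftP ord0 i) => [j ->|->]; first by rewrite fconsS.
by rewrite fcons0.
Qed.

(* e(z, Z) = Psi z e(Z) - b(conj z) e(Z), and the last term has two fewer factors. *)
Lemma cyclic_wedge n (Z : 'I_n -> mR -> R[i]) : (forall i, L2half (Z i)) ->
  cyclic (chaos (wedge Z)).
Proof.
have step m (W : 'I_m.+1 -> mR -> R[i]) : (forall i, L2half (W i)) ->
    chaos (wedge W) = Psi (W ord0) (chaos (wedge (fun i => W (lift ord0 i)))) -
      annihilation (fun t => (W ord0 t)^*%C) (chaos (wedge (fun i => W (lift ord0 i)))).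
  by move=> sW; rewrite PsiE addrK creation_wedge// -fcons_eta.
(* Two consecutive degrees are carried along: a wedge is reduced both to one factor less and,
   through annihilation, to two factors less. *)
suff : (forall Z : 'I_n -> mR -> R[i], (forall i, L2half (Z i)) -> cyclic (chaos (wedge Z))) /\
   (forall Z : 'I_n.+1 -> mR -> R[i], (forall i, L2half (Z i)) -> cyclic (chaos (wedge Z))).
  by case=> h _; exact: h.
elim: n {Z} => [|n [IH0 IH1]].
  have c0 (Z : 'I_0 -> mR -> R[i]) : cyclic (chaos (wedge Z)).
    exists id; first exact: generated_von_neumann_id.
    by rewrite vacuumE; congr (chaos (wedge _)); apply/funext => -[].
  split=> // Z sZ; rewrite step// annihilation_wedge0 ?subr0; last exact: L2half_conj.
  exact: cyclic_Psi.
split=> // Z sZ; rewrite step// annihilation_wedge//; last exact: L2half_conj.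
apply: subspaceB; first exact: subspace_cyclic.
  by apply: cyclic_Psi => //; exact: IH1.
apply: subspace_sum => [|i _]; first exact: subspace_cyclic.
by apply: subspaceZ; [exact: subspace_cyclic|exact: IH0].
Qed.

(** The vacuum is cyclic, so the range contains the total set of wedges, and the range of an
    isometry is closed. This is what makes the choice in the definition of [Jn] succeed. *)
Lemma gns_surj y : exists x, G x = y.
Proof.
suff : range G y by case=> x _ <-; exists x.
move: y; apply: fock_wedge_ind.
  by apply: isometric_range_closed gns_bounded _ => u v; rewrite !gns_emb.
move=> n A mA Aoo; have sA i : L2half (ind (A i) : mR -> R[i]) by exact: L2half_ind.
have [u Cu uE] := cyclic_wedge sA.
by exists (emb (mk_clifford Cu)); rewrite // gns_emb.
Qed.

Lemma gns_Jn n (f : n.-tuple mR -> R[i]) : G (Jn f) = chaos f.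
Proof.
have [x xE] := gns_surj (chaos f).
exact: (@xgetPex _ 0 [set xi | G xi = chaos f]) (ex_intro _ x xE).
Qed.

Section left_multiplication.
Variable x : fock R -> fock R.
Hypothesis Cx : clifford_algebra x.

Let mul (v : clifford R) : clifford R :=
  mk_clifford (generated_von_neumann_comp Cx (clifford_mem v)).

Lemma left_actionP : bounded_operator (left_action x) /\
  forall u v : clifford R, x \o u = v -> left_action x (emb u) = emb v.
Proof.
pose T (v : clifford R) : L2C R := emb (mul v).
have [lx [c xc]] := clifford_bounded Cx.
have bT : bounded_map T.
  split=> [a u v|].
    rewrite /T -linearP; congr emb; apply/val_inj/funext => y.
    rewrite -[LHS]/(x ((a *: u + v : clifford R) y)).
    rewrite -[RHS]/(a *: x (u y) + x (v y)) -lx.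
    by [].
  by exists c => v; rewrite /T hnorm_emb; exact: xc.
have [T' [bT' T'E]] := completion_extend bT.
apply: (@xgetPex _ 0 [set T | bounded_operator T /\
  forall u v : clifford R, x \o u = v -> T (emb u) = emb v]).
exists T'; split=> // u v uv; rewrite T'E /T; congr emb; exact/val_inj.
Qed.

(** Carries the module structure over to the Fock space, where the increments of the field process
    are sums of creation and annihilation operators. *)
Lemma gns_left_action xi : G (left_action x xi) = x (G xi).
Proof.
have [bL LE] := left_actionP; have bx := clifford_bounded Cx.
have [lL [c Lc]] := bL; have [lG [d Gd]] := gns_bounded; have [lx [k xk]] := bx.
have b1 : bounded_map (G \o left_action x).
  split=> [a u v|]; first by rewrite /= lL lG.
  by exists c => y; rewrite [hnorm _]gns_hnorm; exact: Lc.
have b2 : bounded_map (x \o G).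
  split=> [a u v|]; first by rewrite /= lG lx.
  by exists k => y /=; rewrite (le_trans (xk _))// gns_hnorm.
have := completion_ext b1 b2; move=> /(_ _)/(congr1 (fun T => T xi)); apply => v /=.
by rewrite (LE _ (mul v))// !gns_emb.
Qed.

End left_multiplication.

Lemma filtration_adherence t :
  L2C_filtration t = adherence [set emb u | u in [set u : clifford R | clifford_filtration t u]].
Proof.
apply/seteqP; split=> xi.
  move=> [u [Cu /hcvgP uxi]] e e0; have [N HN] := uxi _ e0.
  exists (emb (u N)); first by exists (u N) => //; exact: Cu.
  by apply: HN.
move=> /adherence_hcvg[x hx xxi].
have /choice[u Hu] : forall k, exists u : clifford R, clifford_filtration t u /\ emb u = x k.
  by move=> k; have [u Cu <-] := hx k; exists u.
exists u; split=> [k|]; first by case: (Hu k).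
by rewrite (_ : (fun k => _) = x)//; apply/funext => k; case: (Hu k).
Qed.

Lemma filtration_closed t : closed_subspace (@L2C_filtration R t).
Proof.
rewrite filtration_adherence; apply: adherence_closed; split.
  by exists 0; [exact: generated_von_neumann0|exact: raddf0].
move=> a _ _ [u Cu <-] [v Cv <-]; exists (a *: u + v); last exact: linearP.
exact: generated_von_neumann_linear.
Qed.

Lemma filtration_mono s t : s <= t -> @L2C_filtration R s `<=` L2C_filtration t.
Proof.
move=> st xi [u [Cu uxi]]; exists u; split=> // k M [vM SM].
apply: (Cu k); split=> // _ [z [sz hz] <-]; apply: SM; exists z => //; split=> //.
apply: filterS hz => x /= hz hx tx; apply: hz => //; exact: le_lt_trans tx.
Qed.

(** Open at [a] and closed at [b], as the difference of the indicators of the closed intervals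
    [0, b] and [0, a] that define the field process. *)
Definition incr (a b : R) : mR -> R[i] := ind `]a, b]%classic.

Lemma L2half_incr a b : L2half (incr a b).
Proof.
apply: L2half_ind; first exact: measurable_itv.
by rewrite lebesgue_measure_itv/=; case: ifP => _; rewrite ?ltry// -EFinD ltry.
Qed.

Lemma halfdot_incr_supported a b z : L2half z ->
  {ae leb, forall s, half_line s -> a < s -> z s = 0} ->
  halfdot (incr a b) z = 0.
Proof.
move=> sz hz; have mH := @measurable_half_line R.
rewrite /halfdot (@cintegral_ae _ _ _ _ _ mH _ (fun=> 0)) ?cintegral0//.
  exact: cintegrable_measurable (cintegrable_dot mH (L2half_incr a b) sz).
apply: filterS hz => s hz hs; have [as_|sa] := ltP a s; first by rewrite hz// mulr0.
rewrite /incr ind_notin ?conjc0 ?mul0r// => /=.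
by rewrite in_itv/= ltNge sa.
Qed.

Lemma annihilation_filtration a b xi : L2C_filtration a xi ->
  annihilation (incr a b) (G xi) = 0.
Proof.
move=> Fxi; have sg := L2half_incr a b; have bA := annihilation_bounded sg.
have cM : closed_subspace [set xi | annihilation (incr a b) (G xi) = 0].
  have [lA [c Ac]] := bA; have bAG : bounded_map (annihilation (incr a b) \o G).
    split=> [k u v|]; first by rewrite /= gns_linear lA.
    by exists c => y /=; rewrite (le_trans (Ac _))// gns_hnorm.
  have b0 : bounded_map (fun _ : L2C R => 0 : fock R).
    split=> [k u v|]; first by rewrite scaler0 addr0.
    by exists 0 => y; rewrite hnorm0 mul0r.
  exact: (closed_subspace_eq bAG b0).
move: Fxi => [u [Cu uxi]]; have [_ cl] := cM; apply: cl uxi => k /=.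
rewrite gns_emb; apply: (annihilation_generated sg _ (Cu k)) => z [sz hz]; split=> //.
  exact: halfdot_incr_supported.
rewrite halfdotC//; last exact: L2half_conj.
rewrite halfdot_incr_supported ?conjc0//; first exact: L2half_conj.
by apply: filterS hz => s hz hs as_; rewrite hz// conjc0.
Qed.

(** Creation operators are chosen for each function separately, so their additivity in [z] has to be
    read off on wedges. *)
Lemma creation_sub (z z' : mR -> R[i]) y : L2half z -> L2half z' ->
  creation z y - creation z' y = creation (fun t => -1 * z' t + z t) y.
Proof.
move=> sz sz'; have mH := @measurable_half_line R.
have sd : L2half (fun t => -1 * z' t + z t).
  by apply: square_integrableD => //; apply: square_integrableZ.
have E : creation z + (-1) *: creation z' = creation (fun t => -1 * z' t + z t).
  apply: fock_wedge_ext => [||n Z sZ].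
  - apply: bounded_add; first exact: creation_bounded.
    by apply: bounded_scale; exact: creation_bounded.
  - exact: creation_bounded.
  rewrite -[LHS]/(creation z (chaos (wedge Z)) + -1 *: creation z' (chaos (wedge Z))).
  have LZ := Lambda_wedge sZ; have [sw _] := LZ.
  rewrite (proj2 (creationP sz))// (proj2 (creationP sz'))// (proj2 (creationP sd))//.
  rewrite /bstar addrC -hat_linear; [|exact: L2n_tensor..].
  by congr hat; apply/funext => t; rewrite /tensor mulrDl mulrA.
by rewrite -E -[RHS]/(creation z y + -1 *: creation z' y) scaleN1r.
Qed.

(** Adjoints are unique, so the relation between creation operators can be transposed. *)
Lemma annihilation_sub (z z' : mR -> R[i]) y : L2half z -> L2half z' ->
  annihilation z y - annihilation z' y = annihilation (fun t => -1 * z' t + z t) y.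
Proof.
move=> sz sz'; have mH := @measurable_half_line R.
have sd : L2half (fun t => -1 * z' t + z t).
  by apply: square_integrableD => //; apply: square_integrableZ.
have E := fun x => creation_sub x sz sz'; move: (fun t => _) sd E => w sw E.
exact: (adjoint_sub (annihilation_adjoint sz) (annihilation_adjoint sz')
  (annihilation_adjoint sw) E).
Qed.

Lemma step_ind (t : R) : (fun s : mR => if 0 <= s <= t then 1 else 0) = ind `[0, t]%classic :> (mR -> R[i]).
Proof.
apply/funext => s; rewrite /ind indicE; case: ifPn => h; first by rewrite mem_set//= in_itv.
by rewrite memNset//= in_itv/=; exact/negP.
Qed.

Lemma L2half_step (t : R) : L2half (ind `[0, t]%classic : mR -> R[i]).
Proof.
apply: L2half_ind; first exact: measurable_itv.
by rewrite lebesgue_measure_itv/=; case: ifP => _; rewrite ?ltry// -EFinD ltry.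
Qed.

Lemma step_sub (s t : R) : 0 <= s -> s <= t ->
  (fun x => -1 * ind `[0, s]%classic x + ind `[0, t]%classic x) = incr s t :> (mR -> R[i]).
Proof.
move=> s0 st; apply/funext => x; rewrite /incr mulN1r.
have [xs|xs] := leP x s.
  rewrite [X in _ = X]ind_notin; last by rewrite /= in_itv/= ltNge xs.
  have [x0|x0] := leP 0 x.
    rewrite !ind_in ?addNr//= in_itv/= ?x0 ?xs// (le_trans xs)//.
  by rewrite !ind_notin ?oppr0 ?addr0//= in_itv/= leNgt x0.
rewrite [X in - X]ind_notin; last by rewrite /= in_itv/= [x <= s]leNgt xs andbF.
rewrite oppr0 add0r; have [xt|xt] := leP x t.
  by rewrite !ind_in//= in_itv/= ?xs ?xt// andbT (le_trans s0)// ltW.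
by rewrite !ind_notin//= in_itv/= [x <= t]leNgt xt andbF.
Qed.

Lemma Psi_increment (s t : R) y : 0 <= s -> s <= t ->
  (Psi_process t - Psi_process s) y = creation (incr s t) y + annihilation (incr s t) y.
Proof.
move=> s0 st; rewrite -[LHS]/(Psi_process t y - Psi_process s y) /Psi_process !step_ind !PsiE.
have cE (r : R) : (fun x => (ind `[0, r]%classic x)^*%C) = ind `[0, r]%classic :> (mR -> R[i]).
  by apply/funext => x; rewrite /ind conjc_real.
rewrite !cE opprD addrACA creation_sub ?annihilation_sub; try exact: L2half_step.
by rewrite step_sub.
Qed.

Lemma clifford_increment (s t : R) : clifford_algebra (Psi_process t - Psi_process s).
Proof.
rewrite -scaleN1r addrC; apply: generated_von_neumann_linear;
  rewrite /Psi_process step_ind; apply: clifford_Psi; exact: L2half_step.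
Qed.

Lemma gns_increment (s t : R) xi : 0 <= s -> s <= t -> L2C_filtration s xi ->
  G (left_action (Psi_process t - Psi_process s) xi) = creation (incr s t) (G xi).
Proof.
move=> s0 st Fxi; rewrite gns_left_action; last exact: clifford_increment.
by rewrite Psi_increment// annihilation_filtration ?addr0.
Qed.

End clifford_standard_form.

(** * Hilbert space valued functions *)

Section lower_integral.
Context d (T : measurableType d) (R : realType).
Variable mu : {measure set T -> \bar R}.
Variables (D : set T) (mD : measurable D).
Local Open Scope ereal_scope.

(* The integral of a non-measurable function is its lower integral. *)
Lemma le_lower_integral (f g : T -> \bar R) : (forall x, D x -> 0 <= f x) ->
  (forall x, D x -> f x <= g x) ->
  \int[mu]_(x in D) f x <= \int[mu]_(x in D) g x.
Proof.
move=> f0 fg; rewrite !(integral_mkcond D).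
have f0' x : 0 <= (f \_ D) x by exact: erestrict_ge0.
have g0' x : 0 <= (g \_ D) x.
  by apply: erestrict_ge0 => t /[dup] Dt /fg; apply: le_trans; exact: f0.
rewrite !ge0_integralTE//; apply: le_ereal_sup => _ [h hf <-]; exists h => // x.
by rewrite (le_trans (hf x))//; exact: lee_restrict.
Qed.

(** Only [p] may fail to be measurable. The positive part of f - q is measurable and lies below [p],
    so its integral is at most the lower integral of [p]. *)
Lemma lower_integral_leD (f q : T -> R) (p : T -> R) :
  measurable_fun D f -> measurable_fun D q ->
  (forall x, D x -> (0 <= f x)%R) -> (forall x, D x -> (0 <= p x)%R) ->
  (forall x, D x -> (0 <= q x)%R) -> (forall x, D x -> (f x <= p x + q x)%R) ->
  \int[mu]_(x in D) (f x)%:E <= \int[mu]_(x in D) (p x)%:E + \int[mu]_(x in D) (q x)%:E.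
Proof.
move=> mf mq f0 p0 q0 fpq.
pose r x := Num.max (f x - q x)%R 0%R.
have mr : measurable_fun D r.
  by apply: measurable_maxr; [exact: measurable_funB|exact: measurable_cst].
have r0 x : (0 <= r x)%R by rewrite le_max lexx orbT.
apply: (@le_trans _ _ (\int[mu]_(x in D) ((r x)%:E + (q x)%:E))).
  apply: ge0_le_integral => //.
  - exact/measurable_EFinP.
  - by apply/measurable_EFinP; exact: measurable_funD.
  - move=> x Dx; rewrite lee_fin -lerBlDr; by rewrite le_max lexx.
have r0' x : D x -> 0 <= (r x)%:E by move=> _; rewrite lee_fin.
have q0' x : D x -> 0 <= (q x)%:E by move=> Dx; rewrite lee_fin q0.
have mr' : measurable_fun D (fun x => (r x)%:E) by exact/measurable_EFinP.
have mq' : measurable_fun D (fun x => (q x)%:E) by exact/measurable_EFinP.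
rewrite (ge0_integralD mu mD r0' mr' q0' mq').
rewrite leeD2r//; apply: le_lower_integral => x Dx; rewrite lee_fin//.
by rewrite ge_max p0// andbT lerBlDr fpq.
Qed.

End lower_integral.

Section complex_integral_bounds.
Context d (T : measurableType d) (R : realType).
Variable mu : {measure set T -> \bar R}.
Variables (D : set T) (mD : measurable D).

Lemma normc_le_ReIm (a : R[i]) : normc a <= `|complex.Re a| + `|complex.Im a|.
Proof.
have h (x y : R) : 0 <= x -> 0 <= y -> x ^+ 2 + y ^+ 2 <= (x + y) ^+ 2 by nra.
rewrite -(@ler_pXn2r _ 2%N)// ?nnegrE ?normc_ge0 ?addr_ge0//.
rewrite (normc2 a) -(real_normK (num_real (complex.Re a))).
by rewrite -(real_normK (num_real (complex.Im a))); exact: h.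
Qed.

Lemma ReB (a b : R[i]) : complex.Re (a - b) = complex.Re a - complex.Re b.
Proof. by case: a b => ? ? []. Qed.

Lemma ImB (a b : R[i]) : complex.Im (a - b) = complex.Im a - complex.Im b.
Proof. by case: a b => ? ? []. Qed.

Lemma cmeasurable_cvg (f : nat -> T -> R[i]) l :
  (forall k, cmeasurable D (f k)) ->
  (forall t, D t -> forall e : R, 0 < e -> exists N, forall k, (N <= k)%N ->
    normc (f k t - l t) < e) -> cmeasurable D l.
Proof.
move=> mf fl; split.
  apply: (measurable_fun_cvg (fun k => proj1 (mf k))) => t Dt.
  apply/cvgrPdist_lt => e e0; have [N HN] := fl t Dt e e0; exists N => // k Nk.
  have := HN k Nk; apply: le_lt_trans; rewrite /= distrC -ReB; exact: normc_Re.
apply: (measurable_fun_cvg (fun k => proj2 (mf k))) => t Dt.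
apply/cvgrPdist_lt => e e0; have [N HN] := fl t Dt e e0; exists N => // k Nk.
have := HN k Nk; apply: le_lt_trans; rewrite /= distrC -ImB; exact: normc_Im.
Qed.

Lemma measurable_normc (f : T -> R[i]) : cmeasurable D f -> measurable_fun D (fun x => normc (f x)).
Proof.
move=> mf; apply: (eq_measurable_fun (fun x => Num.sqrt (normc (f x) ^+ 2))).
  by move=> x _; rewrite sqrtr_sqr ger0_norm// normc_ge0.
apply: measurableT_comp; last exact: measurable_normc2.
apply: continuous_measurable_fun; exact: sqrt_continuous.
Qed.

Lemma cintegrable_bounded f : cmeasurable D f ->
  (\int[mu]_(x in D) (normc (f x))%:E < +oo)%E -> cintegrable mu D f.
Proof.
move=> mf fo; have mn := measurable_normc mf; split; apply/integrableP; split.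
- by apply/measurable_EFinP; case: mf.
- apply: le_lt_trans fo; apply: ge0_le_integral => //.
  + by apply/measurable_EFinP; apply: measurableT_comp => //; case: mf.
  + exact/measurable_EFinP.
  + by move=> x _; rewrite lee_fin normc_Re.
- by apply/measurable_EFinP; case: mf.
- apply: le_lt_trans fo; apply: ge0_le_integral => //.
  + by apply/measurable_EFinP; apply: measurableT_comp => //; case: mf.
  + exact/measurable_EFinP.
  + by move=> x _; rewrite lee_fin normc_Im.
Qed.

Lemma integrable_normc f : cintegrable mu D f ->
  mu.-integrable D (fun x => (normc (f x))%:E).
Proof.
move=> fi; have mf := cintegrable_measurable fi; case: fi => fr fi.
apply: (le_integrable mD (f := fun x => (normc (f x))%:E)
  (g := fun x => (`|complex.Re (f x)|%:E + `|complex.Im (f x)|%:E)%E)).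
- by apply/measurable_EFinP; exact: measurable_normc.
- move=> x _; rewrite /= lee_fin ger0_norm ?normc_ge0// ger0_norm ?addr_ge0//.
  exact: normc_le_ReIm.
- by apply: integrableD => //; [exact: integrable_abse fr|exact: integrable_abse fi].
Qed.

(** Real and imaginary parts are bounded separately, whence the factor 2; the constants in
    [bochner_dot_cvg] allow for it. *)
Lemma normc_cintegral f c : cintegrable mu D f ->
  (\int[mu]_(x in D) (normc (f x))%:E <= c%:E)%E -> normc (cintegral mu D f) <= 2 * c.
Proof.
move=> fi fc; have ni := integrable_normc fi; case: fi => fr fi.
have fc' : (\int[mu]_(x in D) normc (f x))%R <= c.
  by rewrite -lee_fin fineK//; exact: integrable_fin_num.
rewrite (le_trans (normc_le_ReIm _))//= mulr2n mulrDl mul1r lerD//.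
  apply: le_trans (le_normr_Rintegral mD fr) _; apply: le_trans fc'.
  by apply: le_Rintegral => //[|x _]; [exact: integrable_abse fr|exact: normc_Re].
apply: le_trans (le_normr_Rintegral mD fi) _; apply: le_trans fc'.
by apply: le_Rintegral => //[|x _]; [exact: integrable_abse fi|exact: normc_Im].
Qed.

Lemma cintegrableB f g : cintegrable mu D f -> cintegrable mu D g ->
  cintegrable mu D (fun x => f x - g x).
Proof.
move=> fi gi; have := cintegrableD mD fi (cintegrableZ mD (-1) gi).
by congr (cintegrable _ _ _); apply/funext => x; rewrite mulN1r.
Qed.

Lemma cintegralB f g : cintegrable mu D f -> cintegrable mu D g ->
  cintegral mu D (fun x => f x - g x) = cintegral mu D f - cintegral mu D g.
Proof.
move=> fi gi; have gi' := cintegrableZ mD (-1) gi.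
rewrite -[in RHS]mulN1r -(cintegralZ mD _ gi) -(cintegralD mD fi gi').
by congr (cintegral _ _ _); apply/funext => x; rewrite mulN1r.
Qed.

End complex_integral_bounds.

Section bochner_measurability.
Variables (R : realType) (H : hilbertType R).
Local Notation mR := (measurableTypeR R).
Local Notation leb := (@lebesgue_measure R).
Variables (D : set mR) (mD : measurable D).
Implicit Types f u v s : mR -> H.

Definition weakly_measurable f := forall y, cmeasurable D (fun t => dot (f t) y).

Lemma cmeasurable_dot_simple f s : weakly_measurable f -> simple_function s ->
  cmeasurable D (fun t => dot (f t) (s t)).
Proof.
move=> wf [n [A [x [mA ->]]]].
rewrite (_ : (fun t => _) = (fun t => \sum_(i < n) ind (A i) t * dot (f t) (x i))).
  by apply: cmeasurable_sum => // i; apply: cmeasurableM => //; exact: cmeasurable_ind.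
by apply/funext => t; rewrite dot_sumr; apply: eq_bigr => i _; rewrite dotZr.
Qed.

Lemma cmeasurable_dot f u : weakly_measurable f -> strongly_measurable D u ->
  cmeasurable D (fun t => dot (f t) (u t)).
Proof.
move=> wf [s ss su]; apply: (cmeasurable_cvg (fun k => cmeasurable_dot_simple wf (ss k))).
move=> t Dt e e0; have d0 : 0 < hnorm (f t) + 1 by rewrite ltr_wpDl ?hnorm_ge0.
have /hcvgP/(_ (e / (hnorm (f t) + 1))) := su t Dt.
rewrite divr_gt0// => /(_ isT)[N HN]; exists N => k Nk; have := HN k Nk.
rewrite -dotBr ltr_pdivlMr// => h; apply: le_lt_trans (normc_dot_le _ _) _.
apply: le_lt_trans h; rewrite mulrC ler_wpM2l ?hnorm_ge0//.
by rewrite lerDl.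
Qed.

Lemma strongly_weakly_measurable u : strongly_measurable D u -> weakly_measurable u.
Proof.
move=> su y; have wy : weakly_measurable (fun=> y) by move=> z; exact: cmeasurable_cst.
rewrite (_ : (fun t => _) = (fun t => (dot y (u t))^*%C)).
  by apply: cmeasurable_conj; exact: cmeasurable_dot.
by apply/funext => t; rewrite dotC.
Qed.

Lemma measurable_hnorm2 u : strongly_measurable D u ->
  measurable_fun D (fun t => hnorm (u t) ^+ 2).
Proof.
move=> su; have [+ _] := cmeasurable_dot (strongly_weakly_measurable su) su.
by apply: eq_measurable_fun => t _; rewrite -hnorm2.
Qed.

Lemma simple_function_linear (a : R[i]) (s s' : mR -> H) :
  simple_function s -> simple_function s' -> simple_function (fun t => a *: s t + s' t).
Proof.
move=> [n [A [x [mA ->]]]] [m [B [y [mB ->]]]].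
exists (n + m)%N, (fun i : 'I_(n + m) => match fintype.split i with inl j => A j | inr j => B j end).
exists (fun i : 'I_(n + m) => match fintype.split i with inl j => a *: x j | inr j => y j end); split.
  by move=> i; case: fintype.split.
apply/funext => t; rewrite big_split_ord/= scaler_sumr; congr (_ + _).
  apply: eq_bigr => i _; rewrite (unsplitK (inl i : 'I_n + 'I_m)%type) !scalerA.
  by rewrite mulrC.
by apply: eq_bigr => i _; rewrite (unsplitK (inr i : 'I_n + 'I_m)%type).
Qed.

Lemma simple_function_cst0 : simple_function (fun _ : mR => 0 : H).
Proof.
exists 0%N, (fun=> set0), (fun=> 0); split=> [//|].
by apply/funext => t; rewrite big_ord0.
Qed.

Lemma simple_function_ind (A : set mR) (x : H) : measurable A ->
  simple_function (fun t => ind A t *: x).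
Proof.
move=> mA; exists 1%N, (fun=> A), (fun=> x); split=> //.
by apply/funext => t; rewrite big_ord1.
Qed.

Lemma simple_function_sum I (r : seq I) (s : I -> mR -> H) :
  (forall i, simple_function (s i)) -> simple_function (fun t => \sum_(i <- r) s i t).
Proof.
move=> ss; elim: r => [|i r IH].
  by under eq_fun do rewrite big_nil; exact: simple_function_cst0.
rewrite (_ : (fun t => _) = (fun t => 1 *: s i t + \sum_(j <- r) s j t)).
  exact: simple_function_linear.
by apply/funext => t; rewrite big_cons scale1r.
Qed.

Lemma simple_function_restrict (A : set mR) s : measurable A -> simple_function s ->
  simple_function (fun t => ind A t *: s t).
Proof.
move=> mA [n [B [x [mB ->]]]]; exists n, (fun i => A `&` B i), x; split.
  by move=> i; exact: measurableI.
apply/funext => t; rewrite scaler_sumr; apply: eq_bigr => i _; rewrite scalerA.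
by rewrite /ind -rmorphM/= !indicE in_setI; case: (t \in A); case: (t \in B i);
  rewrite ?mul1r ?mul0r.
Qed.

Lemma simple_strongly_measurable s : simple_function s -> strongly_measurable D s.
Proof. by move=> ss; exists (fun=> s) => // t _; exact: hcvg_cst. Qed.

Lemma strongly_measurableB u v : strongly_measurable D u -> strongly_measurable D v ->
  strongly_measurable D (fun t => u t - v t).
Proof.
move=> [s ss su] [s' ss' sv]; exists (fun k t => (-1) *: s' k t + s k t).
  by move=> k; exact: simple_function_linear.
move=> t Dt; have := su t Dt; have := sv t Dt => /hcvgP vt /hcvgP ut.
apply/hcvgP => e e0; have e2 : 0 < e / 2 by rewrite divr_gt0.
have [[N HN] [M HM]] := (vt _ e2, ut _ e2); exists (maxn N M) => k.
rewrite geq_max => /andP[Nk Mk].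
rewrite (_ : _ - _ = (v t - s' k t) + (s k t - u t)); last first.
  by rewrite scaleN1r opprB addrACA [- _ + _]addrC.
rewrite (le_lt_trans (hnorm_triangle _ _))// [ltRHS]splitr ltrD ?HM// hnormBC.
exact: HN.
Qed.

Lemma dot_AMGM (x y : H) (c : R) : 0 < c ->
  normc (dot x y) <= (c * hnorm x ^+ 2 + c^-1 * hnorm y ^+ 2) / 2.
Proof.
move=> c0; apply: le_trans (normc_dot_le _ _) _.
move: (hnorm x) (hnorm y) => a b; rewrite -subr_ge0.
suff -> : (c * a ^+ 2 + c^-1 * b ^+ 2) / 2 - a * b = c^-1 * (c * a - b) ^+ 2 / 2.
  by rewrite divr_ge0// mulr_ge0 ?sqr_ge0// invr_ge0 ltW.
by field; rewrite gt_eqF.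
Qed.

End bochner_measurability.

Lemma ereal_cvg0P (R : realType) (a : nat -> \bar R) : (forall k, (0 <= a k)%E) ->
  a k @[k --> \oo] --> 0%E <->
  forall e : R, 0 < e -> exists N, forall k, (N <= k)%N -> (a k <= e%:E)%E.
Proof.
move=> a0; split.
  move=> /fine_cvgP[[M _ HM] /cvgrPdist_le h] e e0; have [N _ HN] := h e e0.
  exists (maxn M N) => k; rewrite geq_max => /andP[Mk Nk].
  have fk := HM k Mk; rewrite -(fineK fk) lee_fin.
  have := HN k Nk; rewrite /= sub0r normrN ger0_norm//.
  exact: fine_ge0.
move=> h; apply/fine_cvgP; split.
  have [N HN] := h 1 ltr01; exists N => // k Nk.
  by rewrite ge0_fin_numE//; apply: le_lt_trans (HN k Nk) _; rewrite ltry.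
apply/cvgrPdist_le => e e0; have [N HN] := h e e0; exists N => // k Nk.
rewrite /= sub0r normrN ger0_norm; last exact: fine_ge0.
rewrite -lee_fin fineK; first exact: HN.
by rewrite ge0_fin_numE//; apply: le_lt_trans (HN k Nk) _; rewrite ltry.
Qed.

Section bochner_limit.
Variables (R : realType) (H : hilbertType R).
Local Notation mR := (measurableTypeR R).
Local Notation leb := (@lebesgue_measure R).
Variables (D : set mR) (mD : measurable D).

Lemma cintegrable_bochner (G u : mR -> H) : bochner_L2 D G -> bochner_L2 D u ->
  cintegrable leb D (fun t => dot (G t) (u t)).
Proof.
move=> [sG Goo] [su uoo].
have md := cmeasurable_dot (strongly_weakly_measurable sG) su.
have [mG mu] := (measurable_hnorm2 sG, measurable_hnorm2 su).
apply: cintegrable_bounded => //.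
apply: (@le_lt_trans _ _ (\int[leb]_(t in D) ((hnorm (G t) ^+ 2)%:E + (hnorm (u t) ^+ 2)%:E))%E).
  apply: ge0_le_integral => //.
  - by move=> t _; rewrite lee_fin normc_ge0.
  - by apply/measurable_EFinP; exact: measurable_normc.
  - by apply/measurable_EFinP; exact: measurable_funD.
  move=> t _; rewrite -EFinD lee_fin; apply: le_trans (dot_AMGM _ _ ltr01) _.
  have := sqr_ge0 (hnorm (G t)); have := sqr_ge0 (hnorm (u t)).
  rewrite invr1 !mul1r; move: (_ ^+ 2) (_ ^+ 2) => a b; lra.
rewrite ge0_integralD//; first by rewrite lte_add_pinfty.
- by move=> t _; rewrite lee_fin sqr_ge0.
- exact/measurable_EFinP.
- by move=> t _; rewrite lee_fin sqr_ge0.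
- exact/measurable_EFinP.
Qed.

(** The parameter [c] decouples the two kinds of terms: a large [c] makes the contribution of the
    fixed vectors [G] and [u] small, while the factor (1 + c) / 2 stands in front of differences
    that tend to 0. *)
Lemma dot_perturbation (G u g h : H) (c : R) : 0 < c ->
  normc (dot g h - dot G u) <= (1 + c) / 2 * (hnorm (g - G) ^+ 2 + hnorm (h - u) ^+ 2) +
    (hnorm G ^+ 2 + hnorm u ^+ 2) / (2 * c).
Proof.
move=> c0.
have -> : dot g h - dot G u = dot (g - G) (h - u) + (dot (g - G) u + dot G (h - u)).
  rewrite !dotBr !dotBl; move: (dot _ _) (dot _ _) (dot _ _) (dot _ _) => p q r s.
  by ring.
have n3 (p q r : R[i]) : normc (p + (q + r)) <= normc p + (normc q + normc r).
  by rewrite (le_trans (le_normcD _ _))// lerD2l le_normcD.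
apply: le_trans (n3 _ _ _) _.
have ic0 : 0 < c^-1 by rewrite invr_gt0.
have := dot_AMGM (g - G) (h - u) ltr01; have := dot_AMGM (g - G) u c0.
have := dot_AMGM G (h - u) ic0; rewrite invrK invr1 !mul1r invfM.
move: (hnorm _ ^+ 2) (hnorm _ ^+ 2) (hnorm _ ^+ 2) (hnorm _ ^+ 2) => a b p q.
by move: (normc _) (normc _) (normc _) (c^-1) => x y z w; lra.
Qed.

Let arith1 (a b x y z : R) : 0 < y -> 0 < z ->
  z * (a + (b + (2 * y * z)^-1 * x)) = z * (a + b) + x / (2 * y).
Proof. by move=> y0 z0; field; rewrite !gt_eqF. Qed.

Let arith2 (a e c C : R) : 0 < c -> 0 < C ->
  C * (e / (8 * C) + (e / (8 * C) + (2 * c * C)^-1 * a)) = e / 4 + a / c / 2.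
Proof. by move=> c0 C0; field; rewrite !gt_eqF. Qed.

Let arith3 (a b : R) : 0 <= a -> 0 < b -> a <= b / 2 * (1 + 2 * a / b).
Proof.
move=> a0 b0; suff -> : b / 2 * (1 + 2 * a / b) = b / 2 + a by lra.
by field; rewrite gt_eqF.
Qed.

Let arith4 (e x : R) : x <= e / 2 -> e / 4 + x / 2 <= e / 2.
Proof. lra. Qed.

(* The [Gk] are only weakly measurable, so the integral of [|Gk - G|^2] is a priori
   a lower integral. *)
Lemma bochner_dot_cvg (G u : mR -> H) Gk hk : bochner_L2 D G -> bochner_L2 D u ->
  (forall k, weakly_measurable D (Gk k)) -> (forall k, strongly_measurable D (hk k)) ->
  bochner_cvg D Gk G -> bochner_cvg D hk u ->
  forall e : R, 0 < e -> exists N, forall k, (N <= k)%N ->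
    normc (bochner_dot D (Gk k) (hk k) - bochner_dot D G u) <= e.
Proof.
move=> LG Lu wG sh cG ch e e0; have [[sG Goo] [su uoo]] := (LG, Lu).
have [mG mu] := (measurable_hnorm2 sG, measurable_hnorm2 su).
pose r t := hnorm (G t) ^+ 2 + hnorm (u t) ^+ 2.
have mr : measurable_fun D r by exact: measurable_funD.
have r0 t : 0 <= r t by rewrite addr_ge0 ?sqr_ge0.
have roo : (\int[leb]_(t in D) (r t)%:E < +oo)%E.
  under eq_integral do rewrite EFinD.
  rewrite ge0_integralD//; first by rewrite lte_add_pinfty.
  - by move=> t _; rewrite lee_fin sqr_ge0.
  - exact/measurable_EFinP.
  - by move=> t _; rewrite lee_fin sqr_ge0.
  - exact/measurable_EFinP.
have ir0 : (0 <= \int[leb]_(t in D) (r t)%:E)%E.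
  by apply: integral_ge0 => t _; rewrite lee_fin.
have rfin : (\int[leb]_(t in D) (r t)%:E)%E \is a fin_num by rewrite ge0_fin_numE.
pose A := fine (\int[leb]_(t in D) (r t)%:E)%E.
have A0 : 0 <= A by exact: fine_ge0.
(* With this [c] the fixed term of [dot_perturbation] integrates to A / (2 c) <= e / 4. The two
   differences, each below e / (8 C), contribute another e / 4 after multiplication by [C], and the
   factor 2 of [normc_cintegral] then gives [e]. *)
pose c := 1 + 2 * A / e.
have c0 : 0 < c by rewrite ltr_pwDl// divr_ge0 ?mulr_ge0// ltW.
pose C := (1 + c) / 2.
have C0 : 0 < C by apply: divr_gt0 => //; exact: addr_gt0 ltr01 c0.
have d0 : 0 < e / (8 * C) by apply: divr_gt0 => //; exact: mulr_gt0.
have [K KE K0] : exists2 K, K = (2 * c * C)^-1 & 0 < K.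
  eexists; first by [].
  by rewrite invr_gt0; apply: mulr_gt0 => //; exact: mulr_gt0.
have I0 f : (0 <= \int[leb]_(t in D) (hnorm (f t : H) ^+ 2)%:E)%E.
  by apply: integral_ge0 => t _; rewrite lee_fin sqr_ge0.
have [N HN] := (proj1 (ereal_cvg0P (fun k => I0 (fun t => Gk k t - G t))) cG) _ d0.
have [M HM] := (proj1 (ereal_cvg0P (fun k => I0 (fun t => hk k t - u t))) ch) _ d0.
exists (maxn N M) => k; rewrite geq_max => /andP[Nk Mk].
pose f t := normc (dot (Gk k t) (hk k t) - dot (G t) (u t)).
have iGu := cintegrable_bochner LG Lu.
have mGh := cmeasurable_dot (wG k) (sh k).
have md : cmeasurable D (fun t => dot (Gk k t) (hk k t) - dot (G t) (u t)).
  have := cmeasurableD mGh (cmeasurableZ (-1) (cintegrable_measurable iGu)).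
  by congr cmeasurable; apply/funext => t; rewrite mulN1r.
have mf : measurable_fun D f by exact: measurable_normc.
pose q t := hnorm (hk k t - u t) ^+ 2.
have mq : measurable_fun D q.
  by apply: measurable_hnorm2 => //; exact: strongly_measurableB.
(* The estimate is divided by [C] so that the term that may be non-measurable has coefficient one,
   and no scaling of its lower integral is called for. *)
have fle : (\int[leb]_(t in D) (C^-1 * f t)%:E <=
    (e / (8 * C))%:E + ((e / (8 * C))%:E + (K * A)%:E))%E.
  apply: le_trans (lower_integral_leD leb mD (f := fun t => C^-1 * f t)
    (p := fun t => hnorm (Gk k t - G t) ^+ 2)
    (q := fun t => q t + K * r t) _ _ _ _ _ _) _.
  - exact: measurable_funM.
  - by apply: measurable_funD => //; exact: measurable_funM.
  - by move=> t _; rewrite mulr_ge0 ?invr_ge0 ?normc_ge0// ltW.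
  - by move=> t _; exact: sqr_ge0.
  - by move=> t _; rewrite addr_ge0 ?sqr_ge0//; apply: mulr_ge0 => //; exact: ltW.
  - move=> t _; rewrite ler_pdivrMl//; apply: le_trans (dot_perturbation _ _ _ _ c0) _.
    rewrite -/(q t) -/(r t) -/C.
    suff -> : C * (hnorm (Gk k t - G t) ^+ 2 + (q t + K * r t)) =
      C * (hnorm (Gk k t - G t) ^+ 2 + q t) + r t / (2 * c) by [].
    rewrite KE; exact: arith1.
  apply: leeD; first exact: HN.
  under eq_integral do rewrite EFinD.
  rewrite ge0_integralD//; last 4 first.
  - by move=> t _; rewrite lee_fin sqr_ge0.
  - exact/measurable_EFinP.
  - by move=> t _; rewrite lee_fin; apply: mulr_ge0 => //; exact: ltW.
  - by apply/measurable_EFinP; exact: measurable_funM.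
  apply: leeD; first exact: HM.
  under eq_integral do rewrite EFinM.
  rewrite ge0_integralZl//.
  - by rewrite EFinM /A fineK.
  - exact/measurable_EFinP.
  - by move=> t _; rewrite lee_fin.
  - by rewrite lee_fin ltW.
have fe : (\int[leb]_(t in D) (f t)%:E <= (e / 2)%:E)%E.
  have -> : (\int[leb]_(t in D) (f t)%:E = C%:E * \int[leb]_(t in D) (C^-1 * f t)%:E)%E.
    under [in RHS]eq_integral do rewrite EFinM.
    rewrite ge0_integralZl//; first by rewrite muleA -EFinM mulfV ?gt_eqF// mul1e.
    - exact/measurable_EFinP.
    - by move=> t _; rewrite lee_fin normc_ge0.
    - by rewrite lee_fin invr_ge0 ltW.
  apply: le_trans (lee_wpmul2l _ fle) _; first by rewrite lee_fin ltW.
  rewrite -!EFinD -EFinM lee_fin.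
  have : A / c <= e / 2.
    rewrite ler_pdivrMr// /c.
    exact: arith3.
  by rewrite KE arith2//; exact: arith4.
have ih : cintegrable leb D (fun t => dot (Gk k t) (hk k t) - dot (G t) (u t)).
  by apply: cintegrable_bounded => //; apply: le_lt_trans fe _; rewrite ltry.
have ik : cintegrable leb D (fun t => dot (Gk k t) (hk k t)).
  have := cintegrableD mD ih iGu.
  by congr cintegrable; apply/funext => t; rewrite subrK.
rewrite /bochner_dot -(cintegralB mD ik iGu).
have := normc_cintegral mD ih fe.
by rewrite [2 * _]mulrC divfK.
Qed.

End bochner_limit.

Lemma dot_natl (R : realType) (V : preHilbertType R) n (x y : V) :
  dot (n%:R *: x) y = n%:R * dot x y.
Proof. by rewrite dotZl conjc_nat. Qed.

(** * The derivative *)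

Section integrable_sections.
Variable R : realType.
Local Notation mR := (measurableTypeR R).
Local Notation leb := (@lebesgue_measure R).
Local Notation nleb := (nlebesgue R).
Local Notation mH := (@measurable_half_line R).
Local Notation cint n := (cintegral (nleb n) (@orthant R n)).

Lemma integrable_fine d (T : measurableType d) (mu : {measure set T -> \bar R})
  (D : set T) (f : T -> \bar R) : measurable D -> mu.-integrable D f ->
  mu.-integrable D (EFin \o (fine \o f)).
Proof.
move=> mD fi; apply: (le_integrable mD _ _ fi).
  apply/measurable_EFinP; apply: measurableT_comp => //.
  exact: measurable_int fi.
by move=> x _ /=; case: (f x) => //=; rewrite normr0 leey.
Qed.

Lemma cintegrable_cons n (f : n.+1.-tuple mR -> R[i]) :
  cintegrable (nleb n.+1) (@orthant R n.+1) f ->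
  cintegrable leb (@half_line R) (fun x => cint n (fun t => f (tuple_cons (x, t)))).
Proof.
move=> [fr fi]; split.
  exact: (integrable_fine mH (integrable_integral_cons fr)).
exact: (integrable_fine mH (integrable_integral_cons fi)).
Qed.

Lemma closed_weakly_measurable (H : hilbertType R) (D : set mR) (f : mR -> H) :
  measurable D -> closed_subspace [set y | cmeasurable D (fun t => dot (f t) y)].
Proof.
move=> mD; split; first split.
- by rewrite /=; under eq_fun do rewrite dot0r; exact: cmeasurable_cst.
- move=> a u v mu mv; rewrite /=; under eq_fun do rewrite dotDr dotZr.
  by apply: cmeasurableD => //; exact: cmeasurableZ.
- move=> x l mx /hcvgP xl; apply: (cmeasurable_cvg mx) => t Dt e e0.
  have d0 : 0 < hnorm (f t) + 1 by rewrite ltr_wpDl ?hnorm_ge0.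
  have := xl (e / (hnorm (f t) + 1)).
  rewrite divr_gt0// => /(_ isT)[N HN]; exists N => k Nk; have := HN k Nk.
  rewrite -dotBr ltr_pdivlMr// => h; apply: le_lt_trans (normc_dot_le _ _) _.
  apply: le_lt_trans h; rewrite mulrC ler_wpM2l ?hnorm_ge0//.
  by rewrite lerDl.
Qed.

Lemma measurable_preimage (D : set mR) (f : mR -> \bar R) (Y : set (\bar R)) :
  measurable D -> measurable_fun D f -> measurable Y -> measurable (D `&` f @^-1` Y).
Proof. by move=> mD mf mY; exact: mf. Qed.

(** Reconciles the intervals [a, b[ of simple processes with the intervals ]a, b] of field
    increments; they differ by the end points only. *)
Lemma ind_co_oc (a b : R) : {ae leb, forall t : mR, ind `[a, b[%classic t = incr a b t :> R[i]}.
Proof.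
exists ([set a] `|` [set b]); split.
- by apply: measurableU; exact: measurable_set1.
- apply/eqP; rewrite eq_le measure_ge0 andbT.
  apply: le_trans (measureU2 _ _ _) _; [exact: measurable_set1..|].
  have h x : leb [set x] = 0%E := lebesgue_measure_set1 x.
  by rewrite -[X in (X <= _)%E]/(leb [set a] + leb [set b])%E !h adde0.
- move=> t /=; apply: contra_notP => /not_orP[ta tb].
  have na : (a == t) = false by apply/eqP => E; apply: ta.
  have nb : (t == b) = false by apply/eqP.
  by rewrite /incr /ind !indicE !mem_setE !in_itv/= !(le_eqVlt a) !(le_eqVlt t) na nb.
Qed.

Section sections.
Variables (n : nat) (v : n.+1.-tuple mR -> R[i]).
Local Notation sec t := (fun s => v (tuple_cons (t, s))).

Definition section_norm (t : mR) : \bar R :=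
  (\int[nleb n]_(s in @orthant R n) (normc (v (tuple_cons (t, s))) ^+ 2)%:E)%E.

(** Vanishes exactly when the section at time [t] is anti-symmetric under [r] almost everywhere.
    Written as an integral, this condition is measurable in [t] by Tonelli's theorem. *)
Definition section_defect (r : 'S_n) (t : mR) : \bar R :=
  (\int[nleb n]_(s in @orthant R n)
    (normc (v (tuple_cons (t, perm_tuple r s)) - (-1) ^+ r * v (tuple_cons (t, s))) ^+ 2)%:E)%E.

(* Since [chaos] vanishes off [Lambda], measurability of the derivative at every
   time needs the exact set of times at which the section lies in [Lambda]. *)
Definition good_section : set mR := [set t | half_line t /\ Lambda (sec t)].

(** Anti-symmetry of [v] passes to its sections through the permutations that fix the first
    variable. *)
Lemma lift_perm_tuple_cons (r : 'S_n) t s :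
  perm_tuple (lift_perm ord0 ord0 r) (tuple_cons (t, s)) = tuple_cons (t, @perm_tuple R n r s).
Proof.
apply: eq_from_tnth => i; rewrite tnth_mktuple; case: (unliftP ord0 i) => [j ->|->].
  by rewrite lift_perm_lift /tuple_cons !tnthS tnth_mktuple.
by rewrite lift_perm_id.
Qed.

Section measurability.
Hypothesis mv : cmeasurable (@orthant R n.+1) v.

Let mperm (r : 'S_n.+1) : cmeasurable (@orthant R n.+1)
  (fun s => v (perm_tuple r s) - (-1) ^+ r * v s).
Proof.
have mO := @measurable_orthant R n.+1.
have := cmeasurableD (cmeasurable_perm r mv) (cmeasurableZ (- (-1) ^+ r) mv).
by congr cmeasurable; apply/funext => s; rewrite mulNr.
Qed.

Let mdefect (r : 'S_n) : measurable_fun (@orthant R n.+1) (fun s : n.+1.-tuple mR =>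
  (normc (v (perm_tuple (lift_perm ord0 ord0 r) s) - (-1) ^+ r * v s) ^+ 2)%:E).
Proof.
apply/measurable_EFinP; apply: measurable_normc2.
by have := mperm (lift_perm ord0 ord0 r); rewrite odd_lift_perm.
Qed.

Lemma measurable_section_norm : measurable_fun (@half_line R) section_norm.
Proof.
apply: (measurable_ge0_integral_cons (f := fun s => (normc (v s) ^+ 2)%:E)).
  by apply/measurable_EFinP; exact: measurable_normc2.
by move=> s _; rewrite lee_fin sqr_ge0.
Qed.

Let defectE (r : 'S_n) : section_defect r = fun t => (\int[nleb n]_(s in @orthant R n)
  (normc (v (perm_tuple (lift_perm ord0 ord0 r) (tuple_cons (t, s))) -
    (-1) ^+ r * v (tuple_cons (t, s))) ^+ 2)%:E)%E.
Proof.
by apply/funext => t; apply: eq_integral => s _; rewrite lift_perm_tuple_cons.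
Qed.

Lemma measurable_section_defect r : measurable_fun (@half_line R) (section_defect r).
Proof.
rewrite defectE; apply: (measurable_ge0_integral_cons (mdefect r)).
by move=> s _; rewrite lee_fin sqr_ge0.
Qed.

Lemma cmeasurable_section t : half_line t -> cmeasurable (@orthant R n) (sec t).
Proof.
move=> ht; case: mv => mr mi; split.
  exact: (measurable_fun_cons ht mr).
exact: (measurable_fun_cons ht mi).
Qed.

Lemma good_sectionP t : half_line t -> good_section t <->
  (section_norm t < +oo)%E /\ forall r : 'S_n, section_defect r t = 0%E.
Proof.
move=> ht; have mO := @measurable_orthant R n; have [mr mi] := cmeasurable_section ht.
have md r : measurable_fun (@orthant R n) (fun s => (normc (v (tuple_cons (t, perm_tuple r s)) -
    (-1) ^+ r * v (tuple_cons (t, s))) ^+ 2)%:E).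
  have := measurable_fun_cons ht (mdefect r).
  by apply: eq_measurable_fun => s _; rewrite lift_perm_tuple_cons.
have aeP r : section_defect r t = 0%E <-> {ae nleb n, forall s, orthant s ->
    v (tuple_cons (t, perm_tuple r s)) = (-1) ^+ r * v (tuple_cons (t, s))}.
  have := ae_eq_integral_abs (nleb n) mO (md r).
  rewrite (_ : integral _ _ _ = section_defect r t); last first.
    by apply: eq_integral => s _; rewrite gee0_abs ?lee_fin ?sqr_ge0.
  move=> ->; split; apply: filterS => s h os.
    have := h os; rewrite /= => -[] /eqP; rewrite sqrf_eq0 => /eqP/eq0_normc/eqP.
    by rewrite subr_eq0 => /eqP.
  by rewrite h// subrr normc0 expr0n.
split; first by move=> [_ [[_ _ voo] av]]; split=> // r; exact/aeP.
by move=> [voo dv]; split=> //; split=> // r; exact/aeP.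
Qed.

Lemma measurable_good_section : measurable good_section.
Proof.
rewrite (_ : good_section = (@half_line R `&` section_norm @^-1` [set x | (x < +oo)%E]) `&`
    \bigcap_(r in [set: 'S_n]) (@half_line R `&` section_defect r @^-1` [set 0%E])).
  apply: measurableI.
    apply: (measurable_preimage mH measurable_section_norm).
    rewrite (_ : [set _ | _] = ~` [set +oo%E]).
      by apply: measurableC; exact: emeasurable_set1.
    by apply/seteqP; split=> x /=; rewrite ltey => /eqP.
  apply: fin_bigcap_measurable => [|r _]; first exact: finite_finset.
  apply: (measurable_preimage mH (measurable_section_defect r)).
  exact: emeasurable_set1.
apply/seteqP; split=> t.
  move=> gt; have ht := gt.1; have [h1 h2] := (proj1 (good_sectionP ht)) gt.
  by split; [split|move=> r _; split].
move=> [[ht h1] h2]; apply/(good_sectionP ht); split=> // r.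
by have [] := h2 r I.
Qed.

End measurability.

Section antisymmetric_sections.
Hypothesis Lv : Lambda v.

Let mv : cmeasurable (@orthant R n.+1) v. Proof. by case: Lv => -[]. Qed.

Lemma integral_section_norm : (\int[leb]_(t in @half_line R) section_norm t < +oo)%E.
Proof.
have [[_ _ voo] _] := Lv; rewrite -(ge0_integral_cons (f := fun s => (normc (v s) ^+ 2)%:E))//.
  by apply/measurable_EFinP; exact: measurable_normc2.
by move=> s _; rewrite lee_fin sqr_ge0.
Qed.

Lemma section_norm_ge0 t : (0 <= section_norm t)%E.
Proof. by apply: integral_ge0 => s _; rewrite lee_fin sqr_ge0. Qed.

(** The squared norm of the section is integrable in [t], hence finite almost everywhere. Each
    defect integrates to 0 by Tonelli's theorem and the anti-symmetry of [v], hence vanishes almost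
    everywhere, and there are finitely many permutations. *)
Lemma good_section_ae : {ae leb, forall t, half_line t -> good_section t}.
Proof.
have h1 : {ae leb, forall t, half_line t -> (section_norm t < +oo)%E}.
  have : leb.-integrable (@half_line R) section_norm.
    apply/integrableP; split; first exact: measurable_section_norm.
    apply: le_lt_trans integral_section_norm.
    by under eq_integral do rewrite gee0_abs ?section_norm_ge0//.
  move=> /(integrable_ae mH); apply: filterS => t h /h.
  by rewrite ge0_fin_numE ?section_norm_ge0.
have h2 : {ae leb, forall t, forall r : 'S_n, half_line t -> section_defect r t = 0%E}.
  apply: filter_forall => r.
  have d0 t : (0 <= section_defect r t)%E.
    by apply: integral_ge0 => s _; rewrite lee_fin sqr_ge0.
  apply/(ae_eq_integral_abs leb mH); first exact: measurable_section_defect.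
  under eq_integral do rewrite gee0_abs ?d0//.
  pose r' := lift_perm ord0 ord0 r : 'S_n.+1.
  have m' : cmeasurable (@orthant R n.+1) (fun s => v (perm_tuple r' s) - (-1) ^+ r' * v s).
    have := cmeasurableD (cmeasurable_perm r' mv) (cmeasurableZ (- (-1) ^+ r') mv).
    by congr cmeasurable; apply/funext => s; rewrite mulNr.
  transitivity (\int[leb]_(x in @half_line R) \int[nleb n]_(t in @orthant R n)
     (normc (v (perm_tuple r' (tuple_cons (x, t))) - (-1) ^+ r' * v (tuple_cons (x, t))) ^+ 2)%:E)%E.
    apply: eq_integral => t _; apply: eq_integral => s _.
    by rewrite /r' lift_perm_tuple_cons odd_lift_perm.
  rewrite -(ge0_integral_cons (f := fun s => (normc (v (perm_tuple r' s) - (-1) ^+ r' * v s) ^+ 2)%:E)).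
  - have [_ /(_ r') av] := Lv; have mO := @measurable_orthant R n.+1.
    have := proj2 (ae_eq_integral_abs (nleb n.+1) mO (f := fun s : n.+1.-tuple mR =>
      (normc (v (perm_tuple r' s) - (-1) ^+ r' * v s) ^+ 2)%:E) _).
    under eq_integral do rewrite gee0_abs ?lee_fin ?sqr_ge0//.
    apply; first by apply/measurable_EFinP; exact: measurable_normc2.
    by apply: filterS av => s h os; rewrite h// subrr normc0 expr0n.
  - by apply/measurable_EFinP; exact: measurable_normc2.
  - by move=> s _; rewrite lee_fin sqr_ge0.
near=> t => ht; apply/(good_sectionP mv ht); split.
  exact: (near h1 t).
by move=> r; exact: (near h2 t).
Unshelve. all: by end_near. Qed.

Lemma hnorm_section t : ((hnorm (chaos (sec t)) ^+ 2)%:E <= (n`!%:R)%:E * section_norm t)%E.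
Proof.
have [Lt|nLt] := pselect (Lambda (sec t)); last first.
  by rewrite chaos_notin// hnorm0 expr0n mule_ge0// ?lee_fin// section_norm_ge0.
rewrite hnorm_chaos// EFinM lee_wpmul2l ?lee_fin// /l2 /Rintegral fineK//.
have [[_ _ voo] _] := Lt; rewrite ge0_fin_numE//; exact: section_norm_ge0.
Qed.

Section pairing.
Variable z : mR -> R[i].
Hypothesis sz : L2half z.

(** At a bad time [chaos] takes its default value 0, and the indicator removes whatever value the
    integral on the right may have. The identity thus holds at every time, which gives exact
    measurability in [t]. *)
Lemma section_dot (f : n.-tuple mR -> R[i]) t : half_line t -> Lambda f ->
  z t * dot (chaos (sec t)) (chaos f) = ind good_section t * (n`!%:R *
    cint n (fun s => (v (tuple_cons (t, s)))^*%C * tensor z f (tuple_cons (t, s)))).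
Proof.
move=> ht Lf; have mO := @measurable_orthant R n.
have [Lt|nLt] := pselect (Lambda (sec t)); last first.
  rewrite chaos_notin// dot0l mulr0 (@ind_notin _ _ good_section) ?mul0r//.
  by case.
rewrite (@ind_in _ _ good_section) ?mul1r// dot_chaos// /Lambda_dot mulrCA.
congr (_ * _); rewrite -cintegralZ//; last first.
  by case: Lt => st _; case: Lf => sf _; exact: cintegrable_dot.
by apply: eq_cintegral => s _; rewrite tensor_cons mulrCA.
Qed.

Let ctensor (f : n.-tuple mR -> R[i]) : Lambda f ->
  cintegrable (nleb n.+1) (@orthant R n.+1) (fun s => (v s)^*%C * tensor z f s).
Proof.
move=> [sf _]; have [sv _] := Lv.
by apply: cintegrable_dot => //; [exact: measurable_orthant|exact: L2n_tensor].
Qed.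

Let mgood := measurable_good_section mv.

Lemma cmeasurable_section_dot_chaos m (f : m.-tuple mR -> R[i]) : Lambda f ->
  cmeasurable (@half_line R) (fun t => z t * dot (chaos (sec t)) (chaos f)).
Proof.
have [nm|nm] := eqVneq n m; last first.
  move=> _; under eq_fun do rewrite dot_chaos_neq// mulr0.
  exact: cmeasurable_cst.
move: f; rewrite -nm => f Lf; pose S t := n`!%:R *
    cint n (fun s => (v (tuple_cons (t, s)))^*%C * tensor z f (tuple_cons (t, s))).
have mS : cmeasurable (@half_line R) (fun t => ind good_section t * S t).
  apply: cmeasurableM; first exact: cmeasurable_ind.
  apply: cmeasurableZ; exact: cintegrable_measurable (cintegrable_cons (ctensor Lf)).
case: mS => mr mi; split.
  by apply: eq_measurable_fun mr => t /set_mem ht; rewrite section_dot.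
by apply: eq_measurable_fun mi => t /set_mem ht; rewrite section_dot.
Qed.

(** The factor n + 1 is the ratio of the factorials in the inner products of degrees n + 1 and n.
    The anti-symmetrization in b^* is absorbed by [v], and Fubini's theorem separates the first
    variable. *)
Lemma section_pairing_chaos m (f : m.-tuple mR -> R[i]) : Lambda f ->
  n.+1%:R * cintegral leb (@half_line R) (fun t => z t * dot (chaos (sec t)) (chaos f)) =
  dot (chaos v) (creation z (chaos f)).
Proof.
move=> Lf; have [_ ->//] := creationP sz; rewrite /bstar /hat.
have [nm|nm] := eqVneq n m; last first.
  rewrite dot_chaos_neq ?eqSS//.
  by under eq_cintegral do rewrite dot_chaos_neq// mulr0; rewrite cintegral0 mulr0.
move: f Lf; rewrite -nm => f Lf; have [sf _] := Lf.
have st := L2n_tensor sz sf.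
rewrite dot_chaos//; last exact: Lambda_antisymmetrization.
rewrite Lambda_dot_antisymmetrization// factS natrM -mulrA; congr (_ * _).
rewrite (cintegral_cons (ctensor Lf)) -(cintegralZ mH _ (cintegrable_cons (ctensor Lf))).
apply: (cintegral_ae mH).
- exact: cmeasurable_section_dot_chaos.
- apply: cmeasurableZ; exact: cintegrable_measurable (cintegrable_cons (ctensor Lf)).
- apply: filterS good_section_ae => t gt ht; rewrite section_dot//.
  by rewrite (@ind_in _ _ good_section) ?mul1r//; exact: gt.
Qed.

End pairing.

Lemma weakly_measurable_section : weakly_measurable (@half_line R) (fun t => chaos (sec t)).
Proof.
have cM := closed_weakly_measurable (fun t => chaos (sec t)) mH.
move=> y; apply: (fock_chaos_ind cM) => m f Lf /=.
(* The weight in the previous pairing is square integrable, unlike the constant 1, which is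
   recovered as the pointwise limit of the indicators of [-k, k]. *)
have h k : cmeasurable (@half_line R) (fun t => ind (@itvk R k) t * dot (chaos (sec t)) (chaos f)).
  by apply: cmeasurable_section_dot_chaos => //; apply: L2half_ind;
    [exact: measurable_itvk|exact: leb_itvk].
apply: (cmeasurable_cvg h) => t ht e e0.
have [N HN] := in_cubek [tuple t]; exists N => k Nk.
rewrite ind_in ?mul1r ?subrr ?normc0//; exact: (HN k Nk ord0).
Qed.

Section pairing_extension.
Variable z : mR -> R[i].
Hypothesis sz : L2half z.

(** Constant of the pairing as a functional of y, from |z_t| |v_t| |y| <= |y| (|z_t|^2 + |v_t|^2)
    integrated over the half-line; the factorial is the one in the norm of [chaos]. *)
Let K : \bar R := (\int[leb]_(t in @half_line R) (normc (z t) ^+ 2)%:E +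
  (n`!%:R)%:E * \int[leb]_(t in @half_line R) section_norm t)%E.

Let Kfin : K \is a fin_num.
Proof.
have [_ _ zoo] := sz; have voo := integral_section_norm.
have z0 : (0 <= \int[leb]_(t in @half_line R) (normc (z t) ^+ 2)%:E)%E.
  by apply: integral_ge0 => t _; rewrite lee_fin sqr_ge0.
have v0 : (0 <= \int[leb]_(t in @half_line R) section_norm t)%E.
  by apply: integral_ge0 => t _; exact: section_norm_ge0.
rewrite /K fin_numD; apply/andP; split.
  by rewrite ge0_fin_numE.
by apply: fin_numM => //; rewrite ge0_fin_numE.
Qed.

Let mzdot y : cmeasurable (@half_line R) (fun t => z t * dot (chaos (sec t)) y).
Proof.
have [zr zi _] := sz.
by apply: cmeasurableM; [exact: (conj zr zi)|exact: weakly_measurable_section].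
Qed.

Let arith (a b h : R) : 0 <= a -> 0 <= b -> 0 <= h -> a * (b * h) <= h * (a ^+ 2 + b ^+ 2).
Proof.
move=> a0 b0 h0; have := sqr_ge0 (a - b).
have := mulr_ge0 h0 (sqr_ge0 (a - b)); have := mulr_ge0 h0 (sqr_ge0 a).
have := mulr_ge0 h0 (sqr_ge0 b); lra.
Qed.

Let zdot_bound y : (\int[leb]_(t in @half_line R) (normc (z t * dot (chaos (sec t)) y))%:E <=
  (hnorm y * fine K)%:E)%E.
Proof.
have [zr zi _] := sz.
rewrite EFinM fineK// /K.
have mz : measurable_fun (@half_line R) (fun t => (normc (z t) ^+ 2)%:E).
  by apply/measurable_EFinP; apply: measurable_normc2; exact: (conj zr zi).
have mn := measurable_section_norm mv.
rewrite -ge0_integralZl//; last by move=> t _; exact: section_norm_ge0.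
rewrite -ge0_integralD//; last 3 first.
- by move=> t _; rewrite lee_fin sqr_ge0.
- by move=> t _; rewrite mule_ge0// ?lee_fin// section_norm_ge0.
- exact: measurable_funeM.
rewrite -ge0_integralZl//; last 3 first.
- by apply: emeasurable_funD => //; exact: measurable_funeM.
- by move=> t _; rewrite adde_ge0// ?lee_fin ?sqr_ge0// mule_ge0// ?lee_fin// section_norm_ge0.
- by rewrite lee_fin hnorm_ge0.
apply: ge0_le_integral.
- exact: mH.
- by move=> t _; rewrite lee_fin normc_ge0.
- by apply/measurable_EFinP; exact: measurable_normc.
- by apply: measurable_funeM; apply: emeasurable_funD => //; exact: measurable_funeM.
move=> t ht; apply: (@le_trans _ _ ((hnorm y)%:E *
    ((normc (z t) ^+ 2)%:E + (hnorm (chaos (sec t)) ^+ 2)%:E))%E).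
  rewrite -EFinD -EFinM lee_fin normcM.
  apply: le_trans (arith (normc_ge0 (z t)) (hnorm_ge0 (chaos (sec t))) (hnorm_ge0 y)).
  by rewrite ler_wpM2l ?normc_ge0// normc_dot_le.
rewrite lee_wpmul2l ?lee_fin ?hnorm_ge0// leeD2l//; exact: hnorm_section.
all: exact: mH.
Qed.

Lemma cintegrable_section_dot y :
  cintegrable leb (@half_line R) (fun t => z t * dot (chaos (sec t)) y).
Proof.
apply: (cintegrable_bounded mH (mzdot y)).
by apply: le_lt_trans (zdot_bound y) _; rewrite ltry.
Qed.

(** The integral is a bounded functional of [y], so the Riesz vector [w] turns both sides into inner
    products, and an identity known on each chaos extends by density. *)
Lemma section_pairing y :
  n.+1%:R * cintegral leb (@half_line R) (fun t => z t * dot (chaos (sec t)) y) =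
  dot (chaos v) (creation z y).
Proof.
have [w wE] : exists w, forall y,
    cintegral leb (@half_line R) (fun t => z t * dot (chaos (sec t)) y) = dot w y.
  apply: (riesz (c := 2 * fine K)) => [a x x'|x].
    have [ix ix'] := (cintegrable_section_dot x, cintegrable_section_dot x').
    rewrite -(cintegralZ mH _ ix) -(cintegralD mH (cintegrableZ mH a ix) ix').
    by congr (cintegral _ _ _); apply/funext => t; rewrite dotDr dotZr mulrDr mulrCA.
  have := normc_cintegral mH (cintegrable_section_dot x) (zdot_bound x).
  by rewrite [hnorm x * _]mulrC mulrA.
have cM := closed_dot_eq (chaos v) (n.+1%:R *: w) (creation_bounded sz).
rewrite wE -dot_natl; symmetry; apply: (fock_chaos_ind cM) => m f Lf.
rewrite -[_ (chaos f)]/(dot (chaos v) (creation z (chaos f)) = dot (n.+1%:R *: w) (chaos f)).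
by rewrite -(section_pairing_chaos sz Lf) wE dot_natl.
Qed.

End pairing_extension.

End antisymmetric_sections.
End sections.

Definition fock_derivative n : (n.-tuple mR -> R[i]) -> mR -> fock R :=
  match n with
  | 0 => fun _ _ => 0
  | m.+1 => fun v t => m.+1%:R *: chaos (fun s : m.-tuple mR => v (tuple_cons (t, s)))
  end.

Lemma gns_derivative_chaos n (v : n.-tuple mR -> R[i]) t :
  gns_unitary (derivative_chaos v t) = fock_derivative v t.
Proof.
case: n v => [|n] v; first exact: lin0 (@gns_linear R).
by rewrite -[LHS]/(gns_unitary (n.+1%:R *: Jn _)) (linZ (@gns_linear R)) gns_Jn.
Qed.

Lemma weakly_measurable_fock_derivative n (v : n.-tuple mR -> R[i]) : Lambda v ->
  weakly_measurable (@half_line R) (fock_derivative v).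
Proof.
case: n v => [|n] v Lv y; first by under eq_fun do rewrite dot0l; exact: cmeasurable_cst.
under eq_fun do rewrite dot_natl.
by apply: cmeasurableZ; exact: weakly_measurable_section.
Qed.

(** A created vector has no component of degree 0, in accordance with the derivative being 0 on
    constants. *)
Lemma dot_chaos0_creation (v : 0.-tuple mR -> R[i]) z y : L2half z ->
  dot (chaos v) (creation z y) = 0.
Proof.
move=> sz; have cM := closed_dot_eq (chaos v) 0 (creation_bounded sz).
rewrite -[RHS](dot0l y); apply: (fock_chaos_ind cM) => m f Lf.
by rewrite /= dot0l (proj2 (creationP sz))// dot_chaos_neq.
Qed.

Lemma fock_derivative_pairing n (v : n.-tuple mR -> R[i]) z y : Lambda v -> L2half z ->
  cintegrable leb (@half_line R) (fun t => z t * dot (fock_derivative v t) y) /\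
  cintegral leb (@half_line R) (fun t => z t * dot (fock_derivative v t) y) =
  dot (chaos v) (creation z y).
Proof.
case: n v => [|n] v Lv sz.
  under [in X in X /\ _]eq_fun do rewrite dot0l mulr0.
  under eq_cintegral do rewrite dot0l mulr0.
  rewrite cintegral0 dot_chaos0_creation//; split=> //; exact: cintegrable0.
have i0 := cintegrable_section_dot Lv sz y.
under [in X in X /\ _]eq_fun do rewrite dot_natl mulrCA.
split; first exact: (cintegrableZ mH _ i0).
under eq_cintegral do rewrite dot_natl mulrCA.
by rewrite (cintegralZ mH _ i0); exact: section_pairing.
Qed.

Lemma derivative_finite_weakly_measurable F G : @derivative_finite R F G ->
  weakly_measurable (@half_line R) G.
Proof.
move=> [N [v [Lv _ ->]]] y; under eq_fun do rewrite dot_suml.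
apply: cmeasurable_sum => n.
under eq_fun do rewrite -gns_dot gns_derivative_chaos.
exact: weakly_measurable_fock_derivative.
Qed.

Lemma derivative_finite_pairing F G a b x : @derivative_finite R F G -> 0 <= a -> a <= b ->
  L2C_filtration a x ->
  cintegrable leb (@half_line R) (fun t => ind `[a, b[%classic t * dot (G t) x) /\
  cintegral leb (@half_line R) (fun t => ind `[a, b[%classic t * dot (G t) x) =
  dot F (left_action (Psi_process b - Psi_process a) x).
Proof.
move=> [N [v [Lv -> ->]]] a0 ab Fx.
have sz : L2half (ind `[a, b[%classic : mR -> R[i]).
  apply: L2half_ind; first exact: measurable_itv.
  by rewrite lebesgue_measure_itv/=; case: ifP => _; rewrite ?ltry// -EFinD ltry.
have E (t : mR) : ind `[a, b[%classic t * dot (\sum_(n < N) derivative_chaos (v n) t) x =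
    \sum_(n < N) ind `[a, b[%classic t * dot (fock_derivative (v n) t) (gns_unitary x).
  rewrite dot_suml mulr_sumr; apply: eq_bigr => n _.
  by rewrite -gns_dot gns_derivative_chaos.
under [in X in X /\ _]eq_fun do rewrite E.
have h n := fock_derivative_pairing (gns_unitary x) (Lv n) sz.
split; first by apply: (cintegrable_sum mH) => n; exact: (h n).1.
under eq_cintegral do rewrite E.
rewrite (cintegral_sum mH _ (fun n : 'I_N => (h n).1)).
rewrite dot_suml; apply: eq_bigr => n _.
rewrite -gns_dot gns_Jn gns_increment// (proj2 (h n)).
(* The pairing is computed on [a, b[ for the process and on ]a, b] for the field increment; the two
   integrands agree almost everywhere. *)
have [i1 <-] := h n; have [i2 <-] := fock_derivative_pairing (gns_unitary x) (Lv n) (L2half_incr a b).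
apply: (cintegral_ae mH); [exact: cintegrable_measurable i1|exact: cintegrable_measurable i2|].
by apply: filterS (ind_co_oc a b) => t -> _.
Qed.

End integrable_sections.

(** Moving [A] to the other side and applying the relation leaves the remainder <y, B (A' y')> = <B'
    y, A' y'>, so a single annihilated vector suffices. *)
Lemma dot_anticommutator (R : realType) (H : hilbertType R) (A B A' B' : H -> H) c y y' :
  is_adjoint A A' -> is_adjoint B B' -> (forall x, A' (B x) = c *: x - B (A' x)) ->
  A' y' = 0 \/ B' y = 0 -> dot (A y) (B y') = c * dot y y'.
Proof.
move=> a b car h; rewrite a car dotBr dotZr.
suff -> : dot y (B (A' y')) = 0 by rewrite subr0.
by rewrite dotC b; case: h => ->; rewrite ?dot0l ?dot0r conjc0.
Qed.

Lemma dot_sub_sub (R : realType) (V : preHilbertType R) (x y : V) :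
  dot (x - y) (x - y) = dot x x - dot x y - (dot y x - dot y y).
Proof. by rewrite dotBl !dotBr. Qed.

Lemma dot_sub_sub_congr (R : realType) (V : preHilbertType R) (x y : V) (a b c e : R[i]) :
  dot x x = a -> dot x y = b -> dot y x = c -> dot y y = e ->
  dot (x - y) (x - y) = a - b - (c - e).
Proof. by move=> <- <- <- <-; exact: dot_sub_sub. Qed.

Lemma hnorm2_cintegral (R : realType) (V W : preHilbertType R) d (T : measurableType d)
  (mu : {measure set T -> \bar R}) (D : set T) (g : T -> W) (x : V) : measurable D ->
  cintegrable mu D (fun t => dot (g t) (g t)) ->
  dot x x = cintegral mu D (fun t => dot (g t) (g t)) ->
  ((hnorm x ^+ 2)%:E = \int[mu]_(t in D) (hnorm (g t) ^+ 2)%:E)%E.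
Proof.
move=> mD [ig _] e; rewrite hnorm2 e /= /Rintegral fineK.
  by apply: eq_integral => t _; rewrite hnorm2.
exact: (integrable_fin_num mD ig).
Qed.

Lemma cintegral_sub_sub d (T : measurableType d) (R : realType) (mu : {measure set T -> \bar R})
  (D : set T) (a b c e : T -> R[i]) : measurable D -> cintegrable mu D a ->
  cintegrable mu D b -> cintegrable mu D c -> cintegrable mu D e ->
  cintegrable mu D (fun t => a t - b t - (c t - e t)) /\
  cintegral mu D (fun t => a t - b t - (c t - e t)) =
  cintegral mu D a - cintegral mu D b - (cintegral mu D c - cintegral mu D e).
Proof.
move=> mD ia ib ic ie; have [iab ice] := (cintegrableB mD ia ib, cintegrableB mD ic ie).
split; first exact: cintegrableB.
by rewrite (cintegralB mD iab ice) (cintegralB mD ia ib) (cintegralB mD ic ie).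
Qed.

(** * The Ito-Clifford integral *)

Section ito_isometry.
Variable R : realType.
Local Notation mR := (measurableTypeR R).
Local Notation leb := (@lebesgue_measure R).
Local Notation mH := (@measurable_half_line R).
Local Notation L2C := (L2C R).
Local Notation G := (@gns_unitary R).
Local Notation F_ := (@L2C_filtration R).
Local Notation co a b := (ind `[a, b[%classic : mR -> R[i]).

Lemma L2half_co (a b : R) : L2half (co a b).
Proof.
apply: L2half_ind; first exact: measurable_itv.
by rewrite lebesgue_measure_itv/=; case: ifP => _; rewrite ?ltry// -EFinD ltry.
Qed.

Lemma simple_process_funE (h : simple_process R) t : simple_process_fun h t =
  \sum_(k < sp_size h) co (sp_time h k) (sp_time h k.+1) t *: sp_val h k.
Proof.
apply: eq_bigr => k _; rewrite /ind indicE mem_setE in_itv/=.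
by case: ifP; rewrite ?scale1r ?scale0r.
Qed.

Lemma simple_process_simple (h : simple_process R) : simple_function (simple_process_fun h).
Proof.
rewrite (_ : simple_process_fun h = fun t => \sum_(k < sp_size h)
    co (sp_time h k) (sp_time h k.+1) t *: sp_val h k).
  by apply: simple_function_sum => k; apply: simple_function_ind; exact: measurable_itv.
by apply/funext => t; exact: simple_process_funE.
Qed.

Lemma simple_adapted_time (h : simple_process R) k : simple_adapted h ->
  (k <= sp_size h)%N -> 0 <= sp_time h k <= 1.
Proof.
move=> [h0 h1 hm _].
have mono i j : (i <= j)%N -> (j <= sp_size h)%N -> sp_time h i <= sp_time h j.
  elim: j => [|j IH]; first by rewrite leqn0 => /eqP ->.
  rewrite leq_eqVlt => /predU1P[->//|ij] jn; apply: le_trans (IH ij (ltnW jn)) (hm _ jn).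
by move=> kn; rewrite (le_trans h0 (mono _ _ (leq0n k) kn)) (le_trans (mono _ _ kn (leqnn _)) h1).
Qed.

Lemma simple_integral_pairing (h : simple_process R) F D : derivative_finite F D ->
  simple_adapted h ->
  cintegral leb (@half_line R) (fun t => dot (D t) (simple_process_fun h t)) =
  dot F (simple_integral h).
Proof.
move=> FD ha; have [_ _ hm hF] := ha.
have P (k : 'I_(sp_size h)) := derivative_finite_pairing FD
  (proj1 (andP (simple_adapted_time ha (ltnW (ltn_ord k))))) (hm k (ltn_ord k))
  (hF k (ltn_ord k)).
have E (t : mR) : dot (D t) (simple_process_fun h t) = \sum_(k < sp_size h)
    co (sp_time h k) (sp_time h k.+1) t * dot (D t) (sp_val h k).
  by rewrite simple_process_funE dot_sumr; apply: eq_bigr => k _; rewrite dotZr.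
under eq_cintegral do rewrite E.
rewrite (cintegral_sum mH _ (fun k => (P k).1)) dot_sumr.
by apply: eq_bigr => k _; rewrite (P k).2.
Qed.

(* By the anticommutation relation the defect is an inner product of annihilated
   vectors, one of which vanishes by adaptedness. *)
Lemma dot_increments (a b a' b' : R) x x' : 0 <= a -> a <= b -> 0 <= a' -> a' <= b' ->
  F_ a x -> F_ a' x' ->
  dot (left_action (Psi_process b - Psi_process a) x)
      (left_action (Psi_process b' - Psi_process a') x') =
  halfdot (incr a b) (incr a' b') * dot x x'.
Proof.
move=> a0 ab a0' ab' Fx Fx'; rewrite -gns_dot !gns_increment// -(gns_dot x x').
have [sf sg] := (L2half_incr a b, L2half_incr a' b').
apply: (dot_anticommutator (annihilation_adjoint sf) (annihilation_adjoint sg)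
  (fun z => annihilation_creation z sf sg)).
(* The vector adapted to the earlier left end is annihilated by the increment that starts at the
   later one. *)
have [aa|/ltW aa] := leP a a'; [right|left].
  exact: (@annihilation_filtration R a' b' x (filtration_mono aa Fx)).
exact: (@annihilation_filtration R a b x' (filtration_mono aa Fx')).
Qed.

Lemma halfdot_incr (a b a' b' : R) : halfdot (incr a b) (incr a' b') = halfdot (co a b) (co a' b').
Proof.
have i1 := cintegrable_dot mH (L2half_incr a b) (L2half_incr a' b').
have i2 := cintegrable_dot mH (L2half_co a b) (L2half_co a' b').
apply: (cintegral_ae mH); [exact: cintegrable_measurable i1|exact: cintegrable_measurable i2|].
apply: filterS2 (ind_co_oc a b) (ind_co_oc a' b') => t h h' _.
by rewrite h h'.
Qed.

Lemma cintegral_simple_process (h h' : simple_process R) :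
  cintegrable leb (@half_line R) (fun t => dot (simple_process_fun h t) (simple_process_fun h' t)) /\
  cintegral leb (@half_line R) (fun t => dot (simple_process_fun h t) (simple_process_fun h' t)) =
  \sum_(k < sp_size h) \sum_(l < sp_size h')
    halfdot (co (sp_time h k) (sp_time h k.+1)) (co (sp_time h' l) (sp_time h' l.+1)) *
    dot (sp_val h k) (sp_val h' l).
Proof.
have E : (fun t => dot (simple_process_fun h t) (simple_process_fun h' t)) =
    fun t => \sum_(k < sp_size h) \sum_(l < sp_size h') dot (sp_val h k) (sp_val h' l) *
      ((co (sp_time h k) (sp_time h k.+1) t)^*%C * co (sp_time h' l) (sp_time h' l.+1) t).
  apply/funext => t; rewrite !simple_process_funE dot_suml; apply: eq_bigr => k _.
  rewrite dot_sumr; apply: eq_bigr => l _; rewrite dotZl dotZr mulrA.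
  exact: mulrC.
have I (k : 'I_(sp_size h)) (l : 'I_(sp_size h')) := cintegrableZ mH
  (dot (sp_val h k) (sp_val h' l)) (cintegrable_dot mH (L2half_co (sp_time h k) (sp_time h k.+1))
  (L2half_co (sp_time h' l) (sp_time h' l.+1))).
have I' k := cintegrable_sum mH (index_enum (ordinal (sp_size h'))) (I k).
rewrite E; split; first exact: (cintegrable_sum mH _ I').
rewrite (cintegral_sum mH _ I'); apply: eq_bigr => k _.
rewrite (cintegral_sum mH _ (I k)); apply: eq_bigr => l _.
rewrite mulrC; apply: (cintegralZ mH); apply: (cintegrable_dot mH); exact: L2half_co.
Qed.

(** The two processes may have unrelated grids, so the isometry for differences is obtained without
    refining to a common partition. *)
Lemma ito_dot (h h' : simple_process R) : simple_adapted h -> simple_adapted h' ->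
  dot (simple_integral h) (simple_integral h') =
  cintegral leb (@half_line R) (fun t => dot (simple_process_fun h t) (simple_process_fun h' t)).
Proof.
move=> ha ha'; rewrite (cintegral_simple_process h h').2 dot_suml.
have [_ _ hm hF] := ha; have [_ _ hm' hF'] := ha'.
apply: eq_bigr => k _; rewrite dot_sumr; apply: eq_bigr => l _.
rewrite -halfdot_incr; apply: dot_increments; [|exact: hm| |exact: hm'|exact: hF|exact: hF'].
  by have /andP[] := simple_adapted_time ha (ltnW (ltn_ord k)).
by have /andP[] := simple_adapted_time ha' (ltnW (ltn_ord l)).
Qed.

Lemma ito_isometry (h h' : simple_process R) : simple_adapted h -> simple_adapted h' ->
  ((hnorm (simple_integral h - simple_integral h') ^+ 2)%:E =
  \int[leb]_(t in @half_line R) (hnorm (simple_process_fun h t - simple_process_fun h' t) ^+ 2)%:E)%E.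
Proof.
move=> ha ha'; set f := simple_process_fun h; set f' := simple_process_fun h'.
have [[i11 _] [i12 _]] := (cintegral_simple_process h h, cintegral_simple_process h h').
have [[i21 _] [i22 _]] := (cintegral_simple_process h' h, cintegral_simple_process h' h').
have [iB e] := cintegral_sub_sub mH i11 i12 i21 i22.
have {}e := etrans (dot_sub_sub_congr (ito_dot ha ha) (ito_dot ha ha') (ito_dot ha' ha)
  (ito_dot ha' ha')) (esym e).
have E : (fun t => dot (f t) (f t) - dot (f t) (f' t) - (dot (f' t) (f t) - dot (f' t) (f' t))) =
   fun t => dot (f t - f' t) (f t - f' t).
  by apply/funext => t; rewrite dot_sub_sub.
rewrite -/f -/f' in iB e; rewrite E in iB e.
exact: hnorm2_cintegral mH iB e.
Qed.

End ito_isometry.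

Lemma dominated_cvg0 d (T : measurableType d) (R : realType) (mu : {measure set T -> \bar R})
  (D : set T) (f : nat -> T -> R) (g : T -> R) : measurable D ->
  (forall k, measurable_fun D (f k)) -> measurable_fun D g ->
  (forall k t, D t -> 0 <= f k t <= g t) -> (\int[mu]_(t in D) (g t)%:E < +oo)%E ->
  (forall t, D t -> f k t @[k --> \oo] --> (0 : R)) ->
  (\int[mu]_(t in D) (f k t)%:E)%E @[k --> \oo] --> 0%E.
Proof.
move=> mD mf mg fg goo f0.
have [] := @dominated_convergence _ _ _ mu D mD (fun k t => (f k t)%:E) (cst 0%E)
  (fun t => (g t)%:E).
- by move=> k; apply/measurable_EFinP; exact: mf.
- exact: measurable_cst.
- by apply: aeW => t Dt; apply: cvg_EFin; [exact: nearW|exact: f0].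
- apply/integrableP; split; first exact/measurable_EFinP.
  apply: le_lt_trans goo; apply: ge0_le_integral => //.
  + by apply/measurable_EFinP; apply: measurableT_comp.
  + exact/measurable_EFinP.
  + move=> t Dt; have /andP[h1 h2] := fg 0%N t Dt.
    by rewrite lee_fin ger0_norm// (le_trans h1 h2).
- apply: aeW => t k Dt; have /andP[h1 h2] := fg k t Dt.
  by rewrite gee0_abs ?lee_fin.
by move=> _ _; rewrite integral0.
Qed.

(** * Sampling on uniform grids *)

Section grid.
Variable R : realType.
Local Notation mR := (measurableTypeR R).
Local Notation leb := (@lebesgue_measure R).
Local Notation D := (`[0%R, 1%R[%classic : set mR).

Definition grid_fun (V : nmodType) N (f : nat -> V) (t : R) : V :=
  \sum_(k < N) if k%:R / N%:R <= t < k.+1%:R / N%:R then f k else 0.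

Definition grid_index N (t : R) : nat := Num.truncn (t * N%:R).

Lemma grid_indexP N t k : (0 < N)%N -> 0 <= t ->
  (k%:R / N%:R <= t < k.+1%:R / N%:R) = (k == grid_index N t).
Proof.
move=> N0 t0; have N0' : 0 < N%:R :> R by rewrite ltr0n.
by rewrite ler_pdivrMr// ltr_pdivlMr// -(truncn_eq k) ?mulr_ge0// eq_sym.
Qed.

Lemma grid_index_lt N t : (0 < N)%N -> 0 <= t -> t < 1 -> (grid_index N t < N)%N.
Proof.
move=> N0 t0 t1; rewrite /grid_index truncn_lt_nat ?mulr_ge0//.
by rewrite gtr_pMl ?ltr0n.
Qed.

Lemma grid_funE (V : nmodType) N (f : nat -> V) t : (0 < N)%N -> 0 <= t -> t < 1 ->
  grid_fun N f t = f (grid_index N t).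
Proof.
move=> N0 t0 t1; have iN := grid_index_lt N0 t0 t1.
rewrite /grid_fun (bigD1 (Ordinal iN))//= big1 ?addr0.
  by rewrite grid_indexP// eqxx.
move=> k kN; rewrite grid_indexP//; case: eqP => // E.
by move: kN; rewrite -val_eqE /= E eqxx.
Qed.

Lemma grid_index_itv N t : (0 < N)%N -> 0 <= t ->
  (grid_index N t)%:R / N%:R <= t < (grid_index N t).+1%:R / N%:R.
Proof. by move=> N0 t0; rewrite grid_indexP. Qed.

Lemma measurable_grid_fun N (f : nat -> R) (E : set mR) :
  measurable_fun E (grid_fun N f : mR -> R).
Proof.
apply: (eq_measurable_fun (fun t => \sum_(k < N)
    \1_(`[k%:R / N%:R, k.+1%:R / N%:R[%classic : set mR) t * f k)).
  move=> t _; apply: eq_bigr => k _; rewrite indicE mem_setE in_itv/=.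
  by case: ifP; rewrite ?mul1r ?mul0r.
by apply: measurable_sum => k; apply: measurable_funM => //; exact: measurable_indic.
Qed.

(** The expression is the truncation of [x] to [0, 1], written with absolute values so that its
    continuity is immediate. Truncating does not increase the distance to an indicator, see
    [clamp_le]. *)
Let clamp_itv (x : R) : 0 <= (`|x| - `|x - 1| + 1) / 2 <= 1.
Proof. by case: (ger0P x) => ?; case: (ger0P (x - 1)) => ?; lra. Qed.

Let clamp_le (b : bool) (x : R) : `|b%:R - (`|x| - `|x - 1| + 1) / 2| <= `|b%:R - x|.
Proof.
rewrite ler_norml; case: b; case: (ger0P x) => ?; case: (ger0P (x - 1)) => ?;
  by case: (ger0P (_ - x)) => /= ?; lra.
Qed.

Lemma continuous_approx (A : set mR) (e : R) : measurable A -> 0 < e ->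
  exists g : R -> R, [/\ continuous g, forall t, 0 <= g t <= 1 &
    (\int[leb]_(t in D) `|\1_A t - g t|%:E <= e%:E)%E].
Proof.
move=> mA e0; have mD : measurable D by exact: measurable_itv.
have Doo : (leb D < +oo)%E by rewrite lebesgue_measure_itv/= lte_fin ltr01 -EFinD ltry.
have iA : leb.-integrable D (EFin \o (\1_A : mR -> R)).
  apply/integrableP; split; first by apply/measurable_EFinP; exact: measurable_indic.
  rewrite (eq_integral (fun t => (\1_A t)%:E)); last by move=> t _; rewrite /= ger0_norm.
  rewrite integral_indic//; apply: le_lt_trans Doo; apply: le_measure => //.
    by rewrite inE; exact: measurableI.
    by rewrite inE.
have [g [cg ig gA]] := approximation_continuous_integrable mD Doo iA.
have a0 n : (0 <= \int[leb]_(z in D) `|(\1_A z - g n z)%:E|)%E by exact: integral_ge0.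
have [N HN] := (proj1 (ereal_cvg0P a0) gA) e e0.
pose h t := (`|g N t| - `|g N t - 1| + 1) / 2.
have ch : continuous h.
  move=> t; apply: cvgMl; apply: cvgD; last exact: cvg_cst.
  apply: cvgB; apply: cvg_norm; first exact: cg.
  by apply: cvgB; [exact: cg|exact: cvg_cst].
exists h; split=> //; first by move=> t; exact: (clamp_itv (g N t)).
apply: le_trans (HN N (leqnn _)); apply: ge0_le_integral => //.
- apply/measurable_EFinP; apply: measurableT_comp => //; apply: measurable_funB.
    exact: measurable_indic.
  by apply: measurable_funTS; exact: continuous_measurable_fun.
- apply: measurableT_comp => //; apply/measurable_EFinP; apply: measurable_funB.
    exact: measurable_indic.
  by apply: measurable_funTS; exact: continuous_measurable_fun.
- by move=> t _; rewrite lee_fin /h indicE; exact: clamp_le.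
Qed.

(** At each [t] the sample is taken at distance less than 1 / (n + 1), so continuity gives pointwise
    convergence; the integrand is bounded by 1. *)
Lemma sampling_cvg (g : R -> R) : continuous g -> (forall t, 0 <= g t <= 1) ->
  (\int[leb]_(t in D) `|g t - grid_fun n.+1 (fun k => g (k%:R / n.+1%:R)) t|%:E)%E
    @[n --> \oo] --> 0%E.
Proof.
move=> cg g01; have mD : measurable D by exact: measurable_itv.
apply: (dominated_cvg0 (g := cst 1)) => //.
- move=> n; apply: measurableT_comp => //; apply: measurable_funB.
    by apply: measurable_funTS; exact: continuous_measurable_fun.
  exact: measurable_grid_fun.
- move=> n t; rewrite /= in_itv/= => /andP[t0 t1]; rewrite grid_funE// normr_ge0/=.
  have := g01 t; have := g01 ((grid_index n.+1 t)%:R / n.+1%:R).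
  by rewrite ler_norml; lra.
- rewrite [ltLHS](_ : _ = (1%:E * leb D)%E); last first.
    by rewrite -(integral_cst leb mD 1%:E); exact: eq_integral.
  rewrite mul1e lebesgue_measure_itv/= lte_fin ltr01 -EFinD.
  exact: ltry.
- move=> t; rewrite /= in_itv/= => /andP[t0 t1]; apply/cvgrPdist_lt => e e0.
  have /cvgrPdist_lt/(_ e e0) := cg t; move=> [d /= d0 hd].
  exists (Num.truncn d^-1).+1 => // n Nn /=.
  rewrite sub0r normrN normr_id grid_funE//; apply: hd => /=.
  have /andP[h1 h2] := grid_index_itv (ltn0Sn n) t0.
  rewrite ger0_norm ?subr_ge0//.
  have nd : n.+1%:R^-1 < d.
    rewrite invf_plt ?posrE// (lt_le_trans (truncnS_gt _))// ler_nat.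
    exact: leq_trans Nn (leqnSn n).
  apply: le_lt_trans nd; rewrite lerBlDr (le_trans (ltW h2))//.
  by rewrite -natr1 mulrDl mul1r addrC.
Qed.

End grid.

Lemma sqr_le_sqrD (R : realType) (a b c : R) : 0 <= a -> a <= b + c ->
  a ^+ 2 <= 2 * b ^+ 2 + 2 * c ^+ 2.
Proof.
move=> a0 abc; have := sqr_ge0 (b - c).
have : a ^+ 2 <= (b + c) ^+ 2 by rewrite lerXn2r ?nnegrE//; exact: le_trans abc.
lra.
Qed.

Lemma approx_arith (R : realType) (X e n : R) : 0 <= X -> 0 < e -> 0 < n -> 4 * X / e <= n ->
  2 * (X * (e / (8 * (X + 1)) + e / (8 * (X + 1)))) + 2 * (X / n) <= e.
Proof.
move=> X0 e0 n0; rewrite ler_pdivrMr// => h.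
have X1 : 0 < X + 1 by lra.
have -> : 2 * (X * (e / (8 * (X + 1)) + e / (8 * (X + 1)))) = e / 2 * (X / (X + 1)).
  by field; rewrite gt_eqF.
have : X / (X + 1) <= 1 by rewrite ler_pdivrMr//; lra.
have : X / n <= e / 4 by rewrite ler_pdivrMr//; lra.
move: (X / n) (X / (X + 1)) => p q; nra.
Qed.

(** * Approximation of adapted processes by projection *)

Section projections.
Variables (R : realType) (H : hilbertType R) (F : R -> set H).
Hypothesis cF : forall t, closed_subspace (F t).
Hypothesis mF : forall s t, s <= t -> F s `<=` F t.

Definition proj t (x : H) : H := projT1 (cid2 (projection x (cF t))).

Lemma proj_in t x : F t (proj t x).
Proof. by rewrite /proj; case: cid2. Qed.

Lemma proj_orth t x m : F t m -> dot m (x - proj t x) = 0.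
Proof. by rewrite /proj; case: cid2 => p ? /= h; exact: h. Qed.

Lemma proj_unique t x p : F t p -> (forall m, F t m -> dot m (x - p) = 0) -> p = proj t x.
Proof.
move=> Fp h; apply/eqP; rewrite -subr_eq0; apply/eqP/dot_eq0.
have Fd : F t (p - proj t x) by apply: subspaceB (proj1 (cF t)) _ _ => //; exact: proj_in.
rewrite [X in dot _ X = _](_ : _ = (x - proj t x) - (x - p)).
  by rewrite dotBr proj_orth// h// subrr.
by rewrite opprB [RHS]addrC addrA subrK.
Qed.

Lemma projD t x y : proj t (x + y) = proj t x + proj t y.
Proof.
symmetry; apply: proj_unique.
  by apply: subspaceD (proj1 (cF t)) _ _; exact: proj_in.
by move=> m Fm; rewrite opprD addrACA dotDr !proj_orth// addr0.
Qed.

Lemma projZ t a x : proj t (a *: x) = a *: proj t x.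
Proof.
symmetry; apply: proj_unique.
  by apply: subspaceZ (proj1 (cF t)) _; exact: proj_in.
by move=> m Fm; rewrite -scalerBr dotZr proj_orth// mulr0.
Qed.

Lemma pythagoras (x y : H) : dot x y = 0 -> hnorm (x + y) ^+ 2 = hnorm x ^+ 2 + hnorm y ^+ 2.
Proof. by move=> xy; rewrite hnormD2 xy mulr0 addr0. Qed.

(** In w - x = (w - proj t x) - (x - proj t x) the first term lies in the subspace and the second is
    orthogonal to it. *)
Lemma proj_contract t w x : F t w -> hnorm (w - proj t x) <= hnorm (w - x).
Proof.
move=> Fw; have Fd : F t (w - proj t x).
  by apply: subspaceB (proj1 (cF t)) _ _ => //; exact: proj_in.
rewrite -(@ler_pXn2r _ 2%N)// ?nnegrE ?hnorm_ge0//.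
have -> : w - x = (w - proj t x) + - (x - proj t x).
  by rewrite opprB addrA subrK.
have o : dot (w - proj t x) (- (x - proj t x)) = 0 by rewrite dotNr proj_orth// oppr0.
by rewrite (pythagoras o) lerDl sqr_ge0.
Qed.

Lemma hnorm_proj_le t x : hnorm (proj t x) <= hnorm x.
Proof.
have := proj_contract x (proj1 (proj1 (cF t))).
by rewrite !sub0r !Defs.hnormN.
Qed.

(** The increment is orthogonal to the smaller space, as the difference of two residuals that are.
    The squared norms of the projections therefore have telescoping increments. *)
Lemma proj_increment s t x : s <= t ->
  hnorm (proj t x) ^+ 2 = hnorm (proj s x) ^+ 2 + hnorm (proj t x - proj s x) ^+ 2.
Proof.
move=> st; rewrite -pythagoras; first by rewrite addrC subrK.
rewrite dotBr.
have Fs := proj_in s x; have Ft := mF st Fs.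
have := proj_orth x Fs; have := proj_orth x Ft; rewrite !dotBr.
move=> /eqP; rewrite subr_eq0 => /eqP <- /eqP; rewrite subr_eq0 => /eqP ->.
by rewrite subrr.
Qed.

Section approximation.
Local Notation mR := (measurableTypeR R).
Local Notation leb := (@lebesgue_measure R).
Local Notation D := (`[0%R, 1%R[%classic : set mR).

Let mD : measurable D. Proof. exact: measurable_itv. Qed.

(* [proj t (c t)] is approximated instead of [c t]: an adapted process is at least
   as close to it, see [proj_contract]. *)
Definition adapted_approx (c : mR -> H) := forall e : R, 0 < e -> exists N0, forall N, (N0 <= N)%N ->
  exists2 f : nat -> H, (forall k, F (k%:R / N.+1%:R) (f k)) &
  exists b : mR -> R, [/\ measurable_fun D b, forall t, D t -> 0 <= b t,
    forall t, D t -> hnorm (proj t (c t) - grid_fun N.+1 f t) <= b t &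
    (\int[leb]_(t in D) (b t ^+ 2)%:E <= e%:E)%E].

Lemma grid_funD (V : nmodType) N (f g : nat -> V) (t : R) :
  grid_fun N (fun k => f k + g k) t = grid_fun N f t + grid_fun N g t.
Proof. by rewrite -big_split/=; apply: eq_bigr => k _; case: ifP; rewrite ?addr0. Qed.

(** The pointwise bound is asked almost everywhere only, because the adaptedness of a process is
    given in this form. *)
Lemma integral_sqrD (E : set mR) (a b c : mR -> R) (x y : R) : measurable E ->
  measurable_fun E a ->
  measurable_fun E b -> measurable_fun E c ->
  {ae leb, forall t, E t -> a t ^+ 2 <= 2 * b t ^+ 2 + 2 * c t ^+ 2} ->
  (\int[leb]_(t in E) (b t ^+ 2)%:E <= x%:E)%E ->
  (\int[leb]_(t in E) (c t ^+ 2)%:E <= y%:E)%E ->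
  (\int[leb]_(t in E) (a t ^+ 2)%:E <= (2 * x + 2 * y)%:E)%E.
Proof.
move=> mE ma mb mc abc bx cy.
have mb2 : measurable_fun E (fun t => (b t ^+ 2)%:E) by apply/measurable_EFinP; exact: measurable_funX.
have mc2 : measurable_fun E (fun t => (c t ^+ 2)%:E) by apply/measurable_EFinP; exact: measurable_funX.
apply: (@le_trans _ _ (\int[leb]_(t in E) (2%:E * (b t ^+ 2)%:E + 2%:E * (c t ^+ 2)%:E))%E).
  apply: ae_ge0_le_integral => //.
  - by move=> t _; rewrite lee_fin sqr_ge0.
  - by apply/measurable_EFinP; exact: measurable_funX.
  - by move=> t _; rewrite adde_ge0// mule_ge0// lee_fin ?sqr_ge0.
  - by apply: emeasurable_funD; exact: measurable_funeM.
rewrite ge0_integralD//; first last.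
- exact: measurable_funeM.
- by move=> t _; rewrite -EFinM lee_fin mulr_ge0 ?sqr_ge0.
- exact: measurable_funeM.
- by move=> t _; rewrite -EFinM lee_fin mulr_ge0 ?sqr_ge0.
rewrite !ge0_integralZl//; first last.
- by move=> t _; rewrite lee_fin sqr_ge0.
- by move=> t _; rewrite lee_fin sqr_ge0.
rewrite -[leRHS]/(2%:E * x%:E + 2%:E * y%:E)%E.
by apply: leeD; apply: lee_wpmul2l => //; rewrite lee_fin.
Qed.

Lemma adapted_approxD c c' : adapted_approx c -> adapted_approx c' ->
  adapted_approx (fun t => c t + c' t).
Proof.
move=> hc hc' e e0; have e4 : 0 < e / 4 by rewrite divr_gt0.
have [[N HN] [M HM]] := (hc _ e4, hc' _ e4); exists (maxn N M) => K.
rewrite geq_max => /andP[NK MK].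
have [f Ff [b [mb b0 fb bi]]] := HN K NK; have [f' Ff' [b' [mb' b0' fb' bi']]] := HM K MK.
exists (fun k => f k + f' k); first by move=> k; apply: subspaceD (proj1 (cF _)) _ _.
exists (fun t => b t + b' t); split.
- exact: measurable_funD.
- by move=> t Dt; rewrite addr_ge0 ?b0 ?b0'.
- move=> t Dt; rewrite projD grid_funD opprD addrACA.
  by rewrite (le_trans (hnorm_triangle _ _))// lerD ?fb ?fb'.
- have := integral_sqrD mD (measurable_funD mb mb') mb mb' _ bi bi'.
  suff -> : 2 * (e / 4) + 2 * (e / 4) = e by apply; apply: aeW => t Dt; apply: sqr_le_sqrD; rewrite ?addr_ge0 ?b0 ?b0'.
  by field.
Qed.

Lemma adapted_approx0 : adapted_approx (fun=> 0).
Proof.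
move=> e e0; exists 0%N => N _; exists (fun=> 0); first by move=> k; case: (cF (k%:R / N.+1%:R)) => -[].
exists (fun=> 0); split=> //.
  move=> t _; rewrite -(scale0r (0 : H)) projZ !scale0r sub0r Defs.hnormN.
  by rewrite /grid_fun big1 ?hnorm0// => k _; case: ifP.
by rewrite expr0n/= integral0 lee_fin ltW.
Qed.

Lemma integral_grid_fun N (f : nat -> R) : (forall k, 0 <= f k) ->
  (\int[leb]_(t in D) (grid_fun N.+1 f t)%:E <= (\sum_(k < N.+1) f k / N.+1%:R)%:E)%E.
Proof.
move=> f0; pose I k : set mR := `[k%:R / N.+1%:R, k.+1%:R / N.+1%:R[%classic.
have E (t : mR) : (grid_fun N.+1 f t)%:E = (\sum_(k < N.+1) (f k)%:E * (\1_(I k) t)%:E)%E.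
  rewrite /grid_fun -sumEFin; apply: eq_bigr => k _; rewrite -EFinM.
  by rewrite indicE mem_setE in_itv/=; case: ifP; rewrite ?mulr1 ?mulr0.
under eq_integral do rewrite E.
rewrite ge0_integral_sum//; last 2 first.
- by move=> k; apply: measurable_funeM; apply/measurable_EFinP; apply: measurable_indic; exact: measurable_itv.
- by move=> k t _; rewrite -EFinM lee_fin mulr_ge0.
rewrite -sumEFin; apply: lee_sum => k _.
rewrite ge0_integralZl ?lee_fin//; last first.
  by apply/measurable_EFinP; apply: measurable_indic; exact: measurable_itv.
rewrite EFinM lee_wpmul2l ?lee_fin// integral_indic//; last exact: measurable_itv.
apply: (@le_trans _ _ (leb (I k))).
  by apply: le_measure; rewrite ?inE//; [apply: measurableI => //|]; exact: measurable_itv.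
rewrite lebesgue_measure_itv/=; case: ifP => _; rewrite -?EFinD lee_fin ?invr_ge0//.
by rewrite -mulrBl -natrB// subSnn mul1r.
Qed.

(** The projection at time [t] is sandwiched between those at the ends of its cell, so the error
    depends on [t] only through [A], [g] and the cell. This yields a measurable majorant without
    regularity of the projections in time. *)
Lemma hnorm_grid_error (A g : R) x (r s t : R) : 0 <= g <= 1 -> r <= t -> t <= s ->
  hnorm (proj t (A%:C *: x) - g%:C *: proj r x) <=
  `|A - g| * hnorm x + Num.sqrt (hnorm (proj s x) ^+ 2 - hnorm (proj r x) ^+ 2).
Proof.
move=> /andP[g0 g1] rt ts.
have -> : proj t (A%:C *: x) - g%:C *: proj r x =
    (A - g)%:C *: proj t x + g%:C *: (proj t x - proj r x).
  by rewrite projZ rmorphB/= scalerBl scalerBr addrA subrK.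
apply: le_trans (hnorm_triangle _ _) _; rewrite !hnormZ !normc_real; apply: lerD.
  by rewrite ler_wpM2l ?hnorm_proj_le.
have h : hnorm (proj t x - proj r x) <=
    Num.sqrt (hnorm (proj s x) ^+ 2 - hnorm (proj r x) ^+ 2).
  rewrite -[leLHS]ger0_norm ?hnorm_ge0// -sqrtr_sqr; apply: ler_wsqrtr.
  have := proj_increment x rt; have := proj_increment x ts.
  have := sqr_ge0 (hnorm (proj s x - proj t x)).
  move: (hnorm _ ^+ 2) (hnorm _ ^+ 2) (hnorm _ ^+ 2) (hnorm _ ^+ 2) (hnorm _ ^+ 2).
  by move=> p q u v w; lra.
apply: le_trans h; rewrite ger0_norm//; apply: ler_piMl => //; exact: hnorm_ge0.
Qed.

(* Freezing the projection at the left end of each grid cell costs at most the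
   increment of [|proj t x|^2] over the cell, and these increments telescope. *)
Lemma adapted_approx_ind (A : set mR) (x : H) : measurable A ->
  adapted_approx (fun t => ind A t *: x).
Proof.
move=> mA e e0; pose X := hnorm x ^+ 2; have X0 : 0 <= X by exact: sqr_ge0.
(* The weighted L^1 error enters as 4 X e1 <= e / 2, and the projection error as 2 X / (N + 1),
   which is at most e / 2 once N + 1 >= 4 X / e. The denominator X + 1 covers the case X = 0. *)
pose e1 := e / (8 * (X + 1)); have e10 : 0 < e1.
  by apply: divr_gt0 => //; apply: mulr_gt0 => //; rewrite ltr_wpDl.
have [g [cg g01 gA]] := continuous_approx mA e10.
have d0 n : (0 <= \int[leb]_(t in D)
    `|g t - grid_fun n.+1 (fun k => g (k%:R / n.+1%:R)) t|%:E)%E.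
  by apply: integral_ge0 => t _; rewrite lee_fin.
have [N1 HN1] := (proj1 (ereal_cvg0P d0) (sampling_cvg cg g01)) e1 e10.
exists (maxn N1 (Num.truncn (4 * X / e))) => N; rewrite geq_max => /andP[N1N N2N].
pose gn k := g (k%:R / N.+1%:R).
pose a k := hnorm (proj (k%:R / N.+1%:R) x) ^+ 2.
pose en k := a k.+1 - a k.
have en0 k : 0 <= en k.
  have kk : k%:R / N.+1%:R <= k.+1%:R / N.+1%:R :> R.
    by rewrite ler_pM2r ?invr_gt0// ler_nat.
  by rewrite /en /a (proj_increment x kk) addrAC subrr add0r sqr_ge0.
exists (fun k => (gn k)%:C *: proj (k%:R / N.+1%:R) x).
  by move=> k; apply: subspaceZ (proj1 (cF _)) _; exact: proj_in.
pose b1 (t : mR) := `|\1_A t - grid_fun N.+1 gn t| * hnorm x.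
pose b2 (t : mR) := Num.sqrt (grid_fun N.+1 en t).
have mb1 : measurable_fun D b1.
  apply: measurable_funM => //; apply: measurableT_comp => //; apply: measurable_funB.
    exact: measurable_indic.
  exact: measurable_grid_fun.
have mb2 : measurable_fun D b2.
  rewrite /b2; apply: measurableT_comp; last exact: measurable_grid_fun.
  by apply: continuous_measurable_fun; exact: sqrt_continuous.
have b10 t : 0 <= b1 t by rewrite mulr_ge0 ?hnorm_ge0.
have b20 t : 0 <= b2 t by exact: sqrtr_ge0.
exists (fun t => b1 t + b2 t); split.
- exact: measurable_funD.
- by move=> t _; rewrite addr_ge0.
- move=> t; rewrite /= in_itv/= => /andP[t0 t1]; rewrite /b1 /b2 !grid_funE//.
  have /andP[h1 h2] := grid_index_itv (ltn0Sn N) t0.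
  exact: hnorm_grid_error (g01 _) h1 (ltW h2).
have i1 : (\int[leb]_(t in D) (b1 t ^+ 2)%:E <= (X * (e1 + e1))%:E)%E.
  have mA' : measurable_fun D (fun t : mR => `|\1_A t - g t|).
    apply: measurableT_comp => //; apply: measurable_funB; first exact: measurable_indic.
    by apply: measurable_funTS; exact: continuous_measurable_fun.
  have mG : measurable_fun D (fun t : mR => `|g t - grid_fun N.+1 gn t|).
    apply: measurableT_comp => //; apply: measurable_funB.
      by apply: measurable_funTS; exact: continuous_measurable_fun.
    exact: measurable_grid_fun.
  apply: (@le_trans _ _ (\int[leb]_(t in D)
      (X%:E * (`|\1_A t - g t|%:E + `|g t - grid_fun N.+1 gn t|%:E)))%E).
    apply: ge0_le_integral => //.
    - by move=> t _; rewrite lee_fin sqr_ge0.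
    - by apply/measurable_EFinP; exact: measurable_funX.
    - by apply: measurable_funeM; apply: emeasurable_funD; exact/measurable_EFinP.
    move=> t; rewrite /= in_itv/= => /andP[t0 t1].
    rewrite -EFinD -EFinM lee_fin /b1 exprMn mulrC ler_wpM2l// grid_funE//.
    apply: (@le_trans _ _ `|\1_A t - gn (grid_index N.+1 t)|); last exact: ler_distD.
    (* The difference of two numbers in [0, 1] has absolute value at most 1, so its square is
       bounded by the absolute value, and the L^1 approximation controls the L^2 error. *)
    rewrite expr2; apply: ler_piMl => //; rewrite indicE.
    have := g01 ((grid_index N.+1 t)%:R / N.+1%:R); rewrite -/(gn _).
    by case: (t \in A); rewrite ler_norml /=; lra.
  rewrite ge0_integralZl//; last 2 first.
  - by apply: emeasurable_funD; exact/measurable_EFinP.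
  - by move=> t _; rewrite adde_ge0.
  rewrite ge0_integralD//; [|exact/measurable_EFinP|exact/measurable_EFinP].
  rewrite -[leRHS]/(X%:E * (e1%:E + e1%:E))%E.
  by rewrite lee_wpmul2l ?lee_fin// leeD// HN1.
have i2 : (\int[leb]_(t in D) (b2 t ^+ 2)%:E <= (X / N.+1%:R)%:E)%E.
  rewrite (eq_integral (fun t : mR => (grid_fun N.+1 en t)%:E)); last first.
    move=> t /set_mem; rewrite /= in_itv/= => /andP[t0 t1].
    by rewrite /b2 sqr_sqrtr// grid_funE.
  apply: le_trans (integral_grid_fun N en0) _; rewrite lee_fin -mulr_suml.
  rewrite ler_wpM2r ?invr_ge0//.
  (* The increments over all cells add up to at most |x|^2, while each cell has length 1 / (N +
     1). *)
  rewrite -(big_mkord predT en) telescope_sumr//.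
  apply: le_trans (_ : a N.+1 <= _); first by rewrite gerBl sqr_ge0.
  by rewrite /a /X lerXn2r ?nnegrE ?hnorm_ge0// hnorm_proj_le.
have := integral_sqrD mD (measurable_funD mb1 mb2) mb1 mb2 _ i1 i2.
move=> /(_ _)/le_trans; apply.
  by apply: aeW => t _; apply: sqr_le_sqrD => //; exact: addr_ge0.
rewrite lee_fin; apply: approx_arith => //.
by rewrite (le_trans (ltW (truncnS_gt _)))// ler_nat ltnS.
Qed.

Lemma adapted_approx_simple s : simple_function s -> adapted_approx s.
Proof.
move=> [n [A [x [mA ->]]]]; elim: n A x mA => [|n IH] A x mA.
  by rewrite (_ : (fun t => _) = fun=> 0); [exact: adapted_approx0|
    apply/funext => t; rewrite big_ord0].
rewrite (_ : (fun t => _) = fun t => ind (A ord0) t *: x ord0 +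
    \sum_(i < n) (\1_(A (lift ord0 i)) t)%:C *: x (lift ord0 i)); last first.
  by apply/funext => t; rewrite big_ord_recl.
apply: adapted_approxD; first exact: adapted_approx_ind.
by apply: IH => i; exact: mA.
Qed.

Lemma measurable_hnorm (E : set mR) (u : mR -> H) : strongly_measurable E u ->
  measurable_fun E (fun t => hnorm (u t)).
Proof.
move=> su; apply: (eq_measurable_fun (fun t => Num.sqrt (hnorm (u t) ^+ 2))).
  by move=> t _; rewrite sqrtr_sqr ger0_norm// hnorm_ge0.
apply: measurableT_comp; last exact: measurable_hnorm2.
by apply: continuous_measurable_fun; exact: sqrt_continuous.
Qed.

Lemma simple_function_dense (E : set mR) (u : mR -> H) : measurable E -> bochner_L2 E u ->
  forall e : R, 0 < e -> exists2 s, simple_function s &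
    (\int[leb]_(t in E) (hnorm (u t - s t) ^+ 2)%:E <= e%:E)%E.
Proof.
move=> mE [su uoo] e e0; have [s ss sl] := su.
have mu := measurable_hnorm2 su.
have ms k := measurable_hnorm2 (simple_strongly_measurable E (ss k)).
(* Pointwise approximants come without domination, so they are cut off where their norm exceeds 2
   |u|. Where u is nonzero this eventually changes nothing, where u = 0 it leaves 0, and the squared
   error is dominated by 9 |u|^2. *)
pose B k := E `&` [set t | hnorm (s k t) ^+ 2 <= 4 * hnorm (u t) ^+ 2].
have mB k : measurable (B k).
  rewrite /B (_ : [set t | _] = (fun t => 4 * hnorm (u t) ^+ 2 - hnorm (s k t) ^+ 2)
      @^-1` `[0, +oo[%classic).
    have mf : measurable_fun E (fun t => 4 * hnorm (u t) ^+ 2 - hnorm (s k t) ^+ 2).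
      by apply: measurable_funB => //; exact: measurable_funM.
    by apply: mf => //; exact: measurable_itv.
  by apply/seteqP; split=> t /=; rewrite in_itv/= andbT subr_ge0.
pose r k t := ind (B k) t *: s k t.
have sr k : simple_function (r k) by exact: simple_function_restrict.
have bound k t : hnorm (r k t) <= 2 * hnorm (u t).
  rewrite /r; have [Bt|nBt] := pselect (B k t); last first.
    by rewrite (@ind_notin _ _ (B k))// scale0r hnorm0 mulr_ge0 ?hnorm_ge0.
  rewrite (@ind_in _ _ (B k))// scale1r.
  rewrite -(@ler_pXn2r _ 2%N)// ?nnegrE ?mulr_ge0 ?hnorm_ge0//.
  by case: Bt => _ /=; rewrite exprMn; congr (is_true (_ <= _ * _)); ring.
have cr t : E t -> hnorm (u t - r k t) ^+ 2 @[k --> \oo] --> (0 : R).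
  move=> Et; have [u0|u0] := eqVneq (hnorm (u t)) 0.
    rewrite (_ : (fun k => _) = fun=> 0); first exact: cvg_cst.
    apply/funext => k; suff -> : hnorm (u t - r k t) = 0 by rewrite expr0n.
    apply/eqP; rewrite eq_le hnorm_ge0 andbT (le_trans (hnorm_triangle _ _))//.
    by rewrite Defs.hnormN u0 add0r (le_trans (bound _ _))// u0 mulr0.
  have up : 0 < hnorm (u t) by rewrite lt_neqAle eq_sym u0 hnorm_ge0.
  have /hcvgP ht := sl t Et; have [M HM] := ht _ up.
  apply/cvgrPdist_lt => d d0; have [K HK] := ht (Num.min d 1) ltac:(by rewrite lt_min d0 ltr01).
  exists (maxn M K) => // k /=; rewrite geq_max => /andP[Mk Kk].
  have Bt : B k t.
    split=> //=; have h : hnorm (s k t) <= 2 * hnorm (u t).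
      have := hnorm_triangle (s k t - u t) (u t); rewrite subrK => h.
      have := HM k Mk; move: h; move: (hnorm _) (hnorm _) (hnorm _) => a b c; lra.
    rewrite (_ : 4 * _ = (2 * hnorm (u t)) ^+ 2).
      by rewrite lerXn2r ?nnegrE ?mulr_ge0 ?hnorm_ge0.
    by rewrite exprMn; congr (_ * _); ring.
  rewrite sub0r normrN ger0_norm ?sqr_ge0// /r (@ind_in _ _ (B k))// scale1r hnormBC.
  have := HK k Kk; rewrite lt_min => /andP[k1 k2].
  have := hnorm_ge0 (s k t - u t); move: k1 k2; move: (hnorm _) => a; nra.
have a0 k : (0 <= \int[leb]_(t in E) (hnorm (u t - r k t) ^+ 2)%:E)%E.
  by apply: integral_ge0 => t _; rewrite lee_fin sqr_ge0.
have cv : (\int[leb]_(t in E) (hnorm (u t - r k t) ^+ 2)%:E)%E @[k --> \oo] --> 0%E.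
  apply: (dominated_cvg0 (g := fun t => 9 * hnorm (u t) ^+ 2)) => //.
  + move=> k; apply: measurable_hnorm2; apply: strongly_measurableB => //.
    exact: simple_strongly_measurable.
  + exact: measurable_funM.
  + move=> k t _; rewrite sqr_ge0/= (_ : 9 * _ = (3 * hnorm (u t)) ^+ 2); last first.
      by rewrite exprMn; congr (_ * _); ring.
    rewrite lerXn2r ?nnegrE ?mulr_ge0 ?hnorm_ge0//.
    rewrite (le_trans (hnorm_triangle _ _))// Defs.hnormN.
    have := bound k t; move: (hnorm _) (hnorm _) => a b; lra.
  + under eq_integral do rewrite EFinM.
    rewrite ge0_integralZl//; first by rewrite lte_mul_pinfty.
    * exact/measurable_EFinP.
    * by move=> t _; rewrite lee_fin sqr_ge0.
have [N HN] := (proj1 (ereal_cvg0P a0) cv) e e0.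
by exists (r N) => //; exact: HN.
Qed.

Local Notation E := (`[0%R, 1%R]%classic : set mR).

Lemma simple_grid_fun N (f : nat -> H) : simple_function (grid_fun N f : mR -> H).
Proof.
rewrite (_ : grid_fun N f = fun t => \sum_(k < N)
    ind (`[k%:R / N%:R, k.+1%:R / N%:R[%classic : set mR) t *: f k).
  by apply: simple_function_sum => k; apply: simple_function_ind; exact: measurable_itv.
apply/funext => t; apply: eq_bigr => k _; rewrite /ind indicE mem_setE in_itv/=.
by case: ifP; rewrite ?scale1r ?scale0r.
Qed.

(** At almost every time [u t] lies in the filtration, so projecting a nearby simple function there
    does not increase its distance to [u t]; it remains to approximate this projection on a grid. *)
Lemma adapted_dense (u : mR -> H) : bochner_L2 E u ->
  {ae leb, forall t, E t -> F t (u t)} -> forall e : R, 0 < e ->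
  exists N, exists2 f : nat -> H, (forall k, F (k%:R / N.+1%:R) (f k)) &
  (\int[leb]_(t in E) (hnorm (grid_fun N.+1 f t - u t) ^+ 2)%:E <= e%:E)%E.
Proof.
move=> Lu Fu e e0; have e4 : 0 < e / 4 by rewrite divr_gt0.
have mE : measurable E by exact: measurable_itv.
have DE : D `<=` E by move=> t /=; rewrite !in_itv/= => /andP[-> /ltW ->].
have [s ss us] := simple_function_dense mE Lu e4.
have [N HN] := adapted_approx_simple ss e4.
have [f Ff [b [mb b0 fb bi]]] := HN N (leqnn N).
exists N, f => //; have [su uoo] := Lu.
have sE (v : mR -> H) := @simple_strongly_measurable R H E v.
have mg := measurable_hnorm (strongly_measurableB (sE _ (simple_grid_fun N.+1 f)) su).
have mus := measurable_hnorm (strongly_measurableB su (sE _ ss)).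
have mgD := measurable_funS mE DE mg; have musD := measurable_funS mE DE mus.
(* The cells are open on the right, so a grid function vanishes at time 1; this single point does
   not affect the integral. *)
rewrite -integral_itv_bndo_bndc; last by apply/measurable_EFinP; exact: measurable_funX.
have usD : (\int[leb]_(t in D) (hnorm (u t - s t) ^+ 2)%:E <= (e / 4)%:E)%E.
  rewrite integral_itv_bndo_bndc//; apply/measurable_EFinP; exact: measurable_funX.
have := integral_sqrD mD mgD musD mb _ usD bi.
suff -> : 2 * (e / 4) + 2 * (e / 4) = e.
  apply; apply: filterS Fu => t Fu Dt; apply: sqr_le_sqrD; first exact: hnorm_ge0.
  have Ft := Fu (DE _ Dt); rewrite hnormBC.
  apply: le_trans (hnorm_dist _ (proj t (s t)) _) _; apply: lerD; last exact: fb.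
  exact: proj_contract.
by field.
Qed.

End approximation.

End projections.

(** * Duality of the derivative and the integral *)

Section skorokhod_ito.
Variable R : realType.
Local Notation mR := (measurableTypeR R).
Local Notation leb := (@lebesgue_measure R).
Local Notation mH := (@measurable_half_line R).
Local Notation L2C := (L2C R).
Local Notation F_ := (@L2C_filtration R).
Local Notation E := (`[0%R, 1%R]%classic : set mR).

Lemma unit_intervalE : @unit_interval R = E.
Proof. by apply/seteqP; split=> t /=; rewrite in_itv. Qed.

Lemma integral_half_line (f g : mR -> \bar R) : (forall t, E t -> f t = g t) ->
  (forall t, half_line t -> ~ E t -> f t = 0%E) ->
  (\int[leb]_(t in @half_line R) f t = \int[leb]_(t in E) g t)%E.
Proof.
move=> fg f0; rewrite integral_mkcond [RHS]integral_mkcond; congr (integral _ _ _).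
apply/funext => t; rewrite !patchE; have [Et|nEt] := pselect (E t).
  rewrite !mem_set//; first exact: fg.
  by move: Et; rewrite /= in_itv/= => /andP[].
rewrite (memNset nEt); case: ifPn => // /set_mem ht; exact: f0.
Qed.

Lemma simple_process_fun_out (h : simple_process R) t : simple_adapted h -> ~ E t ->
  simple_process_fun h t = 0.
Proof.
move=> ha nE; apply: big1 => k _; case: ifP => // /andP[h1 h2]; exfalso; apply: nE.
have /andP[l0 _] := simple_adapted_time ha (ltnW (ltn_ord k)).
have /andP[_ l1] := simple_adapted_time ha (ltn_ord k).
by rewrite /= in_itv/= (le_trans l0 h1) (le_trans (ltW h2) l1).
Qed.

Section extension.
Variable H : hilbertType R.
Let ext (u : mR -> H) : mR -> H := fun s => if 0 <= s <= 1 then u s else 0.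

Lemma extE u t : E t -> ext u t = u t.
Proof. by rewrite /= in_itv/= /ext => ->. Qed.

Lemma ext_out u t : ~ E t -> ext u t = 0.
Proof.
by move=> nEt; rewrite /ext ifF//; apply/negP => h; apply: nEt; rewrite /= in_itv.
Qed.

Lemma bochner_L2_ext u : bochner_L2 E u -> bochner_L2 (@half_line R) (ext u).
Proof.
move=> [[s ss su] uoo]; split.
  exists (fun k t => ind E t *: s k t).
    by move=> k; apply: simple_function_restrict; [exact: measurable_itv|].
  move=> t ht; have [Et|nEt] := pselect (E t).
    rewrite extE// (_ : (fun k => _) = s ^~ t); first exact: su.
    by apply/funext => k; rewrite (@ind_in _ _ E)// scale1r.
  rewrite ext_out// (_ : (fun k => _) = fun=> 0); first exact: hcvg_cst.
  by apply/funext => k; rewrite (@ind_notin _ _ E)// scale0r.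
rewrite (@integral_half_line _ (fun t => (hnorm (u t) ^+ 2)%:E))// => t.
  by move=> Et; rewrite extE.
by move=> _ nEt; rewrite ext_out// hnorm0 expr0n.
Qed.

Lemma bochner_cvg_ext (h : nat -> mR -> H) u : (forall k t, ~ E t -> h k t = 0) ->
  bochner_cvg E h u -> bochner_cvg (@half_line R) h (ext u).
Proof.
move=> h0; rewrite /bochner_cvg => hu.
rewrite (_ : (fun k => _) = fun k => (\int[leb]_(t in E) (hnorm (h k t - u t) ^+ 2)%:E)%E)//.
apply/funext => k; apply: integral_half_line => t; first by move=> Et; rewrite extE.
by move=> _ nEt; rewrite h0// ext_out// subrr hnorm0 expr0n.
Qed.

End extension.

Let dot_arith (a b p q r s v e : R) : q < e -> q < 1 -> p < e -> p < 1 -> 0 <= b -> 0 <= a ->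
  0 <= p -> 0 <= q -> v <= a * p -> s <= q * b -> r <= q * p -> r + (s + v) <= (1 + a + b) * e.
Proof.
move=> q1 q2 p1 p2 b0 a0 p0 q0 h1 h2 h3.
have : q * p <= e * 1 by apply: ler_pM => //; exact: ltW.
have : q * b <= e * b by rewrite ler_wpM2r// ltW.
have : a * p <= a * e by rewrite ler_wpM2l// ltW.
lra.
Qed.

Lemma hcvg_dot (V : preHilbertType R) (x y : nat -> V) (k l : V) : hcvg x k -> hcvg y l ->
  forall e : R, 0 < e -> exists N, forall n, (N <= n)%N ->
    normc (dot (x n) (y n) - dot k l) <= (1 + hnorm k + hnorm l) * e.
Proof.
move=> /hcvgP hx /hcvgP hy e e0; have m0 : 0 < Num.min e 1 by rewrite lt_min e0 ltr01.
have [[N HN] [M HM]] := (hx _ m0, hy _ m0); exists (maxn N M) => n.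
rewrite geq_max => /andP[/HN + /HM]; rewrite !lt_min => /andP[a1 a2] /andP[b1 b2].
have -> : dot (x n) (y n) - dot k l =
    dot (x n - k) (y n - l) + (dot (x n - k) l + dot k (y n - l)).
  rewrite !dotBr !dotBl; move: (dot _ _) (dot _ _) (dot _ _) (dot _ _) => p q r s.
  by ring.
have n3 (p q r : R[i]) : normc (p + (q + r)) <= normc p + (normc q + normc r).
  by rewrite (le_trans (le_normcD _ _))// lerD2l le_normcD.
apply: le_trans (n3 _ _ _) _.
have := normc_dot_le (x n - k) (y n - l); have := normc_dot_le (x n - k) l.
have := normc_dot_le k (y n - l); have := hnorm_ge0 (x n - k); have := hnorm_ge0 (y n - l).
have := hnorm_ge0 k; have := hnorm_ge0 l; move: a1 a2 b1 b2; exact: dot_arith.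
Qed.

(** Both the element of the domain and the process are approximated, and the two limits are taken
    together. The approximating sequence is arbitrary, so that the lemma also applies to the unknown
    one behind the choice in [ito_integral]. *)
Lemma ito_duality (h : nat -> simple_process R) (u : mR -> L2C) y F G :
  (forall k, simple_adapted (h k)) -> bochner_L2 E u ->
  bochner_cvg E (fun k => simple_process_fun (h k)) u ->
  hcvg (fun k => simple_integral (h k)) y -> derivative F G ->
  dot F y = bochner_dot (@half_line R) G (extend0 u).
Proof.
move=> ha Lu hu hy [LG [Fk [Gk [FG hF hG]]]].
have lim := bochner_dot_cvg mH LG (bochner_L2_ext Lu)
  (fun k => derivative_finite_weakly_measurable (FG k))
  (fun k => simple_strongly_measurable _ (simple_process_simple (h k))) hG
  (bochner_cvg_ext (fun k t => @simple_process_fun_out (h k) t (ha k)) hu).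
apply/eqP; rewrite -subr_eq0; apply/eqP/eq0_normc/eqP; rewrite eq_le normc_ge0 andbT.
apply: (@le_small _ _ (2 + hnorm F + hnorm y)) => e e0.
have [[N HN] [M HM]] := (lim e e0, hcvg_dot hF hy e0).
have := HN _ (leq_maxl N M); have := HM _ (leq_maxr N M).
have := simple_integral_pairing (FG (maxn N M)) (ha (maxn N M)).
rewrite -[X in X = _]/(bochner_dot (@half_line R) _ _) => ->.
move: (dot (Fk _) _) (dot F y) (bochner_dot _ _ _) (hnorm F) (hnorm y).
move=> p q r a b h1 h2.
have -> : q - r = (p - r) - (p - q) by ring.
apply: le_trans (le_normcD _ _) _; rewrite normcN.
move: (normc _) (normc _) h1 h2 => x z; lra.
Qed.

Lemma bochner_L2_simple (H : hilbertType R) n (A : 'I_n -> set mR) (x : 'I_n -> H) :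
  (forall i, measurable (A i)) -> (forall i, (leb (A i) < +oo)%E) ->
  bochner_L2 (@half_line R) (fun t => \sum_(i < n) ind (A i) t *: x i).
Proof.
move=> mA Aoo; set u := fun t => _.
have su : simple_function u by apply: simple_function_sum => i; exact: simple_function_ind.
split; first exact: simple_strongly_measurable.
have sA i : L2half (ind (A i) : mR -> R[i]) by exact: L2half_ind.
have iu : cintegrable leb (@half_line R) (fun t => dot (u t) (u t)).
  rewrite (_ : (fun t => _) = fun t => \sum_(i < n) \sum_(j < n)
      dot (x i) (x j) * ((ind (A i) t)^*%C * ind (A j) t)); last first.
    apply/funext => t; rewrite dot_suml; apply: eq_bigr => i _.
    rewrite dot_sumr; apply: eq_bigr => j _; rewrite dotZl dotZr mulrA.
    exact: mulrC.
  apply: (cintegrable_sum mH) => i; apply: (cintegrable_sum mH) => j.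
  by apply: (cintegrableZ mH); apply: (cintegrable_dot mH); exact: sA.
case: iu => iu _; have := integrable_lty mH iu.
by under eq_integral do rewrite /= -hnorm2.
Qed.

Section wedge_derivative.
Variables (n : nat) (A : 'I_n -> set mR).
Hypothesis mA : forall i, measurable (A i).
Hypothesis Aoo : forall i, (leb (A i) < +oo)%E.

Let w : n.-tuple mR -> R[i] := wedge (fun i => ind (A i)).
Let sA i : L2half (ind (A i) : mR -> R[i]). Proof. exact: L2half_ind. Qed.
Let Lw : Lambda w. Proof. exact: Lambda_wedge. Qed.
(** The graph on finite sums asks for a kernel in every degree: this one is [w] in degree n and 0 in
    all others. *)
Let v m : m.-tuple mR -> R[i] := component m (chaos_val w).

Let vn : @v n = w. Proof. exact: component_chaos_val. Qed.
Let vm m : m != n -> @v m = fun=> 0. Proof. exact: component_chaos_val_neq. Qed.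

Let Lv m : Lambda (@v m).
Proof.
have [->|mn] := eqVneq m n; first by rewrite vn.
by rewrite vm//; exact: Lambda0.
Qed.

Lemma Jn0 m : Jn (fun _ : m.-tuple mR => 0) = 0 :> L2C.
Proof. by apply: gns_inj; rewrite gns_Jn chaos0 (lin0 (@gns_linear R)). Qed.

Lemma derivative_chaos0 m t : derivative_chaos (fun _ : m.-tuple mR => 0) t = 0 :> L2C.
Proof. by case: m => [//|m] /=; rewrite Jn0 scaler0. Qed.

Let JwE : Jn w = \sum_(m < n.+1) Jn (@v m).
Proof.
rewrite big_ord_recr/= vn big1 ?add0r// => m _.
by rewrite vm ?Jn0// ltn_eqF.
Qed.

Let DwE : derivative_chaos w = fun t => \sum_(m < n.+1) derivative_chaos (@v m) t.
Proof.
apply/funext => t; rewrite big_ord_recr/= vn big1 ?add0r// => m _.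
by rewrite vm ?derivative_chaos0// ltn_eqF.
Qed.

Lemma derivative_finite_wedge : derivative_finite (Jn w) (derivative_chaos w).
Proof. by exists n.+1, v; split; [exact: Lv|exact: JwE|exact: DwE]. Qed.

End wedge_derivative.

Lemma bochner_L2_derivative_wedge n (A : 'I_n -> set mR) : (forall i, measurable (A i)) ->
  (forall i, (leb (A i) < +oo)%E) ->
  bochner_L2 (@half_line R) (derivative_chaos (wedge (fun i => ind (A i)))).
Proof.
case: n A => [|n] A mA Aoo.
  have := bochner_L2_simple (fun _ : 'I_0 => 0 : L2C) mA Aoo.
  by congr bochner_L2; apply/funext => t; rewrite big_ord0.
have sA i : L2half (ind (A i) : mR -> R[i]) by exact: L2half_ind.
pose W i := wedge (fun j => ind (A (lift i j))) : n.-tuple mR -> R[i].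
have LW i : Lambda (W i) by apply: Lambda_wedge.
have := bochner_L2_simple (fun i : 'I_n.+1 => (-1) ^+ i *: Jn (W i)) mA Aoo.
congr bochner_L2; apply/funext => t; symmetry.
have Es (s : n.-tuple mR) : n.+1%:R * wedge (fun i => ind (A i)) (tuple_cons (t, s)) =
    \sum_(i < n.+1) ((-1) ^+ i * ind (A i) t) * W i s by rewrite wedge_cons.
have E : (fun s : n.-tuple mR => n.+1%:R * wedge (fun i => ind (A i)) (tuple_cons (t, s))) =
    fun s => \sum_(i < n.+1) ((-1) ^+ i * ind (A i) t) * W i s by apply/funext.
have n0 : n.+1%:R != 0 :> R[i] by rewrite pnatr_eq0.
(* Here the section is a combination of wedges at every time, so the default value of [chaos] never
   enters. *)
have Ls : Lambda (fun s : n.-tuple mR => wedge (fun i => ind (A i)) (tuple_cons (t, s))).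
  have := LambdaZ (n.+1%:R^-1) (Lambda_sum (index_enum (ordinal n.+1))
    (fun i => LambdaZ ((-1) ^+ i * ind (A i) t) (LW i))).
  by congr Lambda; apply/funext => s; rewrite -(Es s) mulKf.
apply: gns_inj; rewrite gns_derivative_chaos /fock_derivative -chaosZ// E.
rewrite chaos_sum; last by move=> i; exact: LambdaZ.
have lG := @gns_linear R; rewrite (lin_sum lG); apply: eq_bigr => i _.
by rewrite (linZ lG) (linZ lG) gns_Jn scalerA mulrC chaosZ.
Qed.

Lemma derivative_wedge n (A : 'I_n -> set mR) : (forall i, measurable (A i)) ->
  (forall i, (leb (A i) < +oo)%E) ->
  derivative (Jn (wedge (fun i => ind (A i)))) (derivative_chaos (wedge (fun i => ind (A i)))).
Proof.
move=> mA Aoo; split; first exact: bochner_L2_derivative_wedge.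
exists (fun=> Jn (wedge (fun i => ind (A i)))).
exists (fun=> derivative_chaos (wedge (fun i => ind (A i)))).
split; [by move=> _; exact: derivative_finite_wedge|exact: hcvg_cst|].
rewrite /bochner_cvg (_ : (fun k => _) = fun=> 0%E); first exact: cvg_cst.
by apply/funext => k; apply: integral0_eq => t _; rewrite subrr hnorm0 expr0n.
Qed.

(* On wedges of indicators the derivative is a simple function, hence they lie in
   the domain of the closure and are total. *)
Lemma derivative_separating (x : L2C) : (forall F G, derivative F G -> dot F x = 0) -> x = 0.
Proof.
move=> h; have cM := closed_dot_eq (gns_unitary x) 0 (@bounded_id R (fock R)).
have g0 y : dot (gns_unitary x) y = dot 0 y.
  apply: (fock_wedge_ind cM) => n A mA Aoo.
  rewrite -[_ (chaos _)]/(dot (gns_unitary x) (chaos _) = dot 0 (chaos _)) dot0l.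
  by rewrite dotC -gns_Jn gns_dot (h _ _ (derivative_wedge mA Aoo)) conjc0.
apply: gns_inj; rewrite (lin0 (@gns_linear R)); apply: dot_eq0.
by rewrite g0 dot0l.
Qed.

Definition grid_process N (f : nat -> L2C) : simple_process R :=
  SimpleProcess N.+1 (fun k => k%:R / N.+1%:R) f.

Lemma grid_process_adapted N f : (forall k, F_ (k%:R / N.+1%:R) (f k)) ->
  simple_adapted (grid_process N f).
Proof.
move=> Ff; split=> /=.
- by rewrite mul0r.
- by rewrite divff// pnatr_eq0.
- by move=> k _; rewrite ler_pM2r ?invr_gt0// ler_nat.
- by move=> k _.
Qed.

Lemma ito_cauchy (h : nat -> simple_process R) (u : mR -> L2C) :
  (forall k, simple_adapted (h k)) -> bochner_L2 E u ->
  bochner_cvg E (fun k => simple_process_fun (h k)) u ->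
  hcauchy (fun k => simple_integral (h k)).
Proof.
move=> ha [su uoo] hu e e0; have mE : measurable E by exact: measurable_itv.
(* Two processes within e^2 / 8 of [u] in squared norm are within 2 (e^2 / 8) + 2 (e^2 / 8) = e^2 /
   2 of each other, which leaves room for a strict inequality. *)
have e8 : 0 < e ^+ 2 / 8 by rewrite divr_gt0// exprn_gt0.
have a0 k : (0 <= \int[leb]_(t in E) (hnorm (simple_process_fun (h k) t - u t) ^+ 2)%:E)%E.
  by apply: integral_ge0 => t _; rewrite lee_fin sqr_ge0.
have [N HN] := (proj1 (ereal_cvg0P a0) hu) _ e8; exists N => m n Nm Nn.
have sh k := simple_strongly_measurable E (simple_process_simple (h k)).
have mh k := measurable_hnorm (strongly_measurableB (sh k) su).
have mmn := measurable_hnorm (strongly_measurableB (sh m) (sh n)).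
have le : (\int[leb]_(t in E) (hnorm (simple_process_fun (h m) t - simple_process_fun (h n) t) ^+ 2)%:E
    <= (2 * (e ^+ 2 / 8) + 2 * (e ^+ 2 / 8))%:E)%E.
  apply: (integral_sqrD mE mmn (mh m) (mh n) _ (HN m Nm) (HN n Nn)).
  apply: aeW => t _; apply: sqr_le_sqrD; first exact: hnorm_ge0.
  by rewrite [X in _ <= _ + X]hnormBC; exact: hnorm_dist.
have := ito_isometry (ha m) (ha n).
rewrite (@integral_half_line _ (fun t =>
  (hnorm (simple_process_fun (h m) t - simple_process_fun (h n) t) ^+ 2)%:E))//; last first.
  by move=> t _ nEt; rewrite !simple_process_fun_out// subrr hnorm0 expr0n.
move=> eq; rewrite -eq lee_fin in le.
rewrite -(@ltr_pXn2r _ 2%N)// ?nnegrE ?hnorm_ge0//; last exact: ltW.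
apply: le_lt_trans le _; have := exprn_gt0 2 e0; move: (e ^+ 2) => x; lra.
Qed.

Lemma ito_exists (u : mR -> L2C) : bochner_L2 E u ->
  {ae leb, forall s, E s -> F_ s (u s)} ->
  exists (h : nat -> simple_process R) y, [/\ forall k, simple_adapted (h k),
    bochner_cvg E (fun k => simple_process_fun (h k)) u & hcvg (fun k => simple_integral (h k)) y].
Proof.
move=> Lu Fu; have dense k := adapted_dense (@filtration_closed R) (@filtration_mono R) Lu Fu
  (e := k.+1%:R^-1) ltac:(by rewrite invr_gt0).
have /choice[h Hh] : forall k, exists h : simple_process R, simple_adapted h /\
    (\int[leb]_(t in E) (hnorm (simple_process_fun h t - u t) ^+ 2)%:E <= (k.+1%:R^-1)%:E)%E.
  move=> k; have [N [f Ff fu]] := dense k; exists (grid_process N f); split=> //.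
  exact: grid_process_adapted.
have ha k := (Hh k).1; exists h.
have hu : bochner_cvg E (fun k => simple_process_fun (h k)) u.
  have a0 k : (0 <= \int[leb]_(t in E) (hnorm (simple_process_fun (h k) t - u t) ^+ 2)%:E)%E.
    by apply: integral_ge0 => t _; rewrite lee_fin sqr_ge0.
  apply/(ereal_cvg0P a0) => e e0; exists (Num.truncn e^-1) => k ek.
  apply: le_trans (Hh k).2 _; rewrite lee_fin invf_ple ?posrE//.
  by rewrite (le_trans (ltW (truncnS_gt _)))// ler_nat ltnS.
have [y hy] : exists y, hcvg (fun k => simple_integral (h k)) y.
  by apply: hcomplete; exact: ito_cauchy hu.
by exists y.
Qed.

End skorokhod_ito.

Theorem proposition4p13 (R : realType) (u : R -> L2C R) (hu : adapted01 u) :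
  dom_divergence (extend0 u) /\ divergence (extend0 u) = ito_integral u.
Proof.
case: hu; rewrite unit_intervalE => Lu Fu.
have [h [y [ha hc hy]]] := ito_exists Lu Fu.
have dual F G : derivative F G -> dot F y = bochner_dot (@half_line R) G (extend0 u).
  exact: (ito_duality ha Lu hc hy).
have unique z : (forall F G, derivative F G ->
    dot F z = bochner_dot (@half_line R) G (extend0 u)) -> z = y.
  move=> hz; apply/eqP; rewrite -subr_eq0; apply/eqP/derivative_separating => F G FG.
  by rewrite dotBr (hz F G FG) (dual F G FG) subrr.
split.
  split; first exact: (bochner_L2_ext Lu).
  exists (hnorm y) => F G FG; rewrite -(dual F G FG) mulrC.
  exact: normc_dot_le.
transitivity y.
  apply: unique; exact: (@xgetPex _ 0 [set x | forall F G, derivative F G ->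
    dot F x = bochner_dot (@half_line R) G (extend0 u)] (ex_intro _ y dual)).
symmetry; apply: unique => F G FG.
(* The sequence behind the chosen integral may differ from [h]. The duality holds along every
   admissible sequence, so this limit is again [y]. *)
have /= [h' [ha' hc' hy']] := @xgetPex _ 0 [set y | exists h : nat -> simple_process R,
    [/\ forall k, simple_adapted (h k),
        bochner_cvg (@unit_interval R) (fun k => simple_process_fun (h k)) u &
        hcvg (fun k => simple_integral (h k)) y]] (ex_intro _ y (ex_intro _ h
  (And3 ha (eq_ind_r (fun D => bochner_cvg D _ u) hc (unit_intervalE R)) hy))).
rewrite unit_intervalE in hc'.
exact: (ito_duality ha' Lu hc' hy' FG).
Qed.
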